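(* Let $\lambda > 0$ and let $R_\lambda = \frac12 \sqrt{\lambda}$. Then the closed ball $\overline B_{R_\lambda}\subset\mathbb R^2$ of radius $R_\lambda$ is the unique (up to translations) minimizer of $\mathcal E^Q_\lambda$ over $\mathcal A$, where $\mathcal E^Q_\lambda(\Omega) = \mathcal H^1(\partial \Omega) + \lambda\, \mathcal I_1(\Omega)$.
   Context: $\mathcal H^1$ is the one-dimensional Hausdorff measure, $\partial\Omega$ is the topological boundary and $|\Omega|$ the Lebesgue measure of $\Omega\subset\mathbb R^2$. $\overline B_R$ (or $\overline B_R(x)$) is a closed ball of radius $R>0$ in $\mathbb R^2$ (centered at $x$). The Riesz capacitary energy is $\mathcal I_1(\Omega):=\inf\left\{\int_\Omega \int_\Omega \frac{d\mu(x)\,d\mu(y)}{|x-y|} : \mu(\Omega)=1\right\}$, the infimum being over probability measures $\mu$ supported on $\Omega$. For $A,B\subset\mathbb R^2$ write $A\sim B$ if $\mathcal H^1(A\setminus B)=\mathcal H^1(B\setminus A)=0$. The admissible class is $\mathcal A := \{ \Omega \subset \mathbb R^2 : \Omega \text{ compact}, |\Omega| > 0, \mathcal H^1(\partial \Omega) < \infty \}/\sim$. Sets in $\mathcal A$ are identified when equivalent under $\sim$; in particular, uniqueness and equality of sets are understood modulo $\sim$. *)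

(* Defs.v *)
From HB Require Import structures.
From mathcomp Require Import all_boot all_order all_algebra.
From mathcomp Require Import all_classical all_reals all_analysis.
Set Implicit Arguments.
Unset Strict Implicit.
Unset Printing Implicit Defensive.
Import Order.TTheory GRing.Theory Num.Theory.
Import numFieldNormedType.Exports.
Local Open Scope classical_set_scope.
Local Open Scope ring_scope.

(* The plane is R * R.  Its library norm is the max norm, so the Euclidean
   distance is defined explicitly; the product topology and the product
   sigma-algebra are the Euclidean topology and its Borel sigma-algebra. *)
Definition eucl_dist (R : realType) (x y : R * R) : R :=
  Num.sqrt ((x.1 - y.1) ^+ 2 + (x.2 - y.2) ^+ 2).

Definition eucl_closed_ball (R : realType) (c : R * R) (r : R) : set (R * R) :=
  [set x | eucl_dist c x <= r].

Definition area (R : realType) : set (R * R) -> \bar R :=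
  (lebesgue_measure \x lebesgue_measure)%E.

Definition boundary (T : topologicalType) (A : set T) : set T :=
  closure A `\` interior A.

(* Adjoining 0 only affects the empty set, whose diameter is then 0 and
   not -oo. *)
Definition eucl_diam (R : realType) (A : set (R * R)) : \bar R :=
  ereal_sup (0%E |` [set (eucl_dist p.1 p.2)%:E | p in A `*` A]).

(* In dimension one the normalizing constant of the Hausdorff measure is 1. *)
Definition hausdorff1_pre (R : realType) (delta : R) (A : set (R * R)) :
    \bar R :=
  ereal_inf [set (\sum_(k <oo) eucl_diam (C k))%E | C in
    [set C : nat -> set (R * R) |
      A `<=` \bigcup_k C k /\ forall k, (eucl_diam (C k) <= delta%:E)%E]].

(* The supremum is the limit as delta -> 0+, by monotonicity in delta. *)
Definition hausdorff1 (R : realType) (A : set (R * R)) : \bar R :=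
  ereal_sup [set hausdorff1_pre delta A | delta in [set d : R | 0 < d]].

(* The inverse is taken in \bar R, so the kernel is +oo on the diagonal. *)
Definition riesz_kernel (R : realType) (x y : R * R) : \bar R :=
  ((eucl_dist x y)%:E^-1)%E.

Definition riesz_energy (R : realType) (Omega : set (R * R)) : \bar R :=
  ereal_inf [set (\int[mu]_(x in Omega) \int[mu]_(y in Omega)
                    riesz_kernel x y)%E | mu in
    [set mu : probability (R * R)%type R | mu Omega = 1%E]].

Definition H1_equiv (R : realType) (A B : set (R * R)) : Prop :=
  hausdorff1 (A `\` B) = 0%E /\ hausdorff1 (B `\` A) = 0%E.

(* Representatives of the admissible class; the quotient by H1_equiv is
   handled by stating uniqueness of minimizers up to H1_equiv. *)
Definition admissible (R : realType) (Omega : set (R * R)) : Prop :=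
  [/\ compact Omega, (0 < area Omega)%E &
      (hausdorff1 (boundary Omega) < +oo)%E].

Definition energyQ (R : realType) (lambda : R) (Omega : set (R * R)) :
    \bar R :=
  (hausdorff1 (boundary Omega) + lambda%:E * riesz_energy Omega)%E.

Definition is_minimizer (R : realType) (lambda : R) (Omega : set (R * R)) :
    Prop :=
  admissible Omega /\
  forall Omega', admissible Omega' ->
    (energyQ lambda Omega <= energyQ lambda Omega')%E.

(* Main.v *)
Require Import Defs.
From HB Require Import structures.
From mathcomp Require Import all_boot all_order all_algebra.
From mathcomp Require Import all_classical all_reals all_analysis.
From mathcomp Require Import measurable_realfun.
From mathcomp Require Import ring lra.
Set Implicit Arguments.
Unset Strict Implicit.
Unset Printing Implicit Defensive.
Import Order.TTheory GRing.Theory Num.Theory.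
Import numFieldNormedType.Exports.
Local Open Scope classical_set_scope.
Local Open Scope ring_scope.

(** The two terms of the functional are compared direction by direction. Let [G] be the
    interior of [Omega] and let [w t] be the length of its shadow, that is of its
    projection to a line orthogonal to the direction [dir t].

    Perimeter. Almost every line that meets [G] crosses the boundary at least twice, so
    the Hausdorff measure of the boundary is at least the integral of [w] over the
    directions in [0, pi] (a Cauchy-Crofton inequality). A line that leaves [Omega] and
    comes back to [G] counts twice; the offsets of these lines form the notch. The
    boundary is an arbitrary compact set of finite length, so this is proved for the
    smoothed indicator of [G] ([smooth_step_le], [smooth_increments_ge]), with all the
    directions of a grid at once, and the scales tend to 0 ([sum_shadows_le],
    [perimeter_ge]).

    Capacitary energy. The Riesz kernel is the integral over the directions of the Poisson
    kernels of the projections, as their width tends to 0 ([poisson_average]); the energy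
    of a measure [mu] is thus an integral of squared L2 norms of smoothed projections of
    [mu]. Completing the square against a competitor on each shadow bounds each of them
    below ([poisson_energy_ge], [energy_ge]); the constant competitor [1 / w t] gives
    [1 / w t], so that the energy is at least the integral of [1 / w]. A measure of finite
    energy does not charge the boundary ([energy_null]), so only shadows of [G] matter.

    Together, [energyQ] is at least the integral of [w + lambda / w] over [0, pi], hence at
    least [2 * pi * sqrt lambda] ([energyQ_lower]). For the ball of radius
    [sqrt lambda / 2] this value is attained ([energyQ_ball]): the projections of its
    equilibrium measure are all uniform, which bounds the potential
    ([riesz_energy_ball]).

    Uniqueness. If the bound is attained, there are no notches, so [G] is convex
    ([interior_convex]), and [w] is constant ([width_const]). Competitors that are affine
    instead of constant are also admissible as long as the slopes cancel in the sum over
    the directions; they show that the middles of the shadows of [G] are the coordinates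
    of a point ([center_deviation], [mid_linear]). Thus [G] has the support function of a
    ball of radius [sqrt lambda / 2], and [Omega] contains that ball. Comparison of the
    lower bound for all parameters [lambda] shows that the boundary of [Omega] is not longer
    than the circle ([perimeter_le]). As it contains the circle, the rest of [Omega] has
    length zero ([H1_equiv_ball]). *)

(** * Lebesgue measure on the line and in the plane *)

Section lebesgue_line.
Context {R : realType}.

(** The Lebesgue measure on the canonical Borel structure of [R], the one that the
    measurability of functions on the plane refers to; [lebesgue_measure] itself is
    a measure for a generated structure with the same measurable sets. *)
Definition leb (A : set R) : \bar R := lebesgue_measure A.

Let leb_semi_sigma_additive : semi_sigma_additive (leb : set R -> \bar R).
Proof. exact: (@measure_semi_sigma_additive _ _ _ (@lebesgue_measure R)). Qed.

HB.instance Definition _ := isMeasure.Build _ R R leb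
  (measure0 (@lebesgue_measure R)) (measure_ge0 (@lebesgue_measure R))
  leb_semi_sigma_additive.

Let leb_sigma_finite : sigma_finite [set: R] leb.
Proof. exact: (sigma_finiteT (@lebesgue_measure R)). Qed.

HB.instance Definition _ := Measure_isSigmaFinite.Build _ R R leb leb_sigma_finite.

Lemma integral_leb (D : set R) (f : R -> \bar R) : measurable D ->
  measurable_fun D f -> (forall x, D x -> 0 <= f x)%E ->
  (\int[leb]_(x in D) f x = \int[lebesgue_measure]_(x in D) f x)%E.
Proof.
move=> mD mf f0.
have mid : measurable_fun [set: measurableTypeR R] (id : measurableTypeR R -> R).
  by [].
have := @ge0_integral_pushforward _ _ _ _ R _ mid (@lebesgue_measure R) D f mD mf.
rewrite preimage_id; apply => y /set_mem; exact: f0.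
Qed.

Lemma leb_itv (a b : R) (x y : bool) : a <= b ->
  leb [set` Interval (BSide x a) (BSide y b)] = (b - a)%:E.
Proof.
move=> ab; rewrite /leb lebesgue_measure_itv/= lte_fin.
case: ltP => // ba; have -> : a = b by apply/eqP; rewrite eq_le ab.
by rewrite subrr.
Qed.

End lebesgue_line.

Section plane_measure.
Context {R : realType}.
Local Notation leb := (@leb R).
Local Notation leb2 := (leb \x leb)%E.

Lemma open_measurable_plane (U : set (R * R)) : open U -> measurable U.
Proof.
move=> oU.
pose box (q : (rat * rat) * (rat * rat)) : set (R * R) :=
  ball (ratr q.1.1 : R) (ratr q.1.2) `*` ball (ratr q.2.1 : R) (ratr q.2.2).
have -> : U = \bigcup_(q : (rat * rat) * (rat * rat))
    (if `[< box q `<=` U >] then box q else set0).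
  apply/seteqP; split => [[x y] Uxy|z [q _]]; last first.
    by case: ifPn => // /asboolP + zq; exact.
  have [[A B]/= [nA nB] ABU] : nbhs (x, y) U by exact: open_nbhs_nbhs.
  have [c [r [/set_mem xB BA]]] :=
    @open_subball_rat R A^° x (open_interior A) (mem_set nA).
  have [c' [r' [/set_mem yB' B'B]]] :=
    @open_subball_rat R B^° y (open_interior B) (mem_set nB).
  exists ((c, r), (c', r')) => //=; rewrite ifT//.
  apply/asboolP => -[u v] [/= uB vB']; apply: ABU; split => /=.
    exact: interior_subset (BA _ uB).
  exact: interior_subset (B'B _ vB').
apply: countable_bigcupT_measurable => // q; case: ifPn => // _.
by apply: measurableX; exact: measurable_ball.
Qed.

Lemma closed_measurable_plane (U : set (R * R)) : closed U -> measurable U.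
Proof.
by move=> cU; rewrite -(setCK U); apply: measurableC;
  apply: open_measurable_plane; exact: closed_openC.
Qed.

Lemma compact_measurable_plane (U : set (R * R)) : compact U -> measurable U.
Proof. by move=> cU; apply: closed_measurable_plane; apply: compact_closed. Qed.

Lemma continuous_measurable_plane (f : R * R -> R) :
  continuous f -> measurable_fun setT f.
Proof.
move=> cf; apply: (@measurability _ _ _ _ _ _ _ (RGenOInfty.measurableE R)).
move=> _ [_ [r ->] <-]; rewrite setTI; apply: open_measurable_plane.
by move/continuousP: cf; apply; exact: interval_open.
Qed.

Lemma integral_translation (f : R -> \bar R) (a : R) :
  measurable_fun [set: R] f -> (forall x, 0 <= f x)%E ->
  (\int[leb]_x f (x + a)%R = \int[leb]_x f x)%E.
Proof.
move=> mf f0.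
have ms : measurable_fun [set: R] (fun x : R => x + a).
  by apply: measurable_funD.
have := @ge0_integral_pushforward _ _ _ _ R _ ms leb setT f measurableT mf
  (fun y _ => f0 y).
rewrite preimage_setT => <-.
apply: eq_measure_integral => A mA _; apply/esym.
have mm : measurable_fun [set: R] (fun x : R => x + a : measurableTypeR R) by [].
pose m' : measure (measurableTypeR R) R :=
  measure_function_pushforward__canonical__measure_function_Measure leb mm.
apply: (@lebesgue_measure_unique R m') => //.
move=> _ [[b c] _ <-]; cbn [fst snd].
have e : [set x : R | x + a \in `]b, c]%R] = `]b - a, c - a]%classic.
  apply/seteqP; split => x /=; rewrite !in_itv/=; lra.
have -> : m' `]b, c]%classic = leb `]b - a, c - a]%classic by rewrite -e.
rewrite /leb !lebesgue_measure_itv/= !lte_fin ltrD2r; case: ifPn => // _.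
by rewrite -!EFinB; congr (_%:E); ring.
Qed.

Let iterate1 (f : R * R -> \bar R) :
  measurable_fun [set: R * R] f -> (forall x, 0 <= f x)%E ->
  (\int[leb2]_x f x = \int[leb]_x \int[leb]_y f (x, y))%E.
Proof. exact: fubini_tonelli1. Qed.

Let iterate2 (f : R * R -> \bar R) :
  measurable_fun [set: R * R] f -> (forall x, 0 <= f x)%E ->
  (\int[leb2]_x f x = \int[leb]_y \int[leb]_x f (x, y))%E.
Proof. exact: fubini_tonelli2. Qed.

Lemma integral2_translation (f : R * R -> \bar R) (v : R * R) :
  measurable_fun [set: R * R] f -> (forall x, 0 <= f x)%E ->
  (\int[leb2]_x f (x + v)%R = \int[leb2]_x f x)%E.
Proof.
move=> mf f0.
have mfv : measurable_fun [set: R * R] (fun x : R * R => f (x.1 + v.1, x.2 + v.2)%R).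
  by apply: (measurableT_comp mf); apply: measurable_fun_pair;
    apply: measurable_funD.
rewrite (iterate1 mfv (fun=> f0 _)) (iterate1 mf f0).
rewrite -[RHS](integral_translation v.1).
- apply: eq_integral => x _; rewrite -[RHS](integral_translation v.2)//.
  exact: measurable_fun_pair2.
- exact: measurable_fun_fubini_tonelli_F.
- by move=> x; exact: integral_ge0.
Qed.

Lemma integral2_shear1 (f : R * R -> \bar R) (a : R) :
  measurable_fun [set: R * R] f -> (forall x, 0 <= f x)%E ->
  (\int[leb2]_x f (x.1 + a * x.2, x.2)%R = \int[leb2]_x f x)%E.
Proof.
move=> mf f0.
have mfv : measurable_fun [set: R * R] (fun x : R * R => f (x.1 + a * x.2, x.2)%R).
  apply: (measurableT_comp mf); apply: measurable_fun_pair; last exact: measurable_snd.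
  apply: measurable_funD; first exact: measurable_fst.
  by apply: measurable_funM => //; exact: measurable_snd.
rewrite (iterate2 mfv (fun=> f0 _)) (iterate2 mf f0); apply: eq_integral => y _ /=.
rewrite (@integral_translation (fun x => f (x, y)) (a * y))//.
exact: measurable_fun_pair1.
Qed.

Lemma integral2_shear2 (f : R * R -> \bar R) (a : R) :
  measurable_fun [set: R * R] f -> (forall x, 0 <= f x)%E ->
  (\int[leb2]_x f (x.1, x.2 + a * x.1)%R = \int[leb2]_x f x)%E.
Proof.
move=> mf f0.
have mfv : measurable_fun [set: R * R] (fun x : R * R => f (x.1, x.2 + a * x.1)%R).
  apply: (measurableT_comp mf); apply: measurable_fun_pair; first exact: measurable_fst.
  apply: measurable_funD; first exact: measurable_snd.
  by apply: measurable_funM => //; exact: measurable_fst.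
rewrite (iterate1 mfv (fun=> f0 _)) (iterate1 mf f0); apply: eq_integral => y _ /=.
rewrite (@integral_translation (fun x => f (y, x)) (a * y))//.
exact: measurable_fun_pair2.
Qed.

Definition rot (c s : R) (x : R * R) : R * R :=
  (c * x.1 - s * x.2, s * x.1 + c * x.2).

Lemma measurable_rot c s : measurable_fun [set: R * R] (rot c s).
Proof.
by apply: measurable_fun_pair; [apply: measurable_funB|apply: measurable_funD];
  apply: measurable_funM.
Qed.

(** The rotation by [theta] is the product of the shears of slopes [- tan (theta / 2)],
    [sin theta] and [- tan (theta / 2)]. *)
Lemma integral2_rot_neqN1 (f : R * R -> \bar R) (c s : R) : c != -1 ->
  c ^+ 2 + s ^+ 2 = 1 ->
  measurable_fun [set: R * R] f -> (forall x, 0 <= f x)%E ->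
  (\int[leb2]_x f (rot c s x) = \int[leb2]_x f x)%E.
Proof.
move=> cN1 cs mf f0.
have c1 : 1 + c != 0 by apply: contra_neq cN1 => h; lra.
pose t := s / (1 + c).
have m1 : measurable_fun [set: R * R] (fun x : R * R => (x.1 + - t * x.2, x.2)%R).
  apply: measurable_fun_pair; last exact: measurable_snd.
  apply: measurable_funD; first exact: measurable_fst.
  by apply: measurable_funM => //; exact: measurable_snd.
have m2 : measurable_fun [set: R * R] (fun x : R * R => (x.1, x.2 + s * x.1)%R).
  apply: measurable_fun_pair; first exact: measurable_fst.
  apply: measurable_funD; first exact: measurable_snd.
  by apply: measurable_funM => //; exact: measurable_fst.
rewrite -[RHS](integral2_shear1 (- t))//.
rewrite -[RHS](@integral2_shear2 (fun x => f (x.1 + - t * x.2, x.2)%R) s)//;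
  last exact: (measurableT_comp mf m1).
rewrite -[RHS](@integral2_shear1 (fun x => f (x.1 + - t * (x.2 + s * x.1),
  x.2 + s * x.1)%R) (- t))//; last first.
  exact: (measurableT_comp (measurableT_comp mf m1) m2).
have ts : t * s = 1 - c.
  rewrite /t mulrAC -expr2; have -> : s ^+ 2 = (1 - c) * (1 + c) by lra.
  by rewrite mulfK.
have tc : t * (1 + c) = s by rewrite /t mulfVK.
apply: eq_integral => x _; apply: congr1; case: x => x y; rewrite /rot.
cbn [fst snd].
congr pair; last first.
  rewrite mulrDr (_ : s * (- t * y) = - (t * s) * y); last by ring.
  by rewrite ts; ring.
transitivity (x - t * y - t * y - (t * s) * x + t * (t * s) * y); last by ring.
rewrite ts -{1}tc; ring.
Qed.

(** Rotations preserve the area: every rotation but the half-turn is a product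
    of three shears, and the half-turn is the square of a quarter-turn. *)
Lemma integral2_rot (f : R * R -> \bar R) (c s : R) :
  c ^+ 2 + s ^+ 2 = 1 ->
  measurable_fun [set: R * R] f -> (forall x, 0 <= f x)%E ->
  (\int[leb2]_x f (rot c s x) = \int[leb2]_x f x)%E.
Proof.
move=> cs mf f0; have [cN1|] := eqVneq c (-1); last first.
  by move=> cN1; exact: integral2_rot_neqN1.
have s0 : s = 0.
  by apply/eqP; rewrite -sqrf_eq0; apply/eqP; move: cs; rewrite cN1; lra.
have N1 : (0 : R) != -1 by apply/eqP; lra.
have e1 : (0 : R) ^+ 2 + 1 ^+ 2 = 1 by ring.
rewrite -[RHS](integral2_rot_neqN1 N1 e1)//.
rewrite -[RHS](@integral2_rot_neqN1 (f \o rot 0 1) _ _ N1 e1); last 2 first.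
- exact: (measurableT_comp mf (measurable_rot 0 1)).
- by move=> x; exact: f0.
apply: eq_integral => x _; apply: (congr1 f); case: x => x y; rewrite /rot.
cbn [fst snd]; rewrite cN1 s0; congr pair; ring.
Qed.
End plane_measure.

(** * Euclidean geometry of the plane *)

Section euclidean_plane.
Context {R : realType}.
Implicit Types x y z v : R * R.

Definition dotp x y : R := x.1 * y.1 + x.2 * y.2.
Definition nrm x : R := Num.sqrt (dotp x x).

Lemma dotp_ge0 x : 0 <= dotp x x.
Proof. by rewrite /dotp -!expr2 addr_ge0// sqr_ge0. Qed.

Lemma nrm_ge0 x : 0 <= nrm x. Proof. exact: sqrtr_ge0. Qed.

Lemma sqr_nrm x : nrm x ^+ 2 = dotp x x.
Proof. by rewrite sqr_sqrtr// dotp_ge0. Qed.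

Lemma dotp_le x y : dotp x y <= nrm x * nrm y.
Proof.
apply: le_trans (ler_norm _) _; rewrite -sqrtr_sqr -sqrtrM ?dotp_ge0//.
rewrite ler_wsqrtr// /dotp; case: x y => [a b] [c d] /=.
have := sqr_ge0 (a * d - b * c); nra.
Qed.

Lemma nrmN x : nrm (- x) = nrm x.
Proof. by rewrite /nrm /dotp /= !mulrNN. Qed.

Lemma dotp_abs_le x y : `|dotp x y| <= nrm x * nrm y.
Proof.
rewrite ler_norml dotp_le andbT lerNl.
have -> : - dotp x y = dotp (- x) y by rewrite /dotp /=; ring.
by rewrite -(nrmN x) dotp_le.
Qed.

Lemma le_nrmP x (r : R) : 0 <= r -> (nrm x <= r) = (dotp x x <= r ^+ 2).
Proof. by move=> r0; rewrite -sqr_nrm ler_sqr// nnegrE// nrm_ge0. Qed.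

Lemma nrmD x y : nrm (x + y) <= nrm x + nrm y.
Proof.
rewrite le_nrmP ?addr_ge0 ?nrm_ge0//.
have -> : dotp (x + y) (x + y) = dotp x x + dotp x y *+ 2 + dotp y y.
  by rewrite /dotp /=; ring.
rewrite sqrrD !sqr_nrm lerD2r lerD2l lerMn2r /= dotp_le//.
Qed.

Lemma nrm_eq0 x : (nrm x == 0) = (x == 0).
Proof.
rewrite -sqrf_eq0 sqr_nrm /dotp -!expr2 paddr_eq0 ?sqr_ge0// !sqrf_eq0.
by case: x.
Qed.

Lemma nrm0 : nrm (0 : R * R) = 0. Proof. by apply/eqP; rewrite nrm_eq0. Qed.

Lemma nrm_scale (a : R) x : nrm (a * x.1, a * x.2) = `|a| * nrm x.
Proof.
rewrite /nrm -sqrtr_sqr -sqrtrM ?sqr_ge0//; congr Num.sqrt.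
by rewrite /dotp /=; ring.
Qed.

Lemma nrm_fst x : `|x.1| <= nrm x.
Proof.
rewrite -sqrtr_sqr ler_wsqrtr// /dotp -!expr2 lerDl sqr_ge0//.
Qed.

Lemma nrm_snd x : `|x.2| <= nrm x.
Proof.
rewrite -sqrtr_sqr ler_wsqrtr// /dotp -!expr2 lerDr sqr_ge0//.
Qed.

Lemma nrm_le_add x : nrm x <= `|x.1| + `|x.2|.
Proof.
rewrite le_nrmP ?addr_ge0// /dotp -!expr2 -(real_normK (num_real x.1))
  -(real_normK (num_real x.2)) sqrrD.
by rewrite -addrA lerD2l lerDr mulrn_wge0// mulr_ge0.
Qed.

Lemma eucl_distE x y : eucl_dist x y = nrm (x - y).
Proof. by rewrite /eucl_dist /nrm /dotp /= !expr2. Qed.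

Lemma eucl_dist_ge0 x y : 0 <= eucl_dist x y.
Proof. by rewrite eucl_distE nrm_ge0. Qed.

Lemma eucl_distC x y : eucl_dist x y = eucl_dist y x.
Proof. by rewrite !eucl_distE -nrmN opprB. Qed.

Lemma eucl_dist_triangle y x z : eucl_dist x z <= eucl_dist x y + eucl_dist y z.
Proof.
rewrite !eucl_distE; have -> : x - z = (x - y) + (y - z) by rewrite addrA subrK.
exact: nrmD.
Qed.

Lemma eucl_distxx x : eucl_dist x x = 0.
Proof. by rewrite eucl_distE subrr nrm0. Qed.

(** The Euclidean norm and the maximum norm of the product are equivalent. *)
Lemma nbhs_eucl x (A : set (R * R)) :
  nbhs x A <-> exists2 e : R, 0 < e & forall y, eucl_dist x y < e -> A y.
Proof.
split.
  move=> /nbhs_ballP[e /= e0 eA]; exists e => // y xy; apply: eA.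
  rewrite eucl_distE in xy.
  split; rewrite /ball /=.
    exact: le_lt_trans (nrm_fst (x - y)) xy.
  exact: le_lt_trans (nrm_snd (x - y)) xy.
move=> [e e0 eA]; apply/nbhs_ballP; exists (e / 2) => /=; first by rewrite divr_gt0.
move=> y [xy1 xy2]; apply: eA; rewrite eucl_distE.
apply: le_lt_trans (nrm_le_add _) _.
rewrite /ball /= in xy1 xy2.
by rewrite (splitr e); exact: ltrD.
Qed.

Lemma open_euclP (A : set (R * R)) :
  open A <-> forall x, A x -> exists2 e : R, 0 < e & forall y, eucl_dist x y < e -> A y.
Proof.
rewrite openE; split => h x Ax; first by apply/nbhs_eucl; exact: h.
by apply/nbhs_eucl; exact: h.
Qed.

Lemma continuous_plane_lip (f : R * R -> R) (k : R) :
  (forall x y, `|f x - f y| <= k * eucl_dist x y) -> continuous f.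
Proof.
move=> fk x; apply/cvgrPdist_lt => e e0.
pose k' := `|k| + 1; have k'0 : 0 < k' by rewrite /k' ltr_wpDl.
apply/nbhs_eucl; exists (e / k'); first by rewrite divr_gt0.
move=> y xy; apply: le_lt_trans (fk _ _) _.
apply: (@le_lt_trans _ _ (k' * eucl_dist x y)).
  rewrite ler_wpM2r ?eucl_dist_ge0// /k'.
  by apply: le_trans (ler_norm k) _; rewrite lerDl.
by rewrite mulrC -ltr_pdivlMr.
Qed.

Lemma eucl_dist_lip x y z : `|eucl_dist x z - eucl_dist y z| <= eucl_dist x y.
Proof.
rewrite ler_norml; apply/andP; split.
  have := eucl_dist_triangle x y z; rewrite (eucl_distC y x); lra.
have := eucl_dist_triangle y x z; lra.
Qed.

Lemma continuous_dist z : continuous (fun x => eucl_dist x z).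
Proof.
by apply: (@continuous_plane_lip _ 1) => x y; rewrite mul1r eucl_dist_lip.
Qed.

Lemma closed_eucl_closed_ball x (r : R) : closed (eucl_closed_ball x r).
Proof.
have -> : eucl_closed_ball x r = (fun y => eucl_dist y x) @^-1` [set t | t <= r].
  by apply/seteqP; split => y; rewrite /eucl_closed_ball /= eucl_distC.
by apply: (closed_comp _ (@closed_le R r)) => y _; exact: continuous_dist.
Qed.

Lemma compact_eucl_closed_ball x (r : R) : compact (eucl_closed_ball x r).
Proof.
apply: (@subclosed_compact _ _ (`[x.1 - r, x.1 + r] `*` `[x.2 - r, x.2 + r])).
- exact: closed_eucl_closed_ball.
- by apply: compact_setX; exact: segment_compact.
- move=> y; rewrite /eucl_closed_ball /= eucl_distE => xyr.
  have /ler_normlP[h1 h2] := le_trans (nrm_fst _) xyr.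
  have /ler_normlP[h3 h4] := le_trans (nrm_snd _) xyr.
  move: h1 h2 h3 h4; rewrite /= !in_itv /=; split; apply/andP; split; lra.
Qed.

Lemma compact_bounded_plane (A : set (R * R)) : compact A ->
  exists2 D : R, 0 < D & forall x, A x -> nrm x <= D.
Proof.
move=> cA; have [->|/set0P A0] := eqVneq A set0; first by exists 1.
have cn : {within A, continuous (fun x => eucl_dist x 0)}.
  by apply: continuous_subspaceT; exact: continuous_dist.
have [x _ xM] := compact_EVT_max A0 cA cn.
exists (eucl_dist x 0 + 1); first by rewrite ltr_wpDl// eucl_dist_ge0.
move=> y Ay; have := xM y (mem_set Ay); rewrite !eucl_distE !subr0; lra.
Qed.

Lemma itv_measurable_box (a b c d : R) : a <= b -> c <= d ->
  (leb \x leb)%E (`[a, b]%classic `*` `[c, d]%classic : set (R * R))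
  = ((b - a) * (d - c))%:E.
Proof.
by move=> ab cd; rewrite product_measure1E//= !leb_itv.
Qed.
End euclidean_plane.

(** * Segments crossing a boundary *)

Section crossing.
Context {R : realType}.
Implicit Types x y z v w : R * R.

Definition sc (t : R) v : R * R := (t * v.1, t * v.2).

Lemma nrm_sc t v : nrm (sc t v) = `|t| * nrm v.
Proof. exact: nrm_scale. Qed.

Lemma eucl_dist_sc x v (t s : R) :
  eucl_dist (x + sc t v) (x + sc s v) = `|t - s| * nrm v.
Proof.
rewrite eucl_distE -nrm_scale; congr nrm.
by apply/eqP; rewrite xpair_eqE /=; apply/andP; split; apply/eqP => /=; ring.
Qed.

(** Consider the first point of the segment outside of the interior. *)
Lemma segment_meets_boundary (A : set (R * R)) x v :
  interior A x -> ~ interior A (x + v) ->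
  exists t : R, [/\ 0 <= t, t <= 1 & boundary A (x + sc t v)].
Proof.
move=> Ax Axv.
pose S := [set t : R | 0 <= t /\ ~ interior A (x + sc t v)].
have S1 : S 1 by split => //; rewrite /sc !mul1r -surjective_pairing.
have Sinf : has_inf S by split; [exists 1|exists 0 => t []].
pose t := inf S.
have t0 : 0 <= t by apply: lb_le_inf; [exists 1|move=> s []].
have tle s : S s -> t <= s by move=> Ss; apply: ge_inf => //; case: Sinf.
have bef s : 0 <= s -> s < t -> interior A (x + sc s v).
  move=> s0 st; apply: contrapT => nA; have := tle s (conj s0 nA); lra.
have v0 : 0 <= nrm v by exact: nrm_ge0.
have oA := @open_interior _ A.
have nt : ~ interior A (x + sc t v).
  move=> /(proj1 (open_euclP _) oA)[e e0 eA].
  have [s Ss st] : exists2 s, S s & s < t + e / (nrm v + 1).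
    by apply: inf_adherent => //; rewrite divr_gt0// ltr_wpDl.
  have := Ss.2; apply; apply: eA; rewrite eucl_dist_sc.
  have ts := tle s Ss; rewrite ler0_norm; last lra.
  have h : s - t < e / (nrm v + 1) by lra.
  have : (s - t) * (nrm v + 1) < e by rewrite -ltr_pdivlMr// ltr_wpDl.
  nra.
have t_gt0 : 0 < t.
  rewrite lt_neqAle t0 andbT; apply/eqP => h; apply: nt; rewrite -h /sc !mul0r.
  by rewrite (_ : (0, 0) = 0)// addr0.
exists t; split => //; first exact: tle.
split => // B /nbhs_eucl[e e0 eB].
pose s := Num.max 0 (t - e / (2 * (nrm v + 1))).
have pos : 0 < e / (2 * (nrm v + 1)) by rewrite divr_gt0// mulr_gt0// ltr_wpDl.
have s0 : 0 <= s by rewrite /s le_max lexx.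
have st : s < t by rewrite /s gt_max t_gt0 /= ltrBlDr ltrDl.
have ts : t - s <= e / (2 * (nrm v + 1)).
  by rewrite lerBlDr -lerBlDl /s le_max lexx orbT.
exists (x + sc s v); split; first exact: interior_subset (bef _ s0 st).
apply: eB; rewrite eucl_dist_sc ger0_norm ?subr_ge0 ?ltW//.
have : (t - s) * (2 * (nrm v + 1)) <= e by rewrite -ler_pdivlMr// mulr_gt0// ltr_wpDl.
have : 0 < t - s by rewrite subr_gt0.
nra.
Qed.
End crossing.

(** * A smoothing kernel *)

Section kernel.
Context {R : realType}.
Implicit Types x y z v w : R * R.
Variable a : R.

Definition bump_root z : R := Num.max 0 (a ^+ 2 - dotp z z).
Local Notation q := bump_root.

(** A compactly supported kernel with a Lipschitz gradient. *)
Definition bump z : R := q z ^+ 2.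

Definition bump_lip : R := 2 * a ^+ 2 * (2 * a + 3) + a ^+ 4.
Definition bump_curv : R := (2 * a + 3) ^+ 2 + 2 * a ^+ 2.

Lemma bump_curv_ge0 : 0 <= bump_curv.
Proof. by rewrite addr_ge0 ?sqr_ge0// mulr_ge0 ?sqr_ge0. Qed.

Lemma bump_lip_ge0 : 0 < a -> 0 <= bump_lip.
Proof.
move=> a0; have h : 0 <= 2 * a + 3 by lra.
apply: addr_ge0; last by rewrite exprn_even_ge0.
by apply: mulr_ge0 => //; apply: mulr_ge0 => //; exact: sqr_ge0.
Qed.

Let q_ge0 z : 0 <= q z. Proof. by rewrite /bump_root le_max lexx. Qed.
Let q_le z : q z <= a ^+ 2.
Proof. by rewrite /bump_root ge_max sqr_ge0 /=; have := dotp_ge0 z; lra. Qed.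

Lemma bump_ge0 z : 0 <= bump z. Proof. exact: sqr_ge0. Qed.

Lemma bump_le z : bump z <= a ^+ 4.
Proof.
have -> : a ^+ 4 = (a ^+ 2) ^+ 2 by ring.
by rewrite /bump ler_sqr ?nnegrE ?q_ge0 ?sqr_ge0.
Qed.

Lemma bump_eq0 z : 0 < a -> a <= nrm z -> bump z = 0.
Proof.
move=> a0 az; rewrite /bump /bump_root max_l ?expr0n// subr_le0 -sqr_nrm.
by rewrite ler_sqr ?nnegrE ?nrm_ge0//; exact: ltW.
Qed.

Lemma bumpN z : bump (- z) = bump z.
Proof. by rewrite /bump /bump_root /dotp /= !mulrNN. Qed.

Let q_dist z w : 0 < a -> nrm w <= 1 -> nrm z <= a + 1 ->
  `|dotp (z + w) (z + w) - dotp z z| <= (2 * a + 3) * nrm w.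
Proof.
move=> a0 w1 za.
have -> : dotp (z + w) (z + w) - dotp z z = 2 * dotp z w + dotp w w.
  by rewrite /dotp /=; ring.
apply: le_trans (ler_normD _ _) _.
rewrite normrM ger0_norm// -sqr_nrm [`|nrm w ^+ 2|]ger0_norm ?sqr_ge0//.
have h := dotp_abs_le z w; have w0 := nrm_ge0 w; have z0 := nrm_ge0 z.
nra.
Qed.

Let q_lip z w : `|q z - q w| <= `|dotp z z - dotp w w|.
Proof.
rewrite /bump_root; set A := dotp z z; set B := dotp w w.
rewrite /Num.max; case: ltP => h1; case: ltP => h2; rewrite ?subrr ?normr0//.
- have -> : a ^+ 2 - A - (a ^+ 2 - B) = - (A - B) by ring.
  by rewrite normrN.
- rewrite subr0 ger0_norm; last exact: ltW.
  rewrite distrC ger0_norm; lra.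
- rewrite sub0r normrN ger0_norm; last exact: ltW.
  rewrite ger0_norm; lra.
Qed.

Let bump_lip_loc z w : 0 < a -> nrm w <= 1 -> nrm z <= a + 1 ->
  `|bump (z + w) - bump z| <= 2 * a ^+ 2 * (2 * a + 3) * nrm w.
Proof.
move=> a0 w1 za; rewrite /bump subr_sqr normrM mulrC.
have h1 := le_trans (q_lip (z + w) z) (q_dist a0 w1 za).
have h2 : `|q (z + w) + q z| <= 2 * a ^+ 2.
  by rewrite ger0_norm ?addr_ge0// mulr2n mulrDl mul1r lerD.
by rewrite -mulrA; apply: ler_pM.
Qed.

Lemma bump_lipschitz z w : 0 < a -> `|bump z - bump w| <= bump_lip * eucl_dist z w.
Proof.
move=> a0; rewrite eucl_distE /bump_lip.
have d0 := nrm_ge0 (z - w).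
have c1 : 0 <= 2 * a ^+ 2 * (2 * a + 3).
  have h : 0 <= 2 * a + 3 by lra.
  by apply: mulr_ge0 => //; apply: mulr_ge0 => //; exact: sqr_ge0.
have c2 : 0 <= a ^+ 4 by rewrite exprn_even_ge0.
have [d1|d1] := leP (nrm (z - w)) 1; last first.
  apply: (@le_trans _ _ (a ^+ 4)).
    rewrite ler_norml; apply/andP; split.
      by have := bump_ge0 z; have := bump_le w; lra.
    by have := bump_ge0 w; have := bump_le z; lra.
  by nra.
have [wa|wa] := leP (nrm w) (a + 1).
  have h := bump_lip_loc a0 d1 wa; rewrite (addrC w) subrK in h.
  by apply: le_trans h _; rewrite ler_wpM2r// lerDl.
have za : a <= nrm z.
  have := nrmD z (w - z); rewrite addrC subrK -(nrmN (w - z)) opprB; lra.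
rewrite (bump_eq0 a0 za) bump_eq0//; last lra.
by rewrite subrr normr0 mulr_ge0// addr_ge0.
Qed.

Lemma bump_near z w : 0 < a -> nrm (z - w) <= 1 ->
  bump z <= bump w + (if (`|w.1| <= a + 1) && (`|w.2| <= a + 1)
                      then bump_lip * nrm (z - w) else 0).
Proof.
move=> a0 zw1; case: ifPn => h.
  have := bump_lipschitz z w a0; rewrite eucl_distE ler_norml => /andP[_]; lra.
rewrite addr0 [bump z]bump_eq0 ?bump_ge0//.
have : a + 1 < nrm w.
  move: h; rewrite negb_and -!ltNge => /orP[] h; apply: lt_le_trans h _.
    exact: nrm_fst.
  exact: nrm_snd.
have := nrmD z (w - z); rewrite addrC subrK -(nrmN (w - z)) opprB; lra.
Qed.

(** Second order Taylor estimate for the kernel, uniform over the plane. *)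
Lemma bump_taylor z w : 0 < a -> nrm w <= 1 ->
  `|bump (z - w) - bump z - 4 * q z * dotp z w| <= bump_curv * nrm w ^+ 2.
Proof.
move=> a0 w1; have h3 : 0 <= 2 * a + 3 by lra.
set p := a ^+ 2 - dotp z z; set p' := a ^+ 2 - dotp (z - w) (z - w).
have pp : p' - p = 2 * dotp z w - nrm w ^+ 2.
  by rewrite sqr_nrm /p' /p /dotp /=; ring.
rewrite /bump /bump_root -/p -/p'.
have [pn|pp0] := leP p 0; have [pn'|pp0'] := leP p' 0.
- by rewrite expr0n mulr0 mul0r !subr0 normr0 mulr_ge0 ?sqr_ge0 ?bump_curv_ge0.
- have za : nrm z <= a + 1.
    have := nrmD (z - w) w; rewrite subrK.
    suff : nrm (z - w) <= a by lra.
    by rewrite le_nrmP ?ltW//; move: pp0'; rewrite /p'; lra.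
  rewrite expr0n mulr0 mul0r !subr0 ger0_norm ?sqr_ge0//.
  have : `|p' - p| <= (2 * a + 3) * nrm w.
    have := @q_dist z (- w); rewrite nrmN => /(_ a0 w1 za).
    by rewrite distrC; rewrite /p' /p; congr (`|_| <= _); ring.
  rewrite ler_norml => /andP[_ h].
  have : p' <= (2 * a + 3) * nrm w by lra.
  have := nrm_ge0 w => w0 h'.
  have : p' ^+ 2 <= ((2 * a + 3) * nrm w) ^+ 2 by rewrite ler_sqr ?nnegrE//; nra.
  rewrite /bump_curv exprMn mulrDl; have := sqr_ge0 (nrm w); have := sqr_ge0 a; nra.
- have za : nrm z <= a by rewrite le_nrmP ?ltW//; move: pp0; rewrite /p; lra.
  have h : `|p' - p| <= (2 * a + 3) * nrm w.
    have := @q_dist z (- w); rewrite nrmN => /(_ a0 w1).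
    rewrite distrC; have -> : dotp z z - dotp (z - w) (z - w) = p' - p.
      by rewrite /p /p'; ring.
    apply; lra.
  have pa : p <= a ^+ 2 by rewrite /p; have := dotp_ge0 z; lra.
  rewrite expr0n /= -normrN; set e := - _.
  (* Here [p' <= 0 < p], so that [p <= `|p' - p|] is small as well. *)
  have -> : e = p ^+ 2 + 2 * p * (p' - p) + 2 * p * nrm w ^+ 2 by rewrite /e pp; ring.
  have w0 := nrm_ge0 w; have wsq := sqr_ge0 (nrm w).
  have hh : (p' - p) ^+ 2 <= ((2 * a + 3) * nrm w) ^+ 2.
    by rewrite -(real_normK (num_real (p' - p))) ler_sqr ?nnegrE ?mulr_ge0.
  rewrite exprMn in hh.
  rewrite /bump_curv ler_norml; apply/andP; split; nra.
- have za : nrm z <= a by rewrite le_nrmP ?ltW//; move: pp0; rewrite /p; lra.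
  have h : `|p' - p| <= (2 * a + 3) * nrm w.
    have := @q_dist z (- w); rewrite nrmN => /(_ a0 w1).
    rewrite distrC; have -> : dotp z z - dotp (z - w) (z - w) = p' - p.
      by rewrite /p /p'; ring.
    apply; lra.
  have pa : p <= a ^+ 2 by rewrite /p; have := dotp_ge0 z; lra.
  have -> : p' ^+ 2 - p ^+ 2 - 4 * p * dotp z w = (p' - p) ^+ 2 - 2 * p * nrm w ^+ 2.
    have e2 : dotp z w = (p' - p + nrm w ^+ 2) / 2 by lra.
    by rewrite e2; field.
  have w0 := nrm_ge0 w; have wsq := sqr_ge0 (nrm w).
  have hh : (p' - p) ^+ 2 <= ((2 * a + 3) * nrm w) ^+ 2.
    by rewrite -(real_normK (num_real (p' - p))) ler_sqr ?nnegrE ?mulr_ge0.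
  rewrite exprMn in hh; have := sqr_ge0 (p' - p).
  rewrite /bump_curv ler_norml => ?; apply/andP; split; nra.
Qed.
End kernel.

(** * Areas of tubes *)

Section tube.
Context {R : realType}.
Local Notation leb2 := (@leb R \x @leb R)%E.
Implicit Types x y z v w : R * R.

(** Across [e] the points [z] whose segment from [z] to [z + r e] meets [C] have a width of
    at most [d], and along [e] a length of at most [2 * d + r]. *)
Lemma tube_cover (C : set (R * R)) (d r : R) (p e : R * R) :
  0 <= r -> dotp e e = 1 -> C p ->
  (forall x y, C x -> C y -> eucl_dist x y <= d) ->
  exists T : set (R * R), [/\ measurable T,
    (forall z t, 0 <= t -> t <= 1 -> C (z + sc (t * r) e) -> T z),
    (forall z, T z -> eucl_dist z p <= 2 * d + r) &
    (leb2 T <= (d * (2 * d + r))%:E)%E].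
Proof.
move=> r0 e1 Cp Cd.
have d0 : 0 <= d by rewrite -(eucl_distxx p); exact: Cd.
case: e e1 => c s; rewrite /dotp /= -!expr2 => cs.
pose S z : R := c * z.2 - s * z.1.
pose T z : R := c * z.1 + s * z.2.
have eN : nrm (c, s) = 1 by rewrite /nrm /dotp /= -!expr2 cs sqrtr1.
have eN' : nrm (- s, c) = 1.
  by rewrite /nrm /dotp /= mulrNN -!expr2 addrC cs sqrtr1.
have Td x y : `|T x - T y| <= eucl_dist x y.
  rewrite eucl_distE -[leRHS]mul1r -eN.
  have -> : T x - T y = dotp (c, s) (x - y) by rewrite /T /dotp /=; ring.
  exact: dotp_abs_le.
have Sd x y : `|S x - S y| <= eucl_dist x y.
  rewrite eucl_distE -[leRHS]mul1r -eN'.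
  have -> : S x - S y = dotp (- s, c) (x - y) by rewrite /S /dotp /=; ring.
  exact: dotp_abs_le.
pose SC := [set S z | z in C].
have SClb : lbound SC (S p - d).
  move=> _ [z Cz <-]; have := le_trans (Sd p z) (Cd _ _ Cp Cz).
  by rewrite ler_norml => /andP[]; lra.
have hSC : has_inf SC by split; [exists (S p), p|exists (S p - d)].
pose al := inf SC.
have alle z : C z -> al <= S z by move=> Cz; apply: ge_inf; [case: hSC|exists z].
have leal z : C z -> S z <= al + d.
  move=> Cz; rewrite -lerBlDr; apply: lb_le_inf; first by case: hSC.
  move=> _ [y Cy <-]; have := le_trans (Sd z y) (Cd _ _ Cz Cy).
  by rewrite ler_norml => /andP[]; lra.
(* In the coordinates [T] along [e] and [S] across it the tube is contained in a box:
   points are moved forward along [e] by at most [r] before they reach [C]. *)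
pose B : set (R * R) := `[T p - d - r, T p + d]%classic `*` `[al, al + d]%classic.
have mB : measurable B by apply: measurableX; exact: measurable_itv.
exists [set z | B (T z, S z)].
have mrot := measurable_rot c (- s).
have TSE z : (T z, S z) = rot c (- s) z.
  by rewrite /rot /T /S; congr pair; ring.
have BE : [set z | B (T z, S z)] = rot c (- s) @^-1` B.
  by apply/seteqP; split => z /=; rewrite TSE.
split.
- by rewrite BE -(setTI (_ @^-1` _)); exact: mrot.
- move=> z t t0 t1 /= Cz; have Szt : S (z + sc (t * r) (c, s)) = S z.
    by rewrite /S /sc /=; ring.
  have Tzt : T (z + sc (t * r) (c, s)) = T z + t * r.
    rewrite /T /sc /=; transitivity (c * z.1 + s * z.2 + t * r * (c ^+ 2 + s ^+ 2)).
      by ring.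
    by rewrite cs mulr1.
  have := alle _ Cz; have := leal _ Cz; rewrite Szt => h1 h2.
  have := le_trans (Td _ _) (Cd _ _ Cz Cp); rewrite Tzt ler_norml => /andP[h3 h4].
  have : 0 <= t * r by exact: mulr_ge0.
  have : t * r <= r by rewrite ler_piMl.
  by split; rewrite /= in_itv /=; apply/andP; split; lra.
- move=> z [] /=; rewrite !in_itv /= => /andP[h1 h2] /andP[h3 h4].
  have := alle _ Cp; have := leal _ Cp => h5 h6.
  have dz : nrm (T z - T p, S z - S p) = eucl_dist z p.
    rewrite eucl_distE /nrm; congr Num.sqrt; rewrite /dotp /T /S /=.
    transitivity ((c ^+ 2 + s ^+ 2) * ((z.1 - p.1) * (z.1 - p.1) +
      (z.2 - p.2) * (z.2 - p.2))); first by ring.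
    by rewrite cs mul1r.
  rewrite -dz; apply: le_trans (nrm_le_add _) _ => /=.
  have : `|T z - T p| <= d + r by rewrite ler_norml; lra.
  have : `|S z - S p| <= d by rewrite ler_norml; lra.
  lra.
- rewrite BE.
  have cs' : c ^+ 2 + (- s) ^+ 2 = 1 by rewrite sqrrN.
  have mi : measurable_fun [set: R * R] (EFin \o (\1_B : R * R -> R)).
    by apply/measurable_EFinP; exact: measurable_indic.
  have := @integral2_rot R (EFin \o \1_B) c (- s) cs' mi (fun x => _).
  have ->// : (\int[leb2]_x (EFin \o \1_B) x = leb2 B)%E.
    by rewrite /= integral_indic// setIT.
  have -> : (\int[leb2]_x (EFin \o \1_B) (rot c (- s) x) = leb2 (rot c (- s) @^-1` B))%E.
    rewrite -[X in _ = leb2 X]setIT -integral_indic//; last first.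
      by rewrite -(setTI (_ @^-1` _)); exact: mrot.
  move=> ->; last by move=> x; rewrite lee_fin.
  rewrite itv_measurable_box; [|lra..].
  rewrite lee_fin; apply/eqP/eqP; nra.
Qed.
End tube.

(** * The smoothed indicator of a set *)

Section smoothing.
Context {R : realType}.
Local Notation leb2 := (@leb R \x @leb R)%E.
Implicit Types (x y z v w : R * R) (G : set (R * R)).

Lemma leb2_bounded_lty (A : set (R * R)) (D : R) : measurable A ->
  (forall x, A x -> nrm x <= D) -> (leb2 A < +oo)%E.
Proof.
move=> mA AD; have [->|/set0P[x Ax]] := eqVneq A set0; first by rewrite measure0 ltry.
have D0 : 0 <= D by exact: le_trans (nrm_ge0 x) (AD _ Ax).
apply: (@le_lt_trans _ _ (leb2 (`[- D, D]%classic `*` `[- D, D]%classic))).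
  apply: le_measure; rewrite ?inE//.
    by apply: measurableX; exact: measurable_itv.
  move=> y /AD yD; have := le_trans (nrm_fst y) yD; have := le_trans (nrm_snd y) yD.
  by rewrite !ler_norml => h1 h2; split; rewrite /= in_itv.
rewrite itv_measurable_box ?ltry//; lra.
Qed.

Lemma Rintegral_bound d (T : measurableType d) (mu : {measure set T -> \bar R})
    (A : set T) (f : T -> R) (k : R) : measurable A -> (mu A < +oo)%E ->
  measurable_fun A f -> (forall x : T, A x -> `|f x| <= k) ->
  `|\int[mu]_(x in A) f x| <= k * fine (mu A).
Proof.
move=> mA Aoo mf fk.
have fi : mu.-integrable A (EFin \o f).
  apply: measurable_bounded_integrable => //; exists k; split; first exact: num_real.
  by move=> M kM x Ax /=; apply: le_trans (fk x Ax) (ltW kM).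
rewrite -lee_fin EFin_normr_Rintegral//.
apply: le_trans (le_abse_integral _ _ _) _ => //; first exact/measurable_EFinP.
rewrite EFinM fineK ?ge0_fin_numE// -integral_cst//.
by apply: ge0_le_integral => //; apply: measurableT_comp => //; exact/measurable_EFinP.
Qed.

Lemma measurable_bump_shift (a : R) x : 0 < a ->
  measurable_fun [set: R * R] (fun y => bump a (y - x)).
Proof.
move=> a0; apply: continuous_measurable_plane.
apply: (@continuous_plane_lip _ _ (bump_lip a)) => y z.
apply: le_trans (bump_lipschitz _ _ a0) _; rewrite !eucl_distE.
by rewrite opprB addrA subrK.
Qed.

Variables (a : R) (G : set (R * R)).

Definition smooth x : R := \int[leb2]_(y in G) bump a (y - x).

Definition bump_mass : \bar R := (\int[leb2]_y (bump a y)%:E)%E.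

Lemma integrable_bump x : 0 < a -> measurable G -> (leb2 G < +oo)%E ->
  leb2.-integrable G (EFin \o (fun y => bump a (y - x))).
Proof.
move=> a0 mG Goo; apply: measurable_bounded_integrable => //.
  by apply: measurable_funTS; exact: measurable_bump_shift.
exists (a ^+ 4); split; first exact: num_real.
move=> M aM y _ /=; rewrite ger0_norm ?bump_ge0//.
by apply: le_trans (bump_le _ _) (ltW aM).
Qed.

Lemma EFin_smooth x : 0 < a -> measurable G -> (leb2 G < +oo)%E ->
  ((smooth x)%:E = \int[leb2]_y (\1_G y * bump a (y - x))%:E)%E.
Proof.
move=> a0 mG Goo; rewrite /smooth /Rintegral fineK; last first.
  exact: integrable_fin_num (integrable_bump x a0 mG Goo).
rewrite integral_mkcond; apply: eq_integral => y _.
by rewrite patchE indicE; case: ifPn; rewrite ?mul1r ?mul0r.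
Qed.

Let measurable_indic_bump (A : set (R * R)) x : 0 < a -> measurable A ->
  measurable_fun [set: R * R] (fun y => (\1_A y * bump a (y - x))%:E).
Proof.
move=> a0 mA; apply/measurable_EFinP; apply: measurable_funM.
  exact: measurable_indic.
exact: measurable_bump_shift.
Qed.

Lemma smooth_ge0 x : 0 <= smooth x.
Proof. by apply: Rintegral_ge0 => y _; exact: bump_ge0. Qed.

Lemma bump_massE x : 0 < a -> (\int[leb2]_y (bump a (y - x))%:E = bump_mass)%E.
Proof.
move=> a0; rewrite /bump_mass.
rewrite -[RHS](@integral2_translation _ (fun y => (bump a y)%:E) (- x))//.
  apply/measurable_EFinP; have := measurable_bump_shift 0 a0.
  by under eq_fun do rewrite subr0.
by move=> y; rewrite lee_fin bump_ge0.
Qed.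

Lemma bump_mass_fin : 0 < a -> bump_mass \is a fin_num.
Proof.
move=> a0; have mB : measurable (eucl_closed_ball (0 : R * R) a).
  by apply: closed_measurable_plane; exact: closed_eucl_closed_ball.
have Boo : (leb2 (eucl_closed_ball (0%R : R * R) a) < +oo)%E.
  apply: (@leb2_bounded_lty _ a) => // x.
  by rewrite /eucl_closed_ball /= eucl_distC eucl_distE subr0.
have -> : bump_mass = (\int[leb2]_(y in eucl_closed_ball (0%R : R * R) a) (bump a y)%:E)%E.
  rewrite [RHS]integral_mkcond; apply: eq_integral => y _; rewrite patchE.
  case: ifPn => // /negP yB; rewrite bump_eq0// leNgt; apply/negP => ya; apply: yB.
  by rewrite inE /eucl_closed_ball /= eucl_distC eucl_distE subr0 ltW.
apply: (@integrable_fin_num _ _ _ leb2) => //.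
apply: (@measurable_bounded_integrable _ _ _ leb2) => //.
  apply: measurable_funTS; have := measurable_bump_shift 0 a0.
  by under eq_fun do rewrite subr0.
exists (a ^+ 4); split; first exact: num_real.
move=> M aM y _ /=; rewrite ger0_norm ?bump_ge0//.
by apply: le_trans (bump_le _ _) (ltW aM).
Qed.

Lemma bump_mass_gt0 : 0 < a -> (0 < bump_mass)%E.
Proof.
move=> a0; pose b := a / 2; have b0 : 0 < b by rewrite divr_gt0.
pose Q : set (R * R) := `[- (b / 2), b / 2]%classic `*` `[- (b / 2), b / 2]%classic.
have mQ : measurable Q by apply: measurableX; exact: measurable_itv.
have mb : measurable_fun [set: R * R] (fun y => (bump a y)%:E).
  apply/measurable_EFinP; have := measurable_bump_shift 0 a0.
  by under eq_fun do rewrite subr0.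
apply: (@lt_le_trans _ _ (\int[leb2]_(y in Q) (b ^+ 4)%:E)%E).
  have LQ : leb2 Q = (b * b)%:E.
    by rewrite /Q itv_measurable_box; [congr (_%:E); field|lra..].
  rewrite integral_cst// -[X in (_ * X)%E]/(leb2 Q) LQ.
  by rewrite -EFinM lte_fin mulr_gt0// ?exprn_gt0// mulr_gt0.
apply: (@le_trans _ _ (\int[leb2]_(y in Q) (bump a y)%:E)%E).
  apply: ge0_le_integral => //.
  - by move=> x _; rewrite lee_fin exprn_ge0 ?ltW.
  - exact: measurable_funTS.
  - move=> x [] /=; rewrite !in_itv/= => /andP[h1 h2] /andP[h3 h4].
    have xb : nrm x <= b.
      apply: le_trans (nrm_le_add x) _.
      have : `|x.1| <= b / 2 by rewrite ler_norml h1 h2.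
      have : `|x.2| <= b / 2 by rewrite ler_norml h3 h4.
      lra.
    rewrite lee_fin /bump; have -> : b ^+ 4 = (b ^+ 2) ^+ 2 by ring.
    have xb2 : dotp x x <= b ^+ 2 by rewrite -le_nrmP// ltW.
    have eb : b ^+ 2 = a ^+ 2 / 4 by rewrite /b; field.
    have h : b ^+ 2 <= a ^+ 2 - dotp x x by have := sqr_ge0 a; lra.
    have := le_trans (sqr_ge0 b) h => h'.
    by rewrite ler_sqr ?nnegrE ?sqr_ge0// /bump_root max_r.
apply: ge0_subset_integral => //.
by move=> x _; rewrite lee_fin bump_ge0.
Qed.

Lemma smooth_le x : 0 < a -> measurable G -> (leb2 G < +oo)%E ->
  smooth x <= fine bump_mass.
Proof.
move=> a0 mG Goo; rewrite -lee_fin EFin_smooth// fineK ?bump_mass_fin//.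
rewrite -(bump_massE x a0); apply: ge0_le_integral => //.
- by move=> y _; rewrite lee_fin mulr_ge0 ?bump_ge0.
- exact: measurable_indic_bump.
- by apply/measurable_EFinP; exact: measurable_bump_shift.
- move=> y _; rewrite lee_fin indicE; case: (_ \in _); rewrite ?mul1r//.
  by rewrite mul0r bump_ge0.
Qed.

Lemma smooth_full x : 0 < a -> measurable G -> (leb2 G < +oo)%E ->
  (forall y, eucl_dist x y < a -> G y) -> smooth x = fine bump_mass.
Proof.
move=> a0 mG Goo xG; apply: EFin_inj; rewrite EFin_smooth// fineK ?bump_mass_fin//.
rewrite -(bump_massE x a0); apply: eq_integral => y _; congr EFin.
rewrite indicE; case: (boolP (y \in G)) => [_|]; rewrite ?mul1r//= => /negP yG.
rewrite mul0r bump_eq0// leNgt; apply/negP => ya; apply: yG.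
by rewrite inE; apply: xG; rewrite eucl_distC eucl_distE.
Qed.

Lemma smooth_empty x : 0 < a -> measurable G -> (leb2 G < +oo)%E ->
  (forall y, eucl_dist x y < a -> ~ G y) -> smooth x = 0.
Proof.
move=> a0 mG Goo xG; apply: EFin_inj; rewrite EFin_smooth//.
apply: integral0_eq => y _; congr EFin.
rewrite indicE; case: (boolP (y \in G)) => [|_]; rewrite ?mul0r// inE => yG.
rewrite mul1r bump_eq0// leNgt; apply/negP => ya; apply: (xG y) => //.
by rewrite eucl_distC eucl_distE.
Qed.

Lemma smooth_lipschitz x w : 0 < a -> measurable G -> (leb2 G < +oo)%E ->
  `|smooth x - smooth w| <= bump_lip a * fine (leb2 G) * eucl_dist x w.
Proof.
move=> a0 mG Goo; have Gf : leb2 G \is a fin_num by rewrite ge0_fin_numE.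
have ix := integrable_bump x a0 mG Goo; have iw := integrable_bump w a0 mG Goo.
rewrite /smooth -RintegralB//.
apply: le_trans (@Rintegral_bound _ _ leb2 G _ (bump_lip a * eucl_dist x w) _ _ _ _) _ => //.
- by apply: measurable_funB; apply: measurable_funTS; exact: measurable_bump_shift.
- move=> y _; apply: le_trans (bump_lipschitz _ _ a0) _.
  rewrite ler_wpM2l ?bump_lip_ge0// !eucl_distE.
  by rewrite (_ : y - x - (y - w) = - (x - w)) ?nrmN// !opprB addrC addrA subrK.
- by rewrite mulrAC.
Qed.

(** The gradient of the smoothed indicator, as a second order expansion that is
    uniform over the plane. *)
Lemma smooth_taylor : 0 < a -> measurable G -> (leb2 G < +oo)%E ->
  exists m : R * R -> R * R, forall x w, nrm w <= 1 ->
  `|smooth (x + w) - smooth x - dotp (m x) w|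
    <= bump_curv a * fine (leb2 G) * nrm w ^+ 2.
Proof.
move=> a0 mG Goo.
have mq x : measurable_fun [set: R * R] (fun y => bump_root a (y - x)).
  apply: continuous_measurable_plane => y.
  have cd : continuous (fun y => a ^+ 2 - dotp (y - x) (y - x)).
    have -> : (fun y => a ^+ 2 - dotp (y - x) (y - x)) =
              (fun y => a ^+ 2 - eucl_dist y x ^+ 2).
      by apply/funext => z; rewrite eucl_distE sqr_nrm.
    move=> z; apply: cvgB; first exact: cvg_cst.
    by rewrite expr2; apply: cvgM; exact: continuous_dist.
  apply: (@continuous_max _ _ (fun=> 0) _ y) => //; first exact: cvg_cst.
  exact: cd.
have m1 (x : R * R) : measurable_fun [set: R * R] (fun y => (y - x).1).
  by apply: measurable_funB.
have m2 (x : R * R) : measurable_fun [set: R * R] (fun y => (y - x).2).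
  by apply: measurable_funB.
have q0 z : 0 <= bump_root a z <= a ^+ 2.
  rewrite /bump_root le_max lexx /= ge_max sqr_ge0 /=; have := dotp_ge0 z; lra.
have qz z : bump_root a z * nrm z <= a ^+ 2 * a.
  have [za|za] := leP a (nrm z).
    have -> : bump_root a z = 0.
      apply/eqP; rewrite -sqrf_eq0; apply/eqP; exact: bump_eq0.
    by rewrite mul0r mulr_ge0 ?sqr_ge0// ltW.
  have /andP[h1 h2] := q0 z; apply: ler_pM => //; first exact: nrm_ge0.
  exact: ltW.
have nb (z : R * R) c : `|c| <= nrm z ->
    `|4 * bump_root a z * c| <= 4 * (a ^+ 2 * a).
  move=> cz; have /andP[h1 _] := q0 z.
  rewrite normrM ger0_norm ?mulr_ge0// -mulrA ler_wpM2l//.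
  by apply: le_trans (qz z); rewrite ler_wpM2l.
have i1 x : leb2.-integrable G (EFin \o (fun y => 4 * bump_root a (y - x) * (y - x).1)).
  apply: measurable_bounded_integrable => //.
    apply: measurable_funTS; apply: measurable_funM => //.
    by apply: measurable_funM.
  exists (4 * (a ^+ 2 * a)); split; first exact: num_real.
  move=> M aM y _ /=; apply: le_trans (ltW aM).
  by apply: nb; exact: (nrm_fst (y - x)).
have i2 x : leb2.-integrable G (EFin \o (fun y => 4 * bump_root a (y - x) * (y - x).2)).
  apply: measurable_bounded_integrable => //.
    apply: measurable_funTS; apply: measurable_funM => //.
    by apply: measurable_funM.
  exists (4 * (a ^+ 2 * a)); split; first exact: num_real.
  move=> M aM y _ /=; apply: le_trans (ltW aM).
  by apply: nb; exact: (nrm_snd (y - x)).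
exists (fun x => (\int[leb2]_(y in G) (4 * bump_root a (y - x) * (y - x).1),
                  \int[leb2]_(y in G) (4 * bump_root a (y - x) * (y - x).2))).
move=> x w w1; rewrite /dotp /=.
have ixw := integrable_bump (x + w) a0 mG Goo; have ix := integrable_bump x a0 mG Goo.
have j1 := i1 x; have j2 := i2 x.
have jD : leb2.-integrable G (EFin \o (fun y => 4 * bump_root a (y - x) * (y - x).1 * w.1
     + 4 * bump_root a (y - x) * (y - x).2 * w.2)).
  have -> : (EFin \o (fun y => 4 * bump_root a (y - x) * (y - x).1 * w.1
     + 4 * bump_root a (y - x) * (y - x).2 * w.2)) =
    ((fun y => (4 * bump_root a (y - x) * (y - x).1)%:E * w.1%:E) \+
     (fun y => (4 * bump_root a (y - x) * (y - x).2)%:E * w.2%:E))%E.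
    by apply/funext => y /=; rewrite -!EFinM -EFinD.
  by apply: integrableD => //; apply: integrableZr.
rewrite -RintegralZr// -RintegralZr// -RintegralD//; last 2 first.
- exact: (integrableZr mG w.1 j1).
- exact: (integrableZr mG w.2 j2).
rewrite /smooth -RintegralB// -RintegralB//; last first.
  exact: (integrableB mG ixw ix).
apply: le_trans (@Rintegral_bound _ _ leb2 G _ (bump_curv a * nrm w ^+ 2) _ _ _ _) _ => //.
- apply: measurable_funTS; apply: measurable_funB.
    by apply: measurable_funB; exact: measurable_bump_shift.
  have n1 : measurable_fun [set: R * R] (fun y : R * R => y.1 - x.1) := m1 x.
  have n2 : measurable_fun [set: R * R] (fun y : R * R => y.2 - x.2) := m2 x.
  apply: measurable_funD; apply: measurable_funM => //; apply: measurable_funM => //;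
    by apply: measurable_funM.
- move=> y _; have := @bump_taylor _ a (y - x) w a0 w1.
  have -> : y - (x + w) = y - x - w by rewrite opprD addrA.
  by rewrite /dotp; congr (`|_| <= _); ring.
- by rewrite mulrAC.
Qed.

End smoothing.

(** * Increments of the smoothed indicator near a boundary of finite length *)

Section smooth_step.
Context {R : realType}.
Local Notation leb2 := (@leb R \x @leb R)%E.
Implicit Types (x y z v w : R * R).

Definition in_square (b : R) z := (`|z.1| <= b) && (`|z.2| <= b).

(** The kernel enlarged by its oscillation at scale [k]. *)
Definition wide_bump (a k : R) z : R :=
  bump a z + (if in_square (a + 1) z then bump_lip a * k else 0).

Lemma wide_bump_ge0 (a k : R) z : 0 < a -> 0 <= k -> 0 <= wide_bump a k z.
Proof.
move=> a0 k0; rewrite addr_ge0 ?bump_ge0//; case: ifP => // _.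
by rewrite mulr_ge0 ?bump_lip_ge0.
Qed.

(** If a translate by a short vector [r e] sends a point into the interior of
    [A] from outside of it, then the point lies in one of the tubes around the
    pieces of a cover of the boundary; the areas of the tubes bound the
    increment of the smoothed indicator. *)
Lemma smooth_step_le (A : set (R * R)) (C : nat -> set (R * R)) (p : nat -> R * R)
    (d : nat -> R) (a delta r : R) e x :
  0 < a -> (leb2 (interior A) < +oo)%E ->
  boundary A `<=` \bigcup_k C k ->
  (forall k y z, C k y -> C k z -> eucl_dist y z <= d k) ->
  (forall k y, C k y -> C k (p k)) ->
  (forall k, 0 <= d k) -> (forall k, d k <= delta) -> 0 <= r ->
  2 * delta + r <= 1 -> dotp e e = 1 ->
  ((smooth a (interior A) (x + sc r e))%:E <= (smooth a (interior A) x)%:E +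
    \sum_(k <oo) (d k * (2 * delta + r) *
                  wide_bump a (2 * delta + r) (p k - x))%:E)%E.
Proof.
move=> a0 Goo AC Cd Cp d0 dd r0 dr1 e1.
set G : set (R * R) := interior A; set kp := 2 * delta + r.
have oG : open G by exact: open_interior.
have mG : measurable G by exact: open_measurable_plane.
have delta0 : 0 <= delta := le_trans (d0 0%N) (dd 0%N).
have kp0 : 0 <= kp by rewrite /kp; lra.
have /choice[T hT] : forall k, exists T : set (R * R), [/\ measurable T,
    (forall z t, 0 <= t -> t <= 1 -> C k (z + sc (t * r) e) -> T z),
    (forall z, T z -> eucl_dist z (p k) <= kp) &
    (leb2 T <= (d k * kp)%:E)%E].
  move=> k; have [C0|/set0P[y Cy]] := eqVneq (C k) set0.
    exists set0; split => //.
      by move=> z t _ _; rewrite C0.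
    by rewrite measure0 lee_fin mulr_ge0.
  have [T [mT CT Tp Td]] := tube_cover r0 e1 (Cp _ _ Cy) (Cd k).
  exists T; split => //.
    move=> z /Tp zp; apply: le_trans zp _; rewrite /kp lerD2r.
    by rewrite ler_wpM2l.
  apply: le_trans Td _; rewrite lee_fin ler_wpM2l// /kp lerD2r.
  by rewrite ler_wpM2l.
pose v := sc r e.
rewrite !EFin_smooth//.
have mi (B : set (R * R)) u : measurable B ->
    measurable_fun [set: R * R] (fun y => (\1_B y * bump a (y - u))%:E).
  move=> mB; apply/measurable_EFinP; apply: measurable_funM.
    exact: measurable_indic.
  exact: measurable_bump_shift.
have i0 (B : set (R * R)) u y : (0 <= (\1_B y * bump a (y - u))%:E)%E.
  by rewrite lee_fin mulr_ge0 ?bump_ge0.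
rewrite -[leLHS](integral2_translation v)//; last exact: mi.
apply: (@le_trans _ _ (\int[leb2]_y ((\1_G y * bump a (y - x))%:E +
   \sum_(k <oo) (\1_(T k) y * bump a (y - x))%:E))%E).
  apply: ge0_le_integral => //.
  - have mv : measurable_fun [set: R * R] (fun y : R * R => y + v).
      by apply: measurable_fun_pair; apply: measurable_funD.
    exact: (measurableT_comp (mi G (x + v) mG) mv).
  - apply: emeasurable_funD; first exact: mi.
    apply: ge0_emeasurable_sum => k; first by move=> y _ _; exact: i0.
    by move=> _; apply: mi; have [] := hT k.
  - move=> y _; have -> : y + v - (x + v) = y - x.
      by rewrite opprD addrACA subrr addr0.
    have s0 : (0 <= \sum_(k <oo) (\1_(T k) y * bump a (y - x))%:E)%E.
      by apply: nneseries_ge0 => k _ _; exact: i0.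
    have [yG|yG] := boolP (y \in G).
      rewrite [in X in (_ <= X)%E]indicE yG mul1r.
      apply: (@le_trans _ _ (bump a (y - x))%:E); last by rewrite leeDl.
      rewrite lee_fin indicE; case: (_ \in _); rewrite ?mul1r//.
      by rewrite mul0r bump_ge0.
    have [yvG|yvG] := boolP (y + v \in G); last first.
      by rewrite indicE (negbTE yvG) mul0r adde_ge0.
    rewrite !indicE yvG (negbTE yG) mul1r mul0r add0e.
    have yvG' : interior A (y + v) by rewrite -/G; move: yvG; rewrite inE.
    have yG' : ~ interior A (y + v + - v).
      by rewrite addrK -/G; move/negP: yG; rewrite inE.
    (* The segment from [y + v] back to [y] meets the boundary, so [y] is in a tube. *)
    have [t [t0 t1 bt]] := segment_meets_boundary yvG' yG'.
    have [k _ Ck] := AC _ bt.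
    have Tk : T k y.
      have [_ h _ _] := hT k; apply: (h y (1 - t)); [lra|lra|].
      have <- // : y + v + sc t (- v) = y + sc ((1 - t) * r) e.
      by apply/eqP; rewrite xpair_eqE /= /v /sc /=; apply/andP; split; apply/eqP; ring.
    apply: le_trans (nneseries_lim_ge k.+1 _); last by move=> i _ _; exact: i0.
    rewrite big_mkord (bigD1 ord_max)//= indicE mem_set// mul1r leeDl//.
    by apply: sume_ge0 => i _; exact: i0.
rewrite ge0_integralD//; last 3 first.
- exact: mi.
- by move=> y _; apply: nneseries_ge0 => k _ _; exact: i0.
- apply: ge0_emeasurable_sum => k; first by move=> y _ _; exact: i0.
  by move=> _; apply: mi; have [] := hT k.
rewrite leeD2l// integral_nneseries//; last first.
  by move=> k; apply: mi; have [] := hT k.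
apply: lee_nneseries => [k _ _|k _].
  by apply: integral_ge0 => y _; exact: i0.
have [mT _ Tp Td] := hT k.
apply: (@le_trans _ _ (\int[leb2]_y ((wide_bump a kp (p k - x))%:E * (\1_(T k) y)%:E))%E).
  apply: ge0_le_integral => //.
  - exact: mi.
  - apply: measurable_funeM; apply/measurable_EFinP; exact: measurable_indic.
  - move=> y _; rewrite indicE; case: (boolP (y \in T k)) => [|_]; last first.
      by rewrite mul0r mule0.
    rewrite inE mul1r mule1 => /Tp yp; rewrite lee_fin.
    have e2 : nrm ((y - x) - (p k - x)) = eucl_dist y (p k).
      by rewrite eucl_distE opprB addrA subrK.
    have := @bump_near _ a (y - x) (p k - x) a0; rewrite e2 => /(_ (le_trans yp dr1)).
    move=> /le_trans; apply; rewrite /wide_bump lerD2l /in_square.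
    by case: ifP => // _; rewrite ler_wpM2l ?bump_lip_ge0.
have w0 := wide_bump_ge0 (p k - x) a0 kp0.
rewrite ge0_integralZl_EFin//; last first.
  by apply/measurable_EFinP; exact: measurable_indic.
rewrite integral_indic// setIT mulrC EFinM lee_wpmul2l//.
Qed.
End smooth_step.

(** * Variation of a function on the line under shifts *)

Section shift_variation.
Context {R : realType}.
Local Notation leb := (@leb R).
Variables (f : R -> R) (M : R).

Definition window (a b : R) : \bar R := (\int[leb]_(t in `]a, b]) (f t)%:E)%E.
Local Notation W := window.

Definition shift_var (A : set R) (r : R) : \bar R :=
  (\int[leb]_(t in A) `|f (t + r) - f t|%:E)%E.
Local Notation V a b r := (shift_var `]a, b]%classic r).

Let mfE (D : set R) : measurable_fun [set: R] f ->
  measurable_fun D (fun t => (f t)%:E).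
Proof. by move=> mf; apply/measurable_EFinP; exact: measurable_funTS. Qed.

Let mshift (r : R) : measurable_fun [set: R] f ->
  measurable_fun [set: R] (fun t => f (t + r)).
Proof.
move=> mf; have ms : measurable_fun [set: R] (fun t : R => t + r).
  exact: measurable_funD.
exact: (measurableT_comp mf ms).
Qed.

Let mvar (r : R) (D : set R) : measurable_fun [set: R] f ->
  measurable_fun D (fun t => `|f (t + r) - f t|%:E).
Proof.
move=> mf; apply/measurable_EFinP; apply: measurable_funTS.
by apply: measurableT_comp => //; apply: measurable_funB => //; exact: mshift.
Qed.

Let Wcat (a b c : R) : measurable_fun [set: R] f -> (forall t, 0 <= f t) ->
  a <= b -> b <= c -> (W a c = W a b + W b c)%E.
Proof.
move=> mf f0 ab bc; rewrite /window -ge0_integral_setU//=.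
- congr (integral _ _ _); apply/seteqP; split => t /=; rewrite !in_itv/=.
    by case: (leP t b) => tb /andP[h1 h2]; [left; rewrite h1|right; rewrite h2].
  by move=> [] /andP[h1 h2]; apply/andP; split; lra.
- exact: mfE.
- by move=> t _; rewrite lee_fin.
- rewrite disj_set2E; apply/eqP; rewrite -subset0 => t /= []; rewrite !in_itv/= => /andP[_ h1] /andP[h2 _].
  by move: h2; rewrite ltNge h1.
Qed.

Let Wle (a b k : R) : measurable_fun [set: R] f -> (forall t, 0 <= f t) ->
  a <= b -> (forall t, a < t -> t <= b -> f t <= k) -> (W a b <= (k * (b - a))%:E)%E.
Proof.
move=> mf f0 ab fk.
apply: (@le_trans _ _ (\int[leb]_(t in `]a, b]) (cst k%:E) t)%E).
  apply: ge0_le_integral => //.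
  - by move=> t _; rewrite lee_fin.
  - exact: mfE.
  - by move=> t /=; rewrite in_itv/= => /andP[h1 h2]; rewrite lee_fin fk.
rewrite integral_cst// -[X in (_ * X)%E]/(leb `]a, b]%classic) leb_itv//.
Qed.

Let Wge (a b k : R) : measurable_fun [set: R] f -> 0 <= k ->
  a <= b -> (forall t, a < t -> t <= b -> k <= f t) -> ((k * (b - a))%:E <= W a b)%E.
Proof.
move=> mf k0 ab fk.
apply: (@le_trans _ _ (\int[leb]_(t in `]a, b]) (cst k%:E) t)%E).
  by rewrite integral_cst// -[X in (_ * X)%E]/(leb `]a, b]%classic) leb_itv.
apply: ge0_le_integral => //.
- exact: mfE.
- by move=> t /=; rewrite in_itv/= => /andP[h1 h2]; rewrite lee_fin fk.
Qed.

Let Wfin (a b : R) : measurable_fun [set: R] f -> (forall t, 0 <= f t <= M) ->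
  a <= b -> (W a b \is a fin_num)%E.
Proof.
move=> mf f0 ab; rewrite ge0_fin_numE; last first.
  by apply: integral_ge0 => t _; rewrite lee_fin; case/andP: (f0 t).
apply: le_lt_trans (ltry _); apply: (Wle (k := M)) => //.
  by move=> t; case/andP: (f0 t).
by move=> t _ _; case/andP: (f0 t).
Qed.

Let Wshift (a b r : R) : measurable_fun [set: R] f -> (forall t, 0 <= f t) ->
  (\int[leb]_(t in `]a, b]) (f (t + r)%R)%:E = W (a + r)%R (b + r)%R)%E.
Proof.
move=> mf f0; rewrite /window integral_mkcond [RHS]integral_mkcond.
rewrite -[RHS](integral_translation r).
- apply: eq_integral => t _; rewrite !patchE.
  have -> // : (t \in `]a, b]%classic) = (t + r \in `](a + r), (b + r)]%classic).
  apply/idP/idP; rewrite !inE/= !in_itv/=; lra.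
- by apply/(measurable_restrictT _ _).1 => //; exact: mfE.
- by move=> t; rewrite patchE; case: ifP; rewrite ?lee_fin.
Qed.

(** Comparing the integrals of [f] over a window of length [r] at both ends of
    an interval: the difference is the integral of the increments. *)
Lemma window_le_right (a b r : R) : measurable_fun [set: R] f ->
  (forall t, 0 <= f t <= M) -> 0 <= r -> a <= b ->
  (W b (b + r)%R <= V a b r + W a (a + r)%R)%E.
Proof.
move=> mf fM r0 ab; have f0 t : 0 <= f t by case/andP: (fM t).
have h : (W (a + r)%R (b + r)%R <= V a b r + W a b)%E.
  rewrite -Wshift// /window /shift_var -ge0_integralD//; last 3 first.
  - exact: mvar.
  - by move=> t _; rewrite lee_fin.
  - exact: mfE.
  apply: ge0_le_integral => //.
  - by move=> t _; rewrite lee_fin.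
  - by apply/measurable_EFinP; apply: measurable_funTS; exact: mshift.
  - by apply: emeasurable_funD; [exact: mvar|exact: mfE].
  - move=> t _; rewrite -EFinD lee_fin -lerBlDr; exact: ler_norm.
have e1 : (W a (a + r)%R + W (a + r)%R (b + r)%R = W a b + W b (b + r)%R)%E.
  by rewrite -Wcat ?lerDl ?lerD2r// -Wcat ?lerDl.
have Cf : W a b \is a fin_num by exact: Wfin.
rewrite -(leeD2lE _ _ Cf) -e1; apply: le_trans (leeD2l _ h) _.
by rewrite [leLHS]addeC (addeC (V a b r) (W a b)) -addeA.
Qed.

Lemma window_le_left (a b r : R) : measurable_fun [set: R] f ->
  (forall t, 0 <= f t <= M) -> 0 <= r -> a <= b ->
  (W a (a + r)%R <= V a b r + W b (b + r)%R)%E.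
Proof.
move=> mf fM r0 ab; have f0 t : 0 <= f t by case/andP: (fM t).
have h : (W a b <= V a b r + W (a + r)%R (b + r)%R)%E.
  rewrite -Wshift// /window /shift_var -ge0_integralD//; last 3 first.
  - exact: mvar.
  - by move=> t _; rewrite lee_fin.
  - by apply/measurable_EFinP; apply: measurable_funTS; exact: mshift.
  apply: ge0_le_integral => //.
  - by move=> t _; rewrite lee_fin.
  - exact: mfE.
  - apply: emeasurable_funD; first exact: mvar.
    by apply/measurable_EFinP; apply: measurable_funTS; exact: mshift.
  - by move=> t _; rewrite -EFinD lee_fin -lerBlDr distrC ler_norm.
have e1 : (W a (a + r)%R + W (a + r)%R (b + r)%R = W a b + W b (b + r)%R)%E.
  by rewrite -Wcat ?lerDl ?lerD2r// -Wcat ?lerDl.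
have Bf : W (a + r)%R (b + r)%R \is a fin_num by apply: Wfin; rewrite ?lerD2r.
rewrite -(leeD2rE _ _ Bf) e1; apply: le_trans (leeD2r _ h) _.
by rewrite addeAC.
Qed.

Lemma window_plateau (t r L : R) : measurable_fun [set: R] f ->
  (forall t, 0 <= f t <= M) -> (forall t s, `|f t - f s| <= L * `|t - s|) ->
  0 <= L -> 0 <= r -> f t = M -> (((M - L * r) * r)%:E <= W t (t + r)%R)%E.
Proof.
move=> mf fM fL L0 r0 ft; have f0 u : 0 <= f u by case/andP: (fM u).
have [Mr|Mr] := leP 0 (M - L * r); last first.
  apply: (@le_trans _ _ 0%E); first by rewrite lee_fin mulr_le0_ge0// ltW.
  by apply: integral_ge0 => u _; rewrite lee_fin.
have e : r = (t + r) - t by ring.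
rewrite [in X in (_ * X)%:E]e; apply: Wge => //; first by rewrite lerDl.
move=> u tu ur; have := fL t u.
rewrite ft (distrC t) [`|u - t|]gtr0_norm ?subr_gt0// ler_norml => /andP[_ h].
have : L * (u - t) <= L * r by rewrite ler_wpM2l// lerBlDl.
by move: h; lra.
Qed.

Lemma window_zero (t r L : R) : measurable_fun [set: R] f ->
  (forall t, 0 <= f t <= M) -> (forall t s, `|f t - f s| <= L * `|t - s|) ->
  0 <= L -> 0 <= r -> f t = 0 -> (W t (t + r)%R <= (L * r * r)%:E)%E.
Proof.
move=> mf fM fL L0 r0 ft; have f0 u : 0 <= f u by case/andP: (fM u).
have e : r = (t + r) - t by ring.
rewrite [in X in (_ * X)%:E]e; apply: Wle => //; first by rewrite lerDl.
move=> u tu ur; have := fL u t; rewrite ft subr0 [`|u - t|]gtr0_norm ?subr_gt0//.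
rewrite ler_norml => /andP[_ h]; apply: le_trans h _.
by rewrite ler_wpM2l// lerBlDl.
Qed.

Let Vcat (A : set R) (a b r : R) : measurable_fun [set: R] f -> measurable A ->
  (forall t, A t -> t <= a) ->
  (shift_var A r + V a b r <= shift_var (A `|` `]a, b]%classic) r)%E.
Proof.
move=> mf mA Aa; rewrite /shift_var ge0_integral_setU//.
- exact: mvar.
- rewrite disj_set2E; apply/eqP; rewrite -subset0 => t [/Aa ta]/=.
  by rewrite in_itv/= => /andP[]; rewrite ltNge ta.
Qed.

Let Vsub (A : set R) (r : R) : measurable_fun [set: R] f -> measurable A ->
  (shift_var A r <= shift_var setT r)%E.
Proof.
move=> mf mA; apply: ge0_subset_integral => //; exact: mvar.
Qed.

(** A function that vanishes far away and reaches [M] increases by [M] and decreases by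
    [M]: its increments over the distance [r] integrate to about [2 * r * M]. *)
Lemma shift_var_peak (T t r L : R) : measurable_fun [set: R] f ->
  (forall t, 0 <= f t <= M) -> (forall t s, `|f t - f s| <= L * `|t - s|) ->
  (forall t, T <= `|t| -> f t = 0) ->
  0 <= L -> 0 <= r <= 1 -> 0 < M -> 0 <= T -> f t = M ->
  ((2 * r * (M - 2 * L * r))%:E <= shift_var setT r)%E.
Proof.
move=> mf fM fL fT L0 /andP[r0 r1] Mp T0 ft.
have tT : `|t| < T by rewrite ltNge; apply/negP => /fT; rewrite ft => h; lra.
have /andP[h1 h2] : - T < t < T by rewrite -ltr_norml.
have mi a b : measurable (`]a, b]%classic : set R) by exact: measurable_itv.
apply: (@le_trans _ _ (V (- T - 1)%R t r + V t T r)%E); last first.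
  apply: le_trans (@Vcat _ t T r mf (mi _ _) _) _.
    by move=> u /=; rewrite in_itv/= => /andP[].
  by apply: Vsub => //; exact: measurableU.
have z1 : W (- T - 1)%R (- T - 1 + r)%R = 0%E.
  apply: integral0_eq => u /=; rewrite in_itv/= => /andP[h3 h4].
  by rewrite fT// ler0_norm; lra.
have z2 : W T (T + r)%R = 0%E.
  apply: integral0_eq => u /=; rewrite in_itv/= => /andP[h3 h4].
  by rewrite fT// ger0_norm; lra.
have p1 := window_plateau mf fM fL L0 r0 ft.
have lt1 : - T - 1 <= t by lra.
have := window_le_right mf fM r0 lt1; rewrite z1 adde0 => q1.
have := window_le_left mf fM r0 (ltW h2); rewrite z2 adde0 => q2.
apply: le_trans (leeD (le_trans p1 q1) (le_trans p1 q2)).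
rewrite -EFinD lee_fin; have := mulr_ge0 L0 (mulr_ge0 r0 r0); lra.
Qed.

(** Coming down to 0 between two peaks doubles the variation. *)
Lemma shift_var_two_peaks (T t1 t2 t3 r L : R) : measurable_fun [set: R] f ->
  (forall t, 0 <= f t <= M) -> (forall t s, `|f t - f s| <= L * `|t - s|) ->
  (forall t, T <= `|t| -> f t = 0) ->
  0 <= L -> 0 <= r <= 1 -> 0 < M -> 0 <= T ->
  t1 < t2 -> t2 < t3 -> f t1 = M -> f t2 = 0 -> f t3 = M ->
  ((4 * r * (M - 2 * L * r))%:E <= shift_var setT r)%E.
Proof.
move=> mf fM fL fT L0 /andP[r0 r1] Mp T0 t12 t23 ft1 ft2 ft3.
have bd t : f t = M -> - T < t < T.
  by move=> ft; rewrite -ltr_norml ltNge; apply/negP => /fT; rewrite ft => h; lra.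
have /andP[h1 h2] := bd _ ft1; have /andP[h3 h4] := bd _ ft3.
have mi a b : measurable (`]a, b]%classic : set R) by exact: measurable_itv.
apply: (@le_trans _ _ (V (- T - 1)%R t1 r + V t1 t2 r + V t2 t3 r + V t3 T r)%E); last first.
  apply: (@le_trans _ _ (shift_var (`]- T - 1, t1]%classic `|` `]t1, t2]%classic
     `|` `]t2, t3]%classic `|` `]t3, T]%classic) r)); last first.
    by apply: Vsub => //; do 3 apply: measurableU => //.
  apply: le_trans (@Vcat _ t3 T r mf _ _); last 2 first.
  - by do 2 apply: measurableU => //.
  - by move=> u /= [[]|]; rewrite /= in_itv/= => /andP[]; lra.
  rewrite leeD2r//; apply: le_trans (@Vcat _ t2 t3 r mf _ _); last 2 first.
  - by apply: measurableU.
  - by move=> u /= []; rewrite /= in_itv/= => /andP[]; lra.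
  rewrite leeD2r//; apply: (@Vcat _ t1 t2 r mf (mi _ _)).
  by move=> u /=; rewrite in_itv/= => /andP[].
have z1 : W (- T - 1)%R (- T - 1 + r)%R = 0%E.
  apply: integral0_eq => u /=; rewrite in_itv/= => /andP[h5 h6].
  by rewrite fT// ler0_norm; lra.
have z2 : W T (T + r)%R = 0%E.
  apply: integral0_eq => u /=; rewrite in_itv/= => /andP[h5 h6].
  by rewrite fT// ger0_norm; lra.
have p1 := window_plateau mf fM fL L0 r0 ft1.
have p3 := window_plateau mf fM fL L0 r0 ft3.
have p2 := window_zero mf fM fL L0 r0 ft2.
have lt1 : - T - 1 <= t1 by lra.
have := window_le_right mf fM r0 lt1; rewrite z1 adde0 => q1.
have := window_le_left mf fM r0 (ltW h4); rewrite z2 adde0 => q4.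
have q2 := window_le_left mf fM r0 (ltW t12).
have q3 := window_le_right mf fM r0 (ltW t23).
have j1 := le_trans p1 q1; have j4 := le_trans p3 q4.
have j2 := le_trans p1 (le_trans q2 (leeD2l _ p2)).
have j3 := le_trans p3 (le_trans q3 (leeD2l _ p2)).
have lrr := mulr_ge0 L0 (mulr_ge0 r0 r0).
have V0 A : (0 <= shift_var A r)%E by apply: integral_ge0.
move: (V0 `]- T - 1, t1]%classic) (V0 `]t1, t2]%classic) (V0 `]t2, t3]%classic)
  (V0 `]t3, T]%classic) j1 j2 j3 j4.
case: (V (- T - 1)%R t1 r) => [v1| |]; case: (V t1 t2 r) => [v2| |];
  case: (V t2 t3 r) => [v3| |]; case: (V t3 T r) => [v4| |] // _ _ _ _;
  rewrite ?lee_fin ?leey// -?EFinD ?lee_fin; try by move=> *; rewrite ?leey.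
lra.
Qed.
End shift_variation.

(** * Covers by small sets *)

Section hausdorff_covers.
Context {R : realType}.
Implicit Types (E A : set (R * R)).

Lemma eucl_diam_ge0 A : (0 <= eucl_diam A)%E.
Proof. by apply: ereal_sup_ubound; left. Qed.

Lemma dist_le_eucl_diam A x y : A x -> A y -> ((eucl_dist x y)%:E <= eucl_diam A)%E.
Proof. by move=> Ax Ay; apply: ereal_sup_ubound; right; exists (x, y). Qed.

Lemma eucl_diam_le A (d : R) : 0 <= d ->
  (forall x y, A x -> A y -> eucl_dist x y <= d) -> (eucl_diam A <= d%:E)%E.
Proof.
move=> d0 Ad; apply: ge_ereal_sup => _ [->|[[x y] /= [Ax Ay] <-]].
  by rewrite lee_fin.
by rewrite lee_fin Ad.
Qed.

Lemma hausdorff1_pre_ge0 (delta : R) E : (0 <= hausdorff1_pre delta E)%E.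
Proof.
apply: le_ereal_inf_tmp => _ [C _ <-].
by apply: nneseries_ge0 => k _ _; exact: eucl_diam_ge0.
Qed.

Lemma hausdorff1_ge0 E : (0 <= hausdorff1 E)%E.
Proof.
apply: le_trans (hausdorff1_pre_ge0 1 E) _.
by apply: ereal_sup_ubound; exists 1 => //=.
Qed.

(** Covers are used with real bounds [d k] of the diameters and with a base point [p k] of
    each nonempty piece. *)
Lemma hausdorff1_cover E (delta : R) : (hausdorff1 E < +oo)%E -> 0 < delta ->
  exists (C : nat -> set (R * R)) (p : nat -> R * R) (d : nat -> R),
  [/\ E `<=` \bigcup_k C k,
      (forall k y z, C k y -> C k z -> eucl_dist y z <= d k) /\
        (forall k y, C k y -> C k (p k)),
      (forall k, 0 <= d k), (forall k, d k <= delta) &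
      (\sum_(k <oo) (d k)%:E <= hausdorff1 E + delta%:E)%E].
Proof.
move=> Eoo d0.
have Ef : hausdorff1 E \is a fin_num by rewrite ge0_fin_numE ?hausdorff1_ge0.
have hp : (hausdorff1_pre delta E <= hausdorff1 E)%E.
  by apply: ereal_sup_ubound; exists delta.
have : (hausdorff1_pre delta E < hausdorff1 E + delta%:E)%E.
  by apply: le_lt_trans hp _; rewrite lteDl ?lte_fin.
move=> /ereal_inf_lt[_ [C [EC Cd] <-] Cs].
have Cf k : eucl_diam (C k) \is a fin_num.
  rewrite ge0_fin_numE ?eucl_diam_ge0//; exact: le_lt_trans (Cd k) (ltry _).
have /choice[p hp'] : forall k, exists q, forall y, C k y -> C k q.
  move=> k; have [C0|/set0P[q Cq]] := eqVneq (C k) set0; last by exists q.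
  by exists 0 => y; rewrite C0.
exists C, p, (fun k => fine (eucl_diam (C k))); split => //.
- split=> // k y z Cy Cz.
  by rewrite -lee_fin fineK//; exact: dist_le_eucl_diam.
- by move=> k; apply: fine_ge0; exact: eucl_diam_ge0.
- by move=> k; rewrite -lee_fin fineK.
- by apply: le_trans (ltW Cs); apply: lee_nneseries => [k _ _|k _];
    rewrite fineK// eucl_diam_ge0.
Qed.
End hausdorff_covers.

(** * Shadows and notches *)

Section shadows.
Context {R : realType}.
Local Notation leb := (@leb R).
Local Notation leb2 := (@leb \x @leb)%E.
Implicit Types (e x y : R * R) (G F U : set (R * R)).

(** The point with the coordinates [t] along [e] and [s] across it. *)
Definition line e (s t : R) : R * R := rot e.1 e.2 (t, s).

Definition shadow e G : set R := [set s | exists t, G (line e s t)].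

(** A line at such an offset leaves [G] and comes back: it crosses the boundary of [G]
    two times more than convexity would require. *)
Definition notch e G F : set R := [set s | exists t1 t2 t3 : R,
  [/\ t1 < t2, t2 < t3, G (line e s t1), F (line e s t2) & G (line e s t3)]].

Lemma eucl_dist_line e s s' t : dotp e e = 1 ->
  eucl_dist (line e s t) (line e s' t) = `|s - s'|.
Proof.
move=> e1; rewrite /eucl_dist -sqrtr_sqr; congr Num.sqrt; rewrite /line /rot /=.
transitivity ((s - s') ^+ 2 * dotp e e); first by rewrite /dotp; ring.
by rewrite e1 mulr1.
Qed.

Lemma eucl_dist_line_t e s t t' : dotp e e = 1 ->
  eucl_dist (line e s t) (line e s t') = `|t - t'|.
Proof.
move=> e1; rewrite /eucl_dist -sqrtr_sqr; congr Num.sqrt; rewrite /line /rot /=.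
transitivity ((t - t') ^+ 2 * dotp e e); first by rewrite /dotp; ring.
by rewrite e1 mulr1.
Qed.

Lemma line_sc e s t r : line e s t + sc r e = line e s (t + r).
Proof.
by apply/eqP; rewrite /line /rot /sc xpair_eqE /=; apply/andP; split; apply/eqP; ring.
Qed.

Let near_line e s t U : dotp e e = 1 -> open U -> U (line e s t) ->
  \forall s' \near s, U (line e s' t).
Proof.
move=> e1 /open_euclP oU /oU[d d0 dU]; near=> s'; apply: dU.
rewrite eucl_dist_line//; near: s'; exact: cvgr_dist_lt.
Unshelve. all: by end_near. Qed.

Lemma open_shadow e G : dotp e e = 1 -> open G -> open (shadow e G).
Proof.
move=> e1 oG; rewrite openE => s [t Gt]; have h := near_line e1 oG Gt.
by rewrite /interior; apply: filterS h => s' Gs'; exists t.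
Qed.

Lemma open_notch e G F : dotp e e = 1 -> open G -> open F -> open (notch e G F).
Proof.
move=> e1 oG oF; rewrite openE => s [t1 [t2 [t3 [t12 t23 G1 F2 G3]]]].
have h1 := near_line e1 oG G1; have h2 := near_line e1 oF F2.
have h3 := near_line e1 oG G3; rewrite /interior.
by apply: filterS3 h1 h2 h3 => s' ? ? ?; exists t1, t2, t3.
Qed.

Lemma notch_shadow e G F : notch e G F `<=` shadow e G.
Proof. by move=> s [t1 [_ [_ [_ _ G1 _ _]]]]; exists t1. Qed.

Lemma shadow_sub e G F : G `<=` F -> shadow e G `<=` shadow e F.
Proof. by move=> GF s [t Gt]; exists t; exact: GF. Qed.

(** On this set the smoothing at the scale [a] does not see the boundary of [G]. *)
Definition core (a : R) G : set (R * R) :=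
  [set x | exists2 b : R, a < b & forall y, eucl_dist x y < b -> G y].

Lemma open_core a G : open (core a G).
Proof.
apply/open_euclP => x [b ab bG]; exists ((b - a) / 2).
  by rewrite divr_gt0// subr_gt0.
move=> y xy; exists ((b + a) / 2); first lra.
move=> z yz; apply: bG; have := eucl_dist_triangle y x z; lra.
Qed.

Lemma core_sub a G : 0 <= a -> core a G `<=` G.
Proof.
move=> a0 x [b ab bG]; apply: bG; rewrite eucl_distxx; exact: le_lt_trans ab.
Qed.

(** The increments of the smoothed indicator of [G] in a direction [e] see
    every line that meets the core of [G] twice, once when it enters [G] and
    once when it leaves it; and four times if it leaves [G] in between. *)
Lemma smooth_increments_ge e G F (a r D : R) :
  dotp e e = 1 -> 0 < a -> open G -> (forall x, G x -> nrm x <= D) ->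
  G `&` F = set0 -> 0 <= r <= 1 -> 0 <= D ->
  let M := fine (bump_mass a) in
  let L := bump_lip a * fine (leb2 G) in
  2 * L * r <= M ->
  ((2 * r * (M - 2 * L * r))%:E *
     (leb (shadow e (core a G)) + leb (notch e (core a G) (core a F)))
   <= \int[leb2]_x `|smooth a G (x + sc r e) - smooth a G x|%:E)%E.
Proof.
move=> e1 a0 oG GD GF /andP[r0 r1] D0 M L rM.
have mG : measurable G := open_measurable_plane oG.
have Goo : (leb2 G < +oo)%E := leb2_bounded_lty mG GD.
have M0 : 0 < M.
  by apply: fine_gt0; rewrite bump_mass_gt0//= ltey_eq bump_mass_fin.
have L0 : 0 <= L by rewrite mulr_ge0 ?bump_lip_ge0 ?fine_ge0.
pose u := smooth a G.
have uL x y : `|u x - u y| <= L * eucl_dist x y by exact: smooth_lipschitz.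
have cu : continuous u by exact: (continuous_plane_lip uL).
have mu := continuous_measurable_plane cu.
pose A := shadow e (core a G); pose B := notch e (core a G) (core a F).
have mA : measurable A.
  by apply: open_measurable; apply: open_shadow => //; exact: open_core.
have mB : measurable B.
  by apply: open_measurable; apply: open_notch => //; exact: open_core.
have msh : measurable_fun [set: R * R] (fun x : R * R => x + sc r e).
  by apply: measurable_fun_pair; apply: measurable_funD.
have mF : measurable_fun [set: R * R] (fun x => `|u (x + sc r e) - u x|%:E).
  apply/measurable_EFinP; apply: measurableT_comp => //.
  by apply: measurable_funB => //; exact: (measurableT_comp mu msh).
have F0 x : (0 <= `|u (x + sc r e) - u x|%:E)%E by rewrite lee_fin.
have cs : e.1 ^+ 2 + e.2 ^+ 2 = 1 by rewrite !expr2.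
have mFr := measurableT_comp mF (measurable_rot e.1 e.2).
rewrite -[leRHS](integral2_rot cs mF F0) fubini_tonelli2//.
set k := 2 * r * _; have k0 : 0 <= k by rewrite /k !mulr_ge0// subr_ge0.
have mi (C : set R) : measurable C -> measurable_fun [set: R] (fun s => (\1_C s)%:E : \bar R).
  by move=> mC; apply/measurable_EFinP; exact: measurable_indic.
have -> : (leb A + leb B = \int[leb]_s ((\1_A s)%:E + (\1_B s)%:E))%E.
  by rewrite ge0_integralD//; [rewrite !integral_indic// !setIT|exact: mi..].
rewrite -ge0_integralZl_EFin//; last 2 first.
- by move=> s _; rewrite adde_ge0 ?lee_fin.
- by apply: emeasurable_funD; exact: mi.
apply: ge0_le_integral => //.
- by move=> s _; rewrite mule_ge0 ?lee_fin// adde_ge0 ?lee_fin.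
- by apply: measurable_funeM; apply: emeasurable_funD; exact: mi.
- exact: measurable_fun_fubini_tonelli_G.
move=> s _; rewrite /fubini_G.
pose f t := u (line e s t).
have -> : (\int[leb]_t `|u (rot e.1 e.2 (t, s) + sc r e) - u (rot e.1 e.2 (t, s))|%:E
   = shift_var f setT r)%E.
  by apply: eq_integral => t _; rewrite -/(line e s t) line_sc.
have fL t t' : `|f t - f t'| <= L * `|t - t'|.
  by rewrite -(eucl_dist_line_t s t t' e1); exact: uL.
have fM t : 0 <= f t <= M by rewrite smooth_ge0 smooth_le.
have mf : measurable_fun [set: R] f.
  have h : measurable_fun [set: R] (fun t : R => (t, s)) by exact: pair2_measurable.
  exact: (measurableT_comp (measurableT_comp mu (measurable_rot e.1 e.2)) h).
have ncore x : core a G x -> u x = M.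
  by move=> [b ab bG]; apply: smooth_full => // y xy; apply: bG; exact: lt_trans ab.
have ncoreF x : core a F x -> u x = 0.
  move=> [b ab bG]; apply: smooth_empty => // y xy Gy.
  have : (G `&` F) y by split => //; apply: bG; exact: lt_trans ab.
  by rewrite GF.
have fT t : D + a <= `|t| -> f t = 0.
  move=> Dt; apply: smooth_empty => // y xy /GD yD.
  have : `|t| <= nrm (line e s t).
    have -> : nrm (line e s t) = nrm (t, s).
      rewrite /nrm; congr Num.sqrt; rewrite /line /rot /dotp /=.
      transitivity ((t * t + s * s) * dotp e e); first by rewrite /dotp; ring.
      by rewrite e1 mulr1.
    exact: (nrm_fst (t, s)).
  have := nrmD y (line e s t - y); rewrite addrC subrK -eucl_distE; lra.
have T0 : 0 <= D + a by rewrite addr_ge0// ltW.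
have r01 : 0 <= r <= 1 by rewrite r0 r1.
(* On a line through the cores the smoothed indicator takes its extreme values, so the
   variation along the line is known. *)
rewrite !indicE; have [/set_mem sB|sB] := boolP (s \in B).
  have -> : s \in A by apply/mem_set; exact: notch_shadow sB.
  case: sB => t1 [t2 [t3 [t12 t23 h1 h2 h3]]].
  rewrite -EFinD -EFinM.
  have := shift_var_two_peaks mf fM fL fT L0 r01 M0 T0 t12 t23
    (ncore _ h1) (ncoreF _ h2) (ncore _ h3).
  by apply: le_trans; rewrite lee_fin (_ : true%:R = 1 :> R)// /k; lra.
rewrite adde0; have [/set_mem[t Gt]|sA] := boolP (s \in A); last first.
  by rewrite mule0; apply: integral_ge0.
rewrite mule1.
exact: (shift_var_peak mf fM fL fT L0 r01 M0 T0 (ncore _ Gt)).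
Qed.
End shadows.

(** * The projection inequality *)

(** Let [r] tend to 0. *)
Lemma le_of_linear_error {R : realType} (x y C r0 : R) : 0 < r0 ->
  (forall r : R, 0 < r -> r <= r0 -> x <= y + C * r) -> x <= y.
Proof.
move=> r00 h; rewrite leNgt; apply/negP => yx.
pose C' := `|C| + 1; have C'0 : 0 < C' by rewrite /C' ltr_wpDl.
pose r := Num.min r0 ((x - y) / (2 * C')).
have p0 : 0 < (x - y) / (2 * C') by rewrite divr_gt0 ?subr_gt0// mulr_gt0.
have rp : 0 < r by rewrite /r lt_min r00.
have rr0 : r <= r0 by rewrite /r ge_min lexx.
have := h r rp rr0.
have : C * r <= C' * r.
  rewrite ler_wpM2r ?(ltW rp)// /C'.
  by apply: le_trans (ler_norm C) _; rewrite lerDl.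
have : C' * r <= (x - y) / 2.
  have : r <= (x - y) / (2 * C') by rewrite /r ge_min lexx orbT.
  rewrite -(ler_pM2l C'0) => /le_trans; apply.
  rewrite (_ : C' * ((x - y) / (2 * C')) = (x - y) / 2)//.
  by field; rewrite gt_eqF.
lra.
Qed.

(** The estimates of both sides of the projection inequality at the scale [r], divided by
    [r], in the limit: all the error terms are of the order [r ^+ 2]. *)
Lemma increments_limit {R : realType} (M H S L c kap C : R) :
  0 < M -> 0 <= H -> 0 <= S -> 0 <= L -> 0 <= c -> 0 <= kap -> 0 <= C ->
  (forall r : R, 0 < r -> r <= 1 / 3 -> 2 * L * r <= M ->
    2 * r * (M - 2 * L * r) * S <=
    kap * ((2 * r ^+ 2 + r) * (M + c * (2 * r ^+ 2 + r)) * (H + r ^+ 2)) + C * r ^+ 2) ->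
  2 * S <= kap * H.
Proof.
move=> Mp H0 S0 L0 c0 kap0 C0 hr.
pose r0 := Num.min (1 / 3) (M / (2 * L + 1)).
have L1 : 0 < 2 * L + 1 by lra.
have r00 : 0 < r0 by rewrite /r0 lt_min divr_gt0// divr_gt0.
rewrite -(ler_pM2l Mp).
pose K1 := M + 3 * c * H + 2 * M * H + 3 * c + 2 * M + 6 * c * H + 6 * c.
apply: (@le_of_linear_error _ _ _ (4 * L * S + kap * K1 + C) _ r00) => r rp rr0.
have r3 : r <= 1 / 3 by apply: le_trans rr0 _; rewrite /r0 ge_min lexx.
have rM : 2 * L * r <= M.
  have : r <= M / (2 * L + 1) by apply: le_trans rr0 _; rewrite /r0 ge_min lexx orbT.
  rewrite ler_pdivlMr//; lra.
have := hr r rp r3 rM.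
set kp : R := 2 * r ^+ 2 + r.
have rr : 0 <= r ^+ 2 by exact: sqr_ge0.
have rr1 : r ^+ 2 <= r by rewrite expr2 ler_piMl; lra.
have r31 : r ^+ 3 <= r.
  by rewrite exprS; apply: (le_trans _ rr1); rewrite ler_piMl//; lra.
have kp0 : 0 <= kp by rewrite /kp; lra.
have Hr : 0 <= H + r by lra.
have cr : 0 <= c * r by rewrite mulr_ge0// ltW.
have h1 : (2 * r + 1) * (M + c * kp) * (H + r ^+ 2) <= M * H + r * K1.
  have q1 : M + c * kp <= M + 3 * c * r.
    have : c * kp <= c * (3 * r) by rewrite ler_wpM2l// /kp; lra.
    lra.
  have q2 : H + r ^+ 2 <= H + r by rewrite lerD2l.
  have q0 : 0 <= M + c * kp by rewrite addr_ge0 ?(ltW Mp)// mulr_ge0.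
  apply: (@le_trans _ _ ((2 * r + 1) * (M + 3 * c * r) * (H + r))).
    apply: ler_pM => //; last by rewrite ler_wpM2l//; lra.
      by rewrite mulr_ge0//; lra.
    by rewrite addr_ge0.
  have cH : 0 <= c * H by exact: mulr_ge0.
  have t1 : (3 * c + 2 * M + 6 * (c * H)) * r ^+ 2 <= (3 * c + 2 * M + 6 * (c * H)) * r.
    by rewrite ler_wpM2l//; lra.
  have t2 : c * r ^+ 3 <= c * r by rewrite ler_wpM2l.
  rewrite [leLHS](_ : _ = M * H + r * (M + 3 * c * H + 2 * M * H)
    + (3 * c + 2 * M + 6 * (c * H)) * r ^+ 2 + 6 * (c * r ^+ 3)); last by ring.
  rewrite /K1; lra.
move=> h3.
have h4 : r * (2 * (M - 2 * L * r) * S) <= r * (kap * (M * H + r * K1) + C * r).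
  have -> : r * (2 * (M - 2 * L * r) * S) = 2 * r * (M - 2 * L * r) * S by ring.
  apply: le_trans h3 _.
  have -> : kap * (kp * (M + c * kp) * (H + r ^+ 2)) + C * r ^+ 2 =
    r * (kap * ((2 * r + 1) * (M + c * kp) * (H + r ^+ 2)) + C * r) by rewrite /kp; ring.
  by rewrite ler_wpM2l ?(ltW rp)// lerD2r ler_wpM2l.
rewrite ler_pM2l// in h4; lra.
Qed.

Section projection_inequality.
Context {R : realType}.
Local Notation leb := (@leb R).
Local Notation leb2 := (@leb \x @leb)%E.
Implicit Types (e x y z : R * R) (A G F : set (R * R)).

Lemma shadow_lty e G D : dotp e e = 1 -> open G -> 0 <= D ->
  (forall x, G x -> nrm x <= D) -> (leb (shadow e G) < +oo)%E.
Proof.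
move=> e1 oG D0 GD.
have mS : measurable (shadow e G) by apply: open_measurable; exact: open_shadow.
apply: (@le_lt_trans _ _ (leb `[- D, D]%classic)); last first.
  by rewrite leb_itv ?ltry//; lra.
apply: le_measure; rewrite ?inE// => s [t /GD].
have -> : nrm (line e s t) = nrm (t, s).
  rewrite /nrm; congr Num.sqrt; rewrite /line /rot /dotp /=.
  transitivity ((t * t + s * s) * dotp e e); first by rewrite /dotp; ring.
  by rewrite e1 mulr1.
by move/(le_trans (nrm_snd _)); rewrite /= ler_norml in_itv.
Qed.

Lemma integral_wide_bump (a k : R) z : 0 < a -> 0 <= k ->
  (\int[leb2]_x (wide_bump a k (z - x))%:E =
   (fine (bump_mass a) + bump_lip a * k * (2 * (a + 1)) ^+ 2)%:E)%E.
Proof.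
move=> a0 k0; pose Q := `[- (a + 1), a + 1]%classic `*` `[- (a + 1), a + 1]%classic
  : set (R * R).
have mQ : measurable Q by apply: measurableX; exact: measurable_itv.
have Qm : leb2 Q = ((2 * (a + 1)) ^+ 2)%:E.
  by rewrite /Q itv_measurable_box; [congr (_%:E); ring|lra..].
have c0 : 0 <= bump_lip a * k by rewrite mulr_ge0 ?bump_lip_ge0.
have mb : measurable_fun [set: R * R] (fun x => (bump a (x - z))%:E).
  by apply/measurable_EFinP; exact: measurable_bump_shift.
have mi0 : measurable_fun [set: R * R] (fun x => (bump_lip a * k)%:E * (\1_Q x)%:E)%E.
  by apply: measurable_funeM; apply/measurable_EFinP; exact: measurable_indic.
have mi : measurable_fun [set: R * R] (fun x : R * R =>
    (bump_lip a * k)%:E * (\1_Q (x + - z))%:E)%E.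
  have ms : measurable_fun [set: R * R] (fun x : R * R => x + - z).
    by apply: measurable_fun_pair; apply: measurable_funD.
  exact: (measurableT_comp mi0 ms).
have i0 x : (0 <= (bump_lip a * k)%:E * (\1_Q x)%:E)%E by rewrite mule_ge0 ?lee_fin.
transitivity (\int[leb2]_x ((bump a (x - z))%:E +
   (bump_lip a * k)%:E * (\1_Q (x + - z))%:E))%E.
  apply: eq_integral => x _; rewrite /wide_bump EFinD -bumpN opprB; congr (_ + _)%E.
  rewrite -EFinM indicE; congr (_%:E).
  have -> : (x + - z \in Q) = in_square (a + 1) (z - x).
    apply/idP/idP; rewrite inE /Q /in_square /= !in_itv /= (distrC z.1) (distrC z.2)
      !ler_norml; first by move=> [-> ->].
    by move=> /andP[-> ->].
  by case: ifP => _; rewrite ?mulr1 ?mulr0.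
have b0 x : (0 <= (bump a (x - z))%:E)%E by rewrite lee_fin bump_ge0.
have j0 x : (0 <= (bump_lip a * k)%:E * (\1_Q (x + - z))%:E)%E by exact: i0.
rewrite ge0_integralD//.
rewrite bump_massE// (integral2_translation (- z) mi0 i0).
rewrite ge0_integralZl_EFin//; last first.
  by apply/measurable_EFinP; exact: measurable_indic.
rewrite integral_indic// setIT -[X in (_ + _ * X)%E]/(leb2 Q) Qm.
by rewrite EFinD fineK ?bump_mass_fin// EFinM.
Qed.

Let smooth_far a G D x : 0 < a -> measurable G -> (leb2 G < +oo)%E ->
  (forall x, G x -> nrm x <= D) -> D + a <= nrm x -> smooth a G x = 0.
Proof.
move=> a0 mG Goo GD xD; apply: smooth_empty => // y xy /GD yD.
have := nrmD y (x - y); rewrite addrC subrK -eucl_distE; lra.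
Qed.

(** The heart of the projection inequality, for the increments at a fixed scale
    [r]: the increments of the smoothed indicator [u] at [x] in all directions
    are controlled by its gradient, that is by its increment in the one
    direction of the gradient; and that increment is at most the total diameter
    of the pieces of the boundary near [x]. *)
Lemma sum_increments_le A (N : nat) (e : nat -> R * R) (kap a r D : R) :
  let G := interior A in
  let M := fine (bump_mass a) in
  let L2 := bump_curv a * fine (leb2 G) in
  let kp := 2 * r ^+ 2 + r in
  let W := M + bump_lip a * kp * (2 * (a + 1)) ^+ 2 in
  (forall x, G x -> nrm x <= D) -> (hausdorff1 (boundary A) < +oo)%E ->
  (forall k, (k < N)%N -> dotp (e k) (e k) = 1) ->
  (forall m, \sum_(k < N) `|dotp m (e k)| <= kap * nrm m) -> 0 <= kap ->
  0 < a -> 0 < r -> r <= 1 / 3 -> 0 <= D ->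
  (\sum_(k < N) \int[leb2]_x `|smooth a G (x + sc r (e k)) - smooth a G x|%:E <=
   (kap * (kp * W * (fine (hausdorff1 (boundary A)) + r ^+ 2)) +
    (kap + N%:R) * L2 * r ^+ 2 * (2 * (D + a + 1)) ^+ 2)%:E)%E.
Proof.
move=> G M L2 kp W GD Hoo e1 ek kap0 a0 r0 r3 D0.
have oG : open G by exact: open_interior.
have mG : measurable G := open_measurable_plane oG.
have Goo : (leb2 G < +oo)%E := leb2_bounded_lty mG GD.
have M0 : 0 <= M by rewrite fine_ge0//; apply: ltW; exact: bump_mass_gt0.
have L20 : 0 <= L2 by rewrite mulr_ge0 ?bump_curv_ge0 ?fine_ge0.
have rr0 : 0 < r ^+ 2 by rewrite exprn_gt0.
have rr : r ^+ 2 <= r * (1 / 3) by rewrite expr2 ler_wpM2l// ltW.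
have kp0 : 0 <= kp by rewrite /kp; lra.
have kp1 : kp <= 1 by rewrite /kp; lra.
have [C [p [d [AC [Cd Cp] d0 dd Hs]]]] := hausdorff1_cover Hoo rr0.
have [m mT] := smooth_taylor a0 mG Goo.
pose u := smooth a G.
have uL x y : `|u x - u y| <= bump_lip a * fine (leb2 G) * eucl_dist x y.
  exact: smooth_lipschitz.
have mu : measurable_fun [set: R * R] u.
  by apply: continuous_measurable_plane; exact: (continuous_plane_lip uL).
have msh v : measurable_fun [set: R * R] (fun x : R * R => x + v).
  by apply: measurable_fun_pair; apply: measurable_funD.
have mF v : measurable_fun [set: R * R] (fun x => `|u (x + v) - u x|%:E).
  apply/measurable_EFinP; apply: measurableT_comp => //.
  by apply: measurable_funB => //; exact: (measurableT_comp mu (msh v)).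
(* Outside of the square [Q] all the smoothed indicators and their shifts vanish. *)
pose b := D + a + 1; have b0 : 0 <= b by rewrite /b; lra.
pose Q := `[- b, b]%classic `*` `[- b, b]%classic : set (R * R).
have mQ : measurable Q by apply: measurableX; exact: measurable_itv.
have Qm : leb2 Q = ((2 * b) ^+ 2)%:E.
  by rewrite /Q itv_measurable_box; [congr (_%:E); ring|lra..].
pose S x : \bar R := (\sum_(k <oo) (d k * kp * wide_bump a kp (p k - x))%:E)%E.
have t0 k x : (0 <= (d k * kp * wide_bump a kp (p k - x))%:E)%E.
  by rewrite lee_fin mulr_ge0 ?wide_bump_ge0// mulr_ge0.
have S0 x : (0 <= S x)%E by apply: nneseries_ge0 => k _ _; exact: t0.
have grad x : ((r * nrm (m x))%:E <= S x + (L2 * r ^+ 2)%:E)%E.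
  have [m0|m0] := eqVneq (nrm (m x)) 0.
    by rewrite m0 mulr0 adde_ge0// lee_fin mulr_ge0// sqr_ge0.
  have mp : 0 < nrm (m x) by rewrite lt_neqAle eq_sym m0 nrm_ge0.
  (* The direction of the gradient: the increment in this direction controls its norm. *)
  pose nu := sc (nrm (m x))^-1 (m x).
  have nu1 : nrm nu = 1 by rewrite nrm_sc gtr0_norm ?invr_gt0// mulVf.
  have nu2 : dotp nu nu = 1 by rewrite -sqr_nrm nu1 expr1n.
  have := smooth_step_le x a0 Goo AC Cd Cp d0 dd (ltW r0) kp1 nu2.
  rewrite -/G -/u -/kp -/(S x) => h.
  have nr : nrm (sc r nu) = r by rewrite nrm_sc nu1 mulr1 gtr0_norm.
  have := mT x (sc r nu); rewrite nr => /(_ ltac:(lra)).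
  have -> : dotp (m x) (sc r nu) = r * nrm (m x).
    rewrite /nu; transitivity (r * ((nrm (m x))^-1 * dotp (m x) (m x))).
      by rewrite /dotp /sc /=; ring.
    by rewrite -sqr_nrm expr2 mulKf.
  rewrite -/u -/L2 ler_norml => /andP[h1 _].
  apply: (@le_trans _ _ ((u (x + sc r nu) - u x) + L2 * r ^+ 2)%:E).
    by rewrite lee_fin; lra.
  by rewrite EFinD leeD2r// EFinB leeBlDl.
have far x : ~ Q x -> b < nrm x.
  move=> nQ; rewrite ltNge; apply/negP => xb; apply: nQ.
  have := le_trans (nrm_fst x) xb; have := le_trans (nrm_snd x) xb.
  by rewrite !ler_norml => h1 h2; split; rewrite /= in_itv.
pose K := (kap + N%:R) * L2 * r ^+ 2.
have K0 : 0 <= K.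
  apply: mulr_ge0; last exact: sqr_ge0.
  by apply: mulr_ge0 => //; exact: addr_ge0.
have pw x : ((\sum_(k < N) `|u (x + sc r (e k)) - u x|)%:E <=
    kap%:E * S x + K%:E * (\1_Q x)%:E)%E.
  rewrite indicE; have [xQ|/negP xQ] := boolP (x \in Q); last first.
    have /far xb : ~ Q x by move=> Qx; apply: xQ; rewrite inE.
    rewrite big1 ?mule0 ?adde0 ?mule_ge0// => k _.
    have ux : u x = 0 by apply: (smooth_far a0 mG Goo GD); rewrite /b in xb; lra.
    suff -> : u (x + sc r (e k)) = 0 by rewrite ux subr0 normr0.
    apply: (smooth_far a0 mG Goo GD).
    have := nrmD (x + sc r (e k)) (- sc r (e k)); rewrite addrK nrmN nrm_sc.
    have -> : nrm (e k) = 1 by rewrite /nrm e1// sqrtr1.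
    by rewrite gtr0_norm// mulr1 /b in xb *; lra.
  rewrite mule1.
  have h1 : \sum_(k < N) `|u (x + sc r (e k)) - u x| <=
      kap * (r * nrm (m x)) + N%:R * (L2 * r ^+ 2).
    have -> : N%:R * (L2 * r ^+ 2) = \sum_(k < N) (L2 * r ^+ 2).
      by rewrite sumr_const card_ord mulr_natl.
    apply: (@le_trans _ _ (\sum_(k < N) (r * `|dotp (m x) (e k)| + L2 * r ^+ 2))).
      apply: ler_sum => k _.
      have nr : nrm (sc r (e k)) = r.
        by rewrite nrm_sc /nrm e1// sqrtr1 mulr1 gtr0_norm.
      have := mT x (sc r (e k)); rewrite nr => /(_ ltac:(lra)).
      have -> : dotp (m x) (sc r (e k)) = r * dotp (m x) (e k).
        by rewrite /dotp /sc /=; ring.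
      rewrite -/u -/L2 => h.
      have -> : r * `|dotp (m x) (e k)| = `|r * dotp (m x) (e k)|.
        by rewrite normrM gtr0_norm.
      rewrite -lerBlDl; apply: le_trans h; exact: lerB_dist.
    rewrite big_split /= lerD2r -mulr_sumr mulrCA ler_wpM2l//; exact: ltW.
  apply: (@le_trans _ _ (kap%:E * (r * nrm (m x))%:E + (N%:R * (L2 * r ^+ 2))%:E)%E).
    by rewrite -EFinM -EFinD lee_fin.
  apply: (@le_trans _ _ (kap%:E * (S x + (L2 * r ^+ 2)%:E) + (N%:R * (L2 * r ^+ 2))%:E)%E).
    by rewrite leeD2r// lee_wpmul2l ?lee_fin.
  have Lr0 : (0 <= (L2 * r ^+ 2)%:E)%E by rewrite lee_fin mulr_ge0// sqr_ge0.
  rewrite ge0_muleDr//.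
  by rewrite -addeA leeD2l// -EFinM -EFinD lee_fin /K; lra.
have mW k : measurable_fun [set: R * R] (fun x => (wide_bump a kp (p k - x))%:E).
  apply/measurable_EFinP; apply: measurable_funD.
    have -> : (fun x => bump a (p k - x)) = (fun x => bump a (x - p k)).
      by apply/funext => x; rewrite -bumpN opprB.
    exact: measurable_bump_shift.
  have -> : (fun x => if in_square (a + 1) (p k - x) then bump_lip a * kp else 0) =
      (fun x => (bump_lip a * kp) *
        \1_(`[- (a + 1), a + 1]%classic `*` `[- (a + 1), a + 1]%classic) (x + - p k)).
    apply/funext => x; rewrite indicE.
    have -> : (x + - p k \in `[- (a + 1), a + 1]%classic `*` `[- (a + 1), a + 1]%classic)
       = in_square (a + 1) (p k - x).
      apply/idP/idP; rewrite inE /in_square /= !in_itv /= (distrC (p k).1) (distrC (p k).2)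
        !ler_norml; first by move=> [-> ->].
      by move=> /andP[-> ->].
    by case: ifP => _; rewrite ?mulr1 ?mulr0.
  apply: measurable_funM => //.
  apply: (measurableT_comp (measurable_indic _) (msh (- p k))).
  by apply: measurableX; exact: measurable_itv.
have mt k : measurable_fun [set: R * R] (fun x => (d k * kp * wide_bump a kp (p k - x))%:E).
  by under eq_fun do rewrite EFinM; apply: measurable_funeM.
have mS : measurable_fun [set: R * R] S.
  by apply: ge0_emeasurable_sum => // k x _ _; exact: t0.
have mI : measurable_fun [set: R * R] (fun x => (\1_Q x)%:E : \bar R).
  by apply/measurable_EFinP; exact: measurable_indic.
rewrite -ge0_integral_sum//.
apply: (@le_trans _ _ (\int[leb2]_x (kap%:E * S x + K%:E * (\1_Q x)%:E))%E).
  apply: ge0_le_integral => //.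
  - by move=> x _; rewrite sume_ge0.
  - exact: emeasurable_sum.
  - by apply: emeasurable_funD; apply: measurable_funeM.
  - by move=> x _; rewrite sumEFin; exact: pw.
rewrite ge0_integralD//; last 4 first.
- by move=> x _; rewrite mule_ge0 ?lee_fin.
- exact: measurable_funeM.
- by move=> x _; rewrite mule_ge0 ?lee_fin.
- exact: measurable_funeM.
rewrite ge0_integralZl_EFin// ge0_integralZl_EFin//.
rewrite integral_indic// setIT -[X in (_ + _ * X <= _)%E]/(leb2 Q) Qm.
rewrite EFinD -[X in (_ <= _ + X)%E]/((K * (2 * b) ^+ 2)%:E) EFinM.
rewrite leeD2r// EFinM lee_wpmul2l ?lee_fin//.
rewrite integral_nneseries//.
have W0 : 0 <= W.
  apply: addr_ge0 => //; apply: mulr_ge0; last exact: sqr_ge0.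
  by apply: mulr_ge0 => //; exact: bump_lip_ge0.
apply: (@le_trans _ _ (\sum_(k <oo) ((kp * W)%:E * (d k)%:E))%E).
  apply: lee_nneseries => [k _ _|k _]; first by apply: integral_ge0 => x _; exact: t0.
  under eq_integral do rewrite EFinM.
  rewrite ge0_integralZl_EFin//; last 2 first.
  - by move=> x _; rewrite lee_fin wide_bump_ge0.
  - by rewrite mulr_ge0.
  by rewrite integral_wide_bump// -EFinM -EFinM lee_fin -/M -/W; lra.
rewrite nneseriesZl; last by move=> k _; rewrite lee_fin.
rewrite (EFinM (kp * W)) lee_wpmul2l ?lee_fin ?mulr_ge0//.
by rewrite EFinD fineK// ge0_fin_numE ?hausdorff1_ge0.
Qed.

(** Sending the scale [r] to 0. *)
Lemma sum_shadows_core_le A F (N : nat) (e : nat -> R * R) (kap a D : R) :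
  let G := interior A in
  (forall x, G x -> nrm x <= D) -> (hausdorff1 (boundary A) < +oo)%E ->
  open F -> G `&` F = set0 ->
  (forall k, (k < N)%N -> dotp (e k) (e k) = 1) ->
  (forall m, \sum_(k < N) `|dotp m (e k)| <= kap * nrm m) -> 0 <= kap ->
  0 < a -> 0 <= D ->
  (2%:E * \sum_(k < N) (leb (shadow (e k) (core a G)) +
                        leb (notch (e k) (core a G) (core a F)))
   <= kap%:E * hausdorff1 (boundary A))%E.
Proof.
move=> G GD Hoo oF GF e1 ek kap0 a0 D0.
have oG : open G by exact: open_interior.
have mG : measurable G := open_measurable_plane oG.
have Goo : (leb2 G < +oo)%E := leb2_bounded_lty mG GD.
set n := fun k => (leb (shadow (e k) (core a G)) +
                   leb (notch (e k) (core a G) (core a F)))%E.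
have nf (k : 'I_N) : n k \is a fin_num.
  have h : (leb (shadow (e k) (core a G)) < +oo)%E.
    have := @shadow_lty (e k) (core a G) D (e1 _ (ltn_ord k)) (@open_core R a G) D0.
    by apply=> x xG; apply: GD; exact: (core_sub (ltW a0) xG).
  have h' : (leb (notch (e k) (core a G) (core a F)) < +oo)%E.
    apply: le_lt_trans h; apply: le_measure; rewrite ?inE.
    - by apply: open_measurable; apply: open_notch; rewrite ?e1//; exact: open_core.
    - by apply: open_measurable; apply: open_shadow; rewrite ?e1//; exact: open_core.
    - exact: notch_shadow.
  by rewrite /n fin_numD !ge0_fin_numE// h h'.
have n0 k : (0 <= n k)%E by rewrite adde_ge0.
pose S := \sum_(k < N) fine (n k).
have SE : (\sum_(k < N) n k = S%:E)%E.
  by rewrite /S -sumEFin; apply: eq_bigr => k _; rewrite fineK.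
have S0 : 0 <= S by apply: sumr_ge0 => k _; rewrite fine_ge0.
set H := fine (hausdorff1 (boundary A)).
have HE : hausdorff1 (boundary A) = H%:E by rewrite fineK// ge0_fin_numE ?hausdorff1_ge0.
have H0 : 0 <= H by rewrite fine_ge0// hausdorff1_ge0.
rewrite SE HE -!EFinM lee_fin.
set M := fine (bump_mass a).
have Mp : 0 < M by apply: fine_gt0; rewrite bump_mass_gt0//= ltey_eq bump_mass_fin.
set L := bump_lip a * fine (leb2 G).
have L0 : 0 <= L by rewrite mulr_ge0 ?bump_lip_ge0 ?fine_ge0.
pose c := bump_lip a * (2 * (a + 1)) ^+ 2.
have c0 : 0 <= c by rewrite mulr_ge0 ?bump_lip_ge0 ?sqr_ge0.
pose C := (kap + N%:R) * (bump_curv a * fine (leb2 G)) * (2 * (D + a + 1)) ^+ 2.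
have C0 : 0 <= C.
  apply: mulr_ge0; last exact: sqr_ge0.
  apply: mulr_ge0; first exact: addr_ge0.
  by apply: mulr_ge0; [exact: bump_curv_ge0|exact: fine_ge0].
apply: (@increments_limit _ M H S L c kap C) => // r rp r3 rM.
have r01 : 0 <= r <= 1 by apply/andP; split; lra.
have up := sum_increments_le GD Hoo e1 ek kap0 a0 rp r3 D0.
have lo : ((2 * r * (M - 2 * L * r))%:E * S%:E <=
  \sum_(k < N) \int[leb2]_x `|smooth a G (x + sc r (e k)) - smooth a G x|%:E)%E.
  rewrite -SE ge0_sume_distrr; last by move=> k _; exact: n0.
  apply: lee_sum => k _.
  exact: (smooth_increments_ge (e1 _ (ltn_ord k)) a0 oG GD GF r01 D0 rM).
have := le_trans lo up; rewrite -EFinM lee_fin -/M -/H -/G {lo up}.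
move=> /le_trans; apply; rewrite /c /C le_eqVlt; apply/orP; left; apply/eqP; ring.
Qed.
End projection_inequality.

Section projection_inequality_limit.
Context {R : realType}.
Local Notation leb := (@leb R).
Implicit Types (e x y z : R * R) (A G F : set (R * R)).

Let seqcore G (n : nat) := core n.+1%:R^-1 G.

Let core_homo G n m : (n <= m)%N -> seqcore G n `<=` seqcore G m.
Proof.
move=> nm x [b nb bG]; exists b => //; apply: le_lt_trans nb.
by rewrite lef_pV2 ?posrE ?ltr0Sn// ler_nat ltnS.
Qed.

Let core_ex G x : open G -> G x -> exists n, seqcore G n x.
Proof.
move=> /open_euclP oG /oG[d d0 dG].
have [n nd] : exists n : nat, n.+1%:R^-1 < d.
  exists (Num.truncn d^-1); rewrite invf_plt ?posrE ?ltr0Sn//.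
  exact: truncnS_gt.
by exists n, d.
Qed.

(** The projection inequality: the directions [e k] are weighted so that the sum
    of the [`|m . e k|] is at most [kap] times the norm of [m]. Every line that
    meets the interior contributes twice, and two times more if it leaves the
    set in between. *)
Lemma sum_shadows_le A F (N : nat) (e : nat -> R * R) (kap D : R) :
  let G := interior A in
  (forall x, G x -> nrm x <= D) -> (hausdorff1 (boundary A) < +oo)%E ->
  open F -> G `&` F = set0 ->
  (forall k, (k < N)%N -> dotp (e k) (e k) = 1) ->
  (forall m, \sum_(k < N) `|dotp m (e k)| <= kap * nrm m) -> 0 <= kap -> 0 <= D ->
  (2%:E * \sum_(k < N) (leb (shadow (e k) G) + leb (notch (e k) G F))
   <= kap%:E * hausdorff1 (boundary A))%E.
Proof.
move=> G GD Hoo oF GF e1 ek kap0 D0.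
have oG : open G by exact: open_interior.
have cvS (k : 'I_N) : leb (shadow (e k) (seqcore G n)) @[n --> \oo] --> leb (shadow (e k) G).
  have -> : shadow (e k) G = \bigcup_n shadow (e k) (seqcore G n).
    apply/seteqP; split => s.
      by move=> [t /(core_ex oG)[n Gn]]; exists n => //; exists t.
    move=> [n _]; apply: shadow_sub; apply: core_sub.
    by rewrite invr_ge0.
  apply: (@nondecreasing_cvg_mu _ _ _ leb).
  - move=> n; apply: open_measurable; apply: open_shadow; first exact: e1.
    exact: open_core.
  - apply: bigcup_measurable => n _; apply: open_measurable; apply: open_shadow.
      exact: e1.
    exact: open_core.
  - by move=> n m nm; apply/subsetPset; apply: shadow_sub; exact: core_homo.
have cvN (k : 'I_N) : leb (notch (e k) (seqcore G n) (seqcore F n)) @[n --> \oo]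
    --> leb (notch (e k) G F).
  have -> : notch (e k) G F = \bigcup_n notch (e k) (seqcore G n) (seqcore F n).
    apply/seteqP; split => s.
      move=> [t1 [t2 [t3 [t12 t23 /(core_ex oG)[n1 h1] /(core_ex oF)[n2 h2]
        /(core_ex oG)[n3 h3]]]]].
      exists (maxn n1 (maxn n2 n3)) => //; exists t1, t2, t3; split => //.
      + by apply: core_homo h1; rewrite leq_maxl.
      + by apply: core_homo h2; rewrite !leq_max leqnn orbT.
      + by apply: core_homo h3; rewrite !leq_max leqnn !orbT.
    move=> [n _ [t1 [t2 [t3 [t12 t23 h1 h2 h3]]]]].
    have n0 : (0 : R) <= n.+1%:R^-1 by rewrite invr_ge0.
    by exists t1, t2, t3; split => //; exact: (core_sub n0).
  apply: (@nondecreasing_cvg_mu _ _ _ leb).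
  - move=> n; apply: open_measurable; apply: open_notch; first exact: e1.
      exact: open_core.
    exact: open_core.
  - apply: bigcup_measurable => n _; apply: open_measurable; apply: open_notch.
    + exact: e1.
    + exact: open_core.
    + exact: open_core.
  - move=> n m nm; apply/subsetPset => s [t1 [t2 [t3 [t12 t23 h1 h2 h3]]]].
    by exists t1, t2, t3; split => //; exact: core_homo nm _ _.
have cv : (2%:E * \sum_(k < N) (leb (shadow (e k) (seqcore G n)) +
   leb (notch (e k) (seqcore G n) (seqcore F n))))%E @[n --> \oo] -->
   (2%:E * \sum_(k < N) (leb (shadow (e k) G) + leb (notch (e k) G F)))%E.
  apply: cvgeZl => //; apply: cvg_nnesum => k _.
    by apply: nearW => n; rewrite adde_ge0.
  apply: cvgeD; [|exact: cvS|exact: cvN].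
  by rewrite ge0_adde_def// inE measure_ge0.
apply: (cvge_to_le cv); apply: nearW => n.
apply: (sum_shadows_core_le GD Hoo oF GF e1 ek kap0 _ D0).
by rewrite invr_gt0.
Qed.
End projection_inequality_limit.

Section directions.
Context {R : realType}.
Implicit Types (m : R * R) (t : R).

Definition dir t : R * R := (cos t, sin t).

Lemma dir1 t : dotp (dir t) (dir t) = 1.
Proof. by rewrite /dotp /= -!expr2 cos2Dsin2. Qed.

Lemma polar m : exists2 t, `|t| <= pi & m = sc (nrm m) (dir t).
Proof.
have [m0|m0] := eqVneq (nrm m) 0.
  exists 0; first by rewrite normr0 pi_ge0.
  rewrite m0; move/eqP: m0; rewrite nrm_eq0 => /eqP ->.
  by rewrite /sc !mul0r.
have mp : 0 < nrm m by rewrite lt_neqAle eq_sym m0 nrm_ge0.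
pose x := m.1 / nrm m; pose y := m.2 / nrm m.
have xy : x ^+ 2 + y ^+ 2 = 1.
  rewrite /x /y !expr_div_n -mulrDl sqr_nrm /dotp !expr2 divff//.
  by rewrite -/(dotp m m) -sqr_nrm sqrf_eq0.
have x1 : -1 <= x <= 1.
  by rewrite -ler_norml -(expr_le1 (n := 2))// real_normK ?num_real//; have := sqr_ge0 y; lra.
have sx : Num.sqrt (1 - x ^+ 2) = `|y| by rewrite -sqrtr_sqr; congr Num.sqrt; lra.
have [y0|y0] := leP 0 y.
  exists (acos x); first by rewrite ger0_norm ?acos_ge0 ?acos_lepi.
  rewrite /dir acosK ?in_itv// sin_acos// sx ger0_norm//.
  by rewrite /sc /x /y /= !(mulrC (nrm m)) !divfK// -surjective_pairing.
exists (- acos x); first by rewrite normrN ger0_norm ?acos_ge0 ?acos_lepi.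
rewrite /dir cosN sinN acosK ?in_itv// sin_acos// sx ltr0_norm//.
by rewrite opprK /sc /x /y /= !(mulrC (nrm m)) !divfK// -surjective_pairing.
Qed.

Variable N : nat.
Let h : R := pi / N%:R.

Let F t : R := \sum_(k < N) `|cos (t - k%:R * h)|.

Let Fshift t : (0 < N)%N -> F (t + h) = F t.
Proof.
move=> N0; have Nh : N%:R * h = pi by rewrite mulrC divfK// pnatr_eq0 -lt0n.
rewrite /F -!(big_mkord xpredT (fun k => `|cos (_ - k%:R * h)|)).
rewrite -(prednK N0) big_nat_recl// [RHS]big_nat_recr//= addrC.
congr (_ + _); last first.
  by apply: eq_bigr => k _; congr `|cos _|; rewrite -(natr1 k) mulrDl; ring.
have -> : t + h - 0 * h = (t - N.-1%:R * h) + pi.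
  by rewrite -Nh -{2}(prednK N0) -natr1 mulrDl; ring.
by rewrite cosDpi normrN.
Qed.

Let Fshiftn t (j : nat) : (0 < N)%N -> F (t + j%:R * h) = F t.
Proof.
move=> N0; elim: j => [|j IH]; first by rewrite mul0r addr0.
by rewrite -natr1 mulrDl mul1r addrA Fshift.
Qed.

Let Fshiftz t (j : int) : (0 < N)%N -> F (t + j%:~R * h) = F t.
Proof.
move=> N0; case: j => j; first exact: Fshiftn.
rewrite NegzE mulrNz mulNr -[LHS](Fshiftn _ j.+1 N0); congr F.
by rewrite subrK.
Qed.

(** In the sum over equidistributed lines the angle can be moved to the window
    where all the cosines are nonnegative; there the sum telescopes. *)
Lemma sum_abs_cos_le t : (0 < N)%N -> F t <= (sin (pi / (2 * N%:R)))^-1.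
Proof.
move=> N0; have Np : 0 < (N%:R : R) by rewrite ltr0n.
have hp : 0 < h by rewrite divr_gt0// pi_gt0.
have Nh : N%:R * h = pi by rewrite mulrC divfK// gt_eqF.
(* Shift the angle into the window in which the [N] cosines are nonnegative. *)
pose j := Num.floor ((pi / 2 - t) / h).
have jle : j%:~R <= (pi / 2 - t) / h by exact: Num.Theory.ge_floor.
have jgt : (pi / 2 - t) / h < j%:~R + 1.
  by have := Num.Theory.floorD1_gt ((pi / 2 - t) / h); rewrite intrD.
rewrite -(Fshiftz t j N0); set b := t + _.
have b1 : b <= pi / 2 by rewrite /b -lerBrDl -ler_pdivlMr.
have b2 : pi / 2 - h < b.
  have : pi / 2 - t < (j%:~R + 1) * h by rewrite -ltr_pdivrMr.
  by rewrite [(_ + 1) * h]mulrDl mul1r /b; lra.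
have s0 : 0 < sin (pi / (2 * N%:R)) :> R.
  have e : pi / (2 * N%:R) = h / 2 :> R by rewrite /h; field; rewrite gt_eqF.
  rewrite e; apply: sin_gt0_pi; rewrite divr_gt0//=.
  have : h <= pi by rewrite /h ler_pdivrMr// ler_peMr ?pi_ge0// ler1n.
  by have := @pi_gt0 R; lra.
rewrite -[leRHS]mul1r ler_pdivlMr//.
have e : pi / (2 * N%:R) = h / 2 :> R by rewrite /h; field; rewrite gt_eqF.
have step (k : 'I_N) : `|cos (b - k%:R * h)| * sin (h / 2) =
    (sin (b + h / 2 - k%:R * h) - sin (b + h / 2 - k.+1%:R * h)) / 2.
  have kN : k%:R * h <= (N%:R - 1) * h.
    rewrite ler_wpM2r ?(ltW hp)//.
    by rewrite lerBrDr natr1 ler_nat.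
  have k0 : 0 <= k%:R * h by rewrite mulr_ge0// ltW.
  rewrite ger0_norm; last first.
    apply: cos_ge0_pihalf; apply/andP; split.
      by move: kN; rewrite mulrBl mul1r Nh; lra.
    lra.
  have -> : b + h / 2 - k%:R * h = (b - k%:R * h) + h / 2 by ring.
  have -> : b + h / 2 - k.+1%:R * h = (b - k%:R * h) - h / 2.
    by rewrite -(natr1 k); field.
  by rewrite (sinD _ (h / 2)) (sinB _ (h / 2)); field.
rewrite e mulr_suml (eq_bigr _ (fun k _ => step k)).
rewrite -mulr_suml.
have -> : \sum_(k < N) (sin (b + h / 2 - k%:R * h) - sin (b + h / 2 - k.+1%:R * h)) =
    sin (b + h / 2) - sin (b + h / 2 - N%:R * h).
  have := @telescope_sumr R 0 N (fun k => - sin (b + h / 2 - k%:R * h)) (leq0n _).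
  rewrite mul0r subr0 opprK big_mkord => h1; rewrite [RHS]addrC -h1.

  by apply: eq_bigr => k _; rewrite opprK addrC.
rewrite Nh; have := sinDpi (b + h / 2 - pi); rewrite subrK => ->.
have := sin_le1 (- (b + h / 2 - pi)); rewrite sinN; lra.
Qed.

Lemma sum_dotp_dir_le m : (0 < N)%N ->
  \sum_(k < N) `|dotp m (dir (k%:R * h))| <= (sin (pi / (2 * N%:R)))^-1 * nrm m.
Proof.
move=> N0; have [t _ mt] := polar m.
have -> : \sum_(k < N) `|dotp m (dir (k%:R * h))| = nrm m * F t.
  rewrite /F mulr_sumr; apply: eq_bigr => k _.
  rewrite -[nrm m in RHS]ger0_norm ?nrm_ge0// -normrM; congr `|_|.
  by rewrite {1}mt /dotp /sc /dir /= cosB; ring.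
by rewrite mulrC ler_wpM2r ?nrm_ge0// sum_abs_cos_le.
Qed.
End directions.

(** * Averages of Poisson kernels over directions *)

Section poisson_average.
Context {R : realType}.
Implicit Types (A B C p D : R).

Let recip A B C (t : R) := (A + B * cos t + C * sin t)^-1.

Let den_gt0 A B C p t : 0 <= p -> p < A -> B ^+ 2 + C ^+ 2 = p ^+ 2 ->
  A - p <= A + B * cos t + C * sin t <= A + p.
Proof.
move=> p0 pA BCp.
have : (B * cos t + C * sin t) ^+ 2 <= p ^+ 2.
  have <- : (B * cos t + C * sin t) ^+ 2 + (B * sin t - C * cos t) ^+ 2 = p ^+ 2.
    rewrite -BCp -[RHS]mulr1 -(cos2Dsin2 t); ring.
  by rewrite lerDl sqr_ge0.
rewrite -[leLHS](real_normK (num_real _)) ler_pXn2r ?nnegrE// ler_norml => /andP[h1 h2].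
by apply/andP; split; lra.
Qed.

Let recip_double A B C p t : 0 <= p -> p < A -> B ^+ 2 + C ^+ 2 = p ^+ 2 ->
  recip A B C t + recip A B C (t + pi) =
  2 * recip (A - (B ^+ 2 + C ^+ 2) / (2 * A)) (- (B ^+ 2 - C ^+ 2) / (2 * A))
            (- (B * C) / A) (2 * t).
Proof.
move=> p0 pA BCp; have A0 : A != 0 by rewrite gt_eqF//; lra.
have /andP[d1 _] := den_gt0 t p0 pA BCp.
have /andP[d2 _] := den_gt0 (t + pi) p0 pA BCp.
rewrite cosDpi sinDpi in d2; rewrite /recip cosDpi sinDpi.
have -> : cos (2 * t) = cos t ^+ 2 - sin t ^+ 2.
  by rewrite mulr_natl cos_mulr2n -(cos2Dsin2 t); ring.
have -> : sin (2 * t) = 2 * (cos t * sin t) by rewrite mulr_natl sin_mulr2n; ring.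
set X := B * cos t + C * sin t.
have AX : A + X != 0 by rewrite gt_eqF// /X addrA; lra.
have AX' : A - X != 0 by rewrite gt_eqF// /X; lra.
have -> : A + B * cos t + C * sin t = A + X by rewrite /X; ring.
have -> : A + B * - cos t + C * - sin t = A - X by rewrite /X; ring.
rewrite (_ : A - _ + _ + _ = (A + X) * (A - X) / A); last first.
  have -> : (B ^+ 2 + C ^+ 2) / (2 * A) =
      (B ^+ 2 + C ^+ 2) * (cos t ^+ 2 + sin t ^+ 2) / (2 * A).
    by rewrite cos2Dsin2 mulr1.
  by rewrite /X; field.
by field; rewrite A0 AX AX'.
Qed.

Let avg (n : nat) A B C : R :=
  (\sum_(k < 2 ^ n) recip A B C (2 * (k%:R * (pi / (2 ^ n)%:R)))) / (2 ^ n)%:R.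

Let avgS n A B C p : 0 <= p -> p < A -> B ^+ 2 + C ^+ 2 = p ^+ 2 ->
  avg n.+1 A B C = avg n (A - (B ^+ 2 + C ^+ 2) / (2 * A))
    (- (B ^+ 2 - C ^+ 2) / (2 * A)) (- (B * C) / A).
Proof.
move=> p0 pA BCp; rewrite /avg.
have N0 : (2 ^ n)%:R != 0 :> R by rewrite pnatr_eq0 expn_eq0.
have -> : (2 ^ n.+1)%:R = 2 * (2 ^ n)%:R :> R by rewrite expnS natrM.
rewrite -(big_mkord xpredT (fun k => recip _ _ _ (2 * (k%:R * _)))).
rewrite (@big_cat_nat _ _ _ (2 ^ n))//=; last by rewrite leq_exp2l.
rewrite -[X in _ + \sum_(X <= _ < _) _]add0n big_addn.
rewrite (_ : (2 ^ n.+1 - 2 ^ n = 2 ^ n)%N); last by rewrite expnS mul2n -addnn addnK.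
rewrite -big_split/= big_mkord; set X := (X in X / _ = _).
have -> : X / (2 * (2 ^ n)%:R) = X / 2 / (2 ^ n)%:R by field.
congr (_ / _); rewrite /X mulr_suml {X}; apply: eq_bigr => k _.
rewrite natrD (_ : 2 * ((k%:R + (2 ^ n)%:R) * _) =
  2 * (k%:R * (pi / (2 * (2 ^ n)%:R))) + pi); last by field.
rewrite (recip_double _ p0 pA BCp) mulrAC divff// mul1r.
by congr (recip _ _ _); field.
Qed.

(** Adding [pi] to the angle and averaging turns [1 / (A + B cos + C sin)] into a
    function of the same form in the doubled angle; [A ^+ 2 - B ^+ 2 - C ^+ 2] is
    invariant, while the oscillating part at least halves. *)
Let avg_recip n A B C p D : 0 <= p -> p < A -> B ^+ 2 + C ^+ 2 = p ^+ 2 ->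
  0 < D -> D ^+ 2 = A ^+ 2 - p ^+ 2 ->
  `|avg n A B C - D^-1| <= 2 * p / D ^+ 2 / (2 ^ n)%:R.
Proof.
elim: n A B C p => [|n IH] A B C p p0 pA BCp D0 DA.
  rewrite /avg expn0 divr1 big_ord1 mul0r mulr0 divr1.
  have /andP[h1 h2] := den_gt0 0 p0 pA BCp.
  rewrite /recip; move: (A + B * cos 0 + C * sin 0) h1 h2 => d h1 h2.
  have dp : 0 < A - p by lra.
  have e : 2 * p / D ^+ 2 = (A - p)^-1 - (A + p)^-1.
    by rewrite DA; field; rewrite subr_sqr mulf_neq0 ?gt_eqF//; lra.
  have D1 : (A + p)^-1 <= D^-1 <= (A - p)^-1.
    have q : 0 <= p * (A - p) by apply: mulr_ge0; lra.
    have [D1 D2] : A - p <= D /\ D <= A + p.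
      have sq (x y : R) : 0 < x -> 0 < y -> x ^+ 2 <= y ^+ 2 -> x <= y.
        by move=> x0 y0; rewrite ler_pXn2r// nnegrE ltW.
      by split; apply: sq; rewrite ?DA ?D0//; [nra|lra|nra].
    by rewrite !lef_pV2 ?posrE ?D1 ?D2//; lra.
  have D2 : (A + p)^-1 <= d^-1 <= (A - p)^-1.
    by rewrite !lef_pV2 ?posrE ?h1 ?h2//; lra.
  rewrite e ler_norml; move: D1 D2 => /andP[? ?] /andP[? ?]; apply/andP; split; lra.
have A0 : 0 < A by lra.
rewrite (avgS _ p0 pA BCp).
have hp : 0 <= p ^+ 2 / (2 * A) by apply: divr_ge0; [exact: sqr_ge0|lra].
have hp2 : p ^+ 2 / (2 * A) <= p / 2.
  by rewrite ler_pdivrMr; [nra|lra].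
have := IH (A - (B ^+ 2 + C ^+ 2) / (2 * A)) (- (B ^+ 2 - C ^+ 2) / (2 * A))
  (- (B * C) / A) (p ^+ 2 / (2 * A)) hp _ _ D0 _.
move=> /(_ _ _ _)/le_trans; apply.
- rewrite BCp; suff : p ^+ 2 / (2 * A) * 2 < A by lra.
  by apply: (@le_lt_trans _ _ p) => //; lra.
- by rewrite -[p ^+ 2]BCp; field; rewrite gt_eqF.
- by rewrite DA -BCp; field; rewrite gt_eqF.
have n0 : (2 ^ n)%:R != 0 :> R by rewrite pnatr_eq0 expn_eq0.
have -> : 2 * p / D ^+ 2 / (2 ^ n.+1)%:R = 2 * (p / 2) / D ^+ 2 / (2 ^ n)%:R.
  by rewrite expnS natrM; field; rewrite n0 gt_eqF.
rewrite ler_wpM2r ?invr_ge0 ?ler0n// ler_wpM2r ?invr_ge0 ?sqr_ge0//; lra.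
Qed.

Definition poisson (b u : R) : R := b / (pi * (b ^+ 2 + u ^+ 2)).

(** The Riesz kernel is an integral of one-dimensional kernels over the directions: as
    [b ^+ 2 + dotp z (dir t) ^+ 2] is an affine function of [cos (2 * t)] and
    [sin (2 * t)], [avg_recip] evaluates the average up to an error uniform in [z]. *)
Lemma poisson_average n N (b : R) (z : R * R) : 0 < b -> N = (2 ^ n)%N ->
  `|pi / N%:R * \sum_(k < N) poisson b (dotp z (dir (k%:R * (pi / N%:R)))) -
    (Num.sqrt (b ^+ 2 + nrm z ^+ 2))^-1| <= (b * N%:R)^-1.
Proof.
move=> b0 NE; have N0 : 0 < N%:R :> R by rewrite NE ltr0n expn_gt0.
pose A := b ^+ 2 + nrm z ^+ 2 / 2; pose p := nrm z ^+ 2 / 2.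
pose B := (z.1 ^+ 2 - z.2 ^+ 2) / 2; pose C := z.1 * z.2.
set S : R := Num.sqrt (b ^+ 2 + nrm z ^+ 2).
have b2 : 0 < b ^+ 2 by rewrite exprn_gt0.
have z2 : 0 <= nrm z ^+ 2 by rewrite sqr_ge0.
have S2 : S ^+ 2 = b ^+ 2 + nrm z ^+ 2 by rewrite sqr_sqrtr//; lra.
have S0 : 0 < S by rewrite sqrtr_gt0; lra.
have p0 : 0 <= p by rewrite /p; lra.
have pA : p < A by rewrite /p /A; lra.
have BCp : B ^+ 2 + C ^+ 2 = p ^+ 2.
  by rewrite /B /C /p sqr_nrm /dotp; field.
have D2 : (b * S) ^+ 2 = A ^+ 2 - p ^+ 2.
  by rewrite exprMn S2 /A /p; field.
have D0 : 0 < b * S by rewrite mulr_gt0.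
have h := avg_recip n p0 pA BCp D0 D2; rewrite -NE in h.
have e : pi / N%:R * \sum_(k < N) poisson b (dotp z (dir (k%:R * (pi / N%:R)))) =
    b * avg n A B C.
  rewrite /avg -NE mulrAC [RHS]mulrA; congr (_ / _).
  rewrite !mulr_sumr; apply: eq_bigr => k _.
  rewrite /poisson /recip; set t := k%:R * _.
  have -> : b ^+ 2 + dotp z (dir t) ^+ 2 = A + B * cos (2 * t) + C * sin (2 * t).
    have -> : cos (2 * t) = cos t ^+ 2 - sin t ^+ 2.
      by rewrite mulr_natl cos_mulr2n -(cos2Dsin2 t); ring.
    have -> : sin (2 * t) = 2 * (cos t * sin t) by rewrite mulr_natl sin_mulr2n; ring.
    rewrite /A /B /C sqr_nrm /dotp /dir /=.
    have -> : (z.1 * z.1 + z.2 * z.2) / 2 =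
        (z.1 * z.1 + z.2 * z.2) * (cos t ^+ 2 + sin t ^+ 2) / 2.
      by rewrite cos2Dsin2 mulr1.
    by field.
  have /andP[h1 _] := den_gt0 (2 * t) p0 pA BCp.
  have d0 : A + B * cos (2 * t) + C * sin (2 * t) != 0 by rewrite gt_eqF//; lra.
  have pi0 : pi != 0 :> R by rewrite gt_eqF ?pi_gt0.
  by rewrite invfM mulrCA mulVKf.
rewrite e (_ : b * avg n A B C - S^-1 = b * (avg n A B C - (b * S)^-1)); last first.
  by rewrite mulrBr invfM mulVKf// gt_eqF.
rewrite normrM (gtr0_norm b0).
apply: le_trans (ler_wpM2l (ltW b0) h) _.
rewrite [(b * N%:R)^-1]invfM mulrA ler_wpM2r ?invr_ge0 ?ler0n//.
rewrite mulrA ler_pdivrMr ?exprn_gt0 // exprMn S2.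
have -> : b^-1 * (b ^+ 2 * (b ^+ 2 + nrm z ^+ 2)) = b * (b ^+ 2 + nrm z ^+ 2).
  by field; rewrite gt_eqF.
by rewrite ler_wpM2l ?(ltW b0)// /p; lra.
Qed.
End poisson_average.

(** * The semigroup of Poisson kernels *)

Section poisson_convolution.
Context {R : realType}.
Local Notation leb := (@leb R).
Implicit Types (b c u h p q s : R).

Lemma poisson_ge0 b u : 0 < b -> 0 <= poisson b u.
Proof.
move=> b0; rewrite /poisson divr_ge0 ?(ltW b0)// mulr_ge0 ?pi_ge0//.
by rewrite addr_ge0 ?sqr_ge0.
Qed.

Let den_gt0 b u : 0 < b -> 0 < b ^+ 2 + u ^+ 2.
Proof. by move=> b0; rewrite ltr_wpDr ?sqr_ge0// exprn_gt0. Qed.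

Lemma poisson_le b u : 0 < b -> poisson b u <= (pi * b)^-1.
Proof.
move=> b0; have p0 := @pi_gt0 R; rewrite /poisson ler_pdivrMr ?mulr_gt0 ?den_gt0//.
rewrite (_ : (pi * b)^-1 * _ = b + u ^+ 2 / b); last first.
  by move: (@pi R) p0 => P P0; field; rewrite !gt_eqF.
by rewrite lerDl divr_ge0 ?sqr_ge0 ?(ltW b0).
Qed.

Lemma poissonN b u : poisson b (- u) = poisson b u.
Proof. by rewrite /poisson sqrrN. Qed.

Lemma continuous_poisson b : 0 < b -> continuous (poisson b).
Proof.
move=> b0 u; rewrite /continuous_at /poisson; apply: cvgM; first exact: cvg_cst.
apply: cvgV; first by rewrite mulf_neq0 ?gt_eqF ?pi_gt0 ?den_gt0.
apply: cvgM; first exact: cvg_cst; apply: cvgD; first exact: cvg_cst.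
by apply: cvgM; exact: cvg_id.
Qed.

Lemma continuous_poisson_shift b p : 0 < b -> continuous (fun s => poisson b (s - p)).
Proof.
move=> b0 s; apply: (@continuous_comp _ _ _ (fun s => s - p) (poisson b)).
  by apply: cvgB; [exact: cvg_id|exact: cvg_cst].
exact: continuous_poisson.
Qed.

Let atan_div b c s : 0 < b -> is_derive s 1 (fun x => atan ((x + c) / b))
  (b / (b ^+ 2 + (s + c) ^+ 2)).
Proof.
move=> b0; have h : is_derive s 1 (fun x => (x + c) / b) b^-1.
  apply/is_derive1_caratheodory; exists (fun=> b^-1); split => //.
    by move=> z; rewrite -mulrBl opprD addrACA subrr addr0 mulrC.
  exact: cst_continuous.
have := @is_derive1_comp _ atan (fun x => (x + c) / b) s _ _ (is_derive1_atan _) h.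
move=> h1; apply: is_derive_eq h1 _.
by field; rewrite !gt_eqF ?den_gt0.
Qed.

Let ln_sq b c s : 0 < b -> is_derive s 1 (fun x => ln (b ^+ 2 + (x + c) ^+ 2))
  (2 * (s + c) / (b ^+ 2 + (s + c) ^+ 2)).
Proof.
move=> b0; have h : is_derive s 1 (fun x => b ^+ 2 + (x + c) ^+ 2) (2 * (s + c)).
  apply/is_derive1_caratheodory; exists (fun z => z + (s + 2 * c)); split.
  - by move=> z; ring.
  - by apply: cvgD; [exact: cvg_id|exact: cvg_cst].
  - by ring.
have := @is_derive1_comp _ (@ln R) (fun x => b ^+ 2 + (x + c) ^+ 2) s _ _
  (is_derive1_ln (den_gt0 _ b0)) h.
by move=> h1; apply: is_derive_eq h1 _; rewrite mulrC.
Qed.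

Let FTC_even (f F : R -> R) (l : R) : (forall x, 0 <= f x) -> continuous f ->
  f =1 f \o -%R -> (forall x : R, is_derive x 1 F (f x)) -> F 0 = 0 ->
  F x @[x --> +oo] --> l -> (\int[leb]_x (f x)%:E = (2 * l)%:E)%E.
Proof.
move=> f0 cf fe dF F0 Fl.
have mf : measurable_fun [set: R] (EFin \o f).
  by apply/measurable_EFinP; exact: continuous_measurable_fun.
rewrite integral_leb//; last by move=> x _; rewrite lee_fin.
rewrite ge0_symfun_integralT// -set_itvcy (@ge0_continuous_FTC2y _ f F 0 l)//.
- by rewrite F0 sube0 EFinM.
- exact: continuous_subspaceT.
- apply: cvg_at_right_filter; apply: differentiable_continuous.
  by apply/derivable1_diffP; exact: ex_derive.
- by move=> x _; rewrite derive1E; exact: derive_val.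
Qed.

Lemma FTC_itv (f F : R -> R) a c : a < c -> continuous f ->
  (forall x, 0 <= f x) -> (forall x : R, is_derive x 1 F (f x)) ->
  (\int[leb]_(x in `[a, c]) (f x)%:E = (F c - F a)%:E)%E.
Proof.
move=> ac cf f0 dF.
have mf : measurable_fun [set: R] (EFin \o f).
  by apply/measurable_EFinP; exact: continuous_measurable_fun.
have cF x : {for x, continuous F}.
  apply: differentiable_continuous.
  by apply/derivable1_diffP; exact: ex_derive.
rewrite integral_leb//; last 2 first.
- exact: measurable_funTS.
- by move=> x _; rewrite lee_fin.
rewrite (@continuous_FTC2 _ f F)//.
- exact: continuous_subspaceT.
- split; last 2 first.
  + by apply: cvg_at_right_filter; exact: cF.
  + by apply: cvg_at_left_filter; exact: cF.
  + by move=> x _; exact: ex_derive.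
- by move=> x _; rewrite derive1E; exact: derive_val.
Qed.

Lemma poisson_itv b p (r : R) : 0 < b -> 0 < r ->
  (\int[leb]_(s in `[(p - r)%R, (p + r)%R]) (poisson b (s - p))%:E =
   (2 / pi * atan (r / b))%:E)%E.
Proof.
move=> b0 r0; have pp := @pi_gt0 R.
have dF (s : R) : is_derive s 1 (fun s => pi^-1 * atan ((s - p) / b)) (poisson b (s - p)).
  have h := @is_deriveZ _ _ _ _ pi^-1 _ _ _ (atan_div (- p) s b0).
  apply: is_derive_eq h _; rewrite /GRing.scale /= /poisson.
  by rewrite invfM mulrCA.
rewrite (FTC_itv _ _ _ dF); last 3 first.
- by rewrite ltrBlDr -addrA ltrDl addr_gt0.
- exact: continuous_poisson_shift.
- by move=> s; exact: poisson_ge0.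
congr EFin; have -> : p + r - p = r by ring.
have -> : p - r - p = - r by ring.
by rewrite mulNr atanN; ring.
Qed.

Let near_oo (f : R -> R) (C : R) : (\forall s \near +oo, `|f s| <= C / s) ->
  f s @[s --> +oo] --> 0.
Proof.
move=> h; apply/cvgr0Pnorm_le => e e0.
near=> s; have s0 : 0 < s by near: s; exact: nbhs_pinfty_gt.
have : `|f s| <= C / s by near: s.
move=> /le_trans; apply; rewrite ler_pdivrMr// mulrC -ler_pdivrMr//.
Unshelve. all: by end_near. Qed.

Let atan_oo b c : 0 < b -> atan ((s + c) / b) @[s --> +oo] --> pi / 2.
Proof.
move=> b0; have h : (s + c) / b @[s --> +oo] --> +oo.
  apply/cvgryPge => A; near=> s; rewrite ler_pdivlMr// -lerBlDr.
  by near: s; apply: nbhs_pinfty_ge; exact: num_real.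
exact: (cvg_comp _ _ h (@cvgy_atan R)).
Unshelve. all: by end_near. Qed.

Let conv_diag b : 0 < b ->
  (\int[leb]_s (poisson b s * poisson b s)%:E = ((2 * pi * b)^-1)%:E)%E.
Proof.
move=> b0; have pp := @pi_gt0 R.
pose F s := (b / pi) ^+ 2 * (s / (2 * b ^+ 2 * (b ^+ 2 + s ^+ 2)) +
  (2 * b ^+ 3)^-1 * atan ((s + 0) / b)).
have pe : (b / pi) ^+ 2 * (0 + (2 * b ^+ 3)^-1 * (pi / 2)) = (4 * pi * b)^-1.
  by move: (@pi R) pp => P P0; field; rewrite !gt_eqF.
have dF (s : R) : is_derive s 1 F (poisson b s * poisson b s).
  have h1 : is_derive s 1 (fun s => s / (2 * b ^+ 2 * (b ^+ 2 + s ^+ 2)))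
      ((b ^+ 2 - s ^+ 2) / (2 * b ^+ 2 * (b ^+ 2 + s ^+ 2) ^+ 2)).
    apply/is_derive1_caratheodory.
    exists (fun z => (b ^+ 2 - s * z) / (2 * b ^+ 2 * (b ^+ 2 + s ^+ 2)) *
      (b ^+ 2 + z ^+ 2)^-1); split.
    + by move=> z; field; rewrite !gt_eqF ?den_gt0.
    + apply: cvgM.
        apply: cvgM; last exact: cvg_cst; apply: cvgB; first exact: cvg_cst.
        by apply: cvgM; [exact: cvg_cst|exact: cvg_id].
      apply: cvgV; first by rewrite gt_eqF ?den_gt0.
      by apply: cvgD; [exact: cvg_cst|apply: cvgM; exact: cvg_id].
    + by field; rewrite !gt_eqF ?den_gt0.
  have h2 := @is_deriveZ _ _ _ _ (2 * b ^+ 3)^-1 _ _ _ (atan_div 0 s b0).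
  have h := @is_deriveZ _ _ _ _ ((b / pi) ^+ 2) _ _ _ (is_deriveD h1 h2).
  apply: (is_derive_eq (f := F) h); rewrite /GRing.scale /= addr0 /poisson.
  by move: (@pi R) pp => P P0; field; rewrite !gt_eqF ?den_gt0.
rewrite (FTC_even (l := (4 * pi * b)^-1) _ _ _ dF).
- by congr EFin; move: (@pi R) pp => P P0; field; rewrite !gt_eqF.
- by move=> s; rewrite mulr_ge0 ?poisson_ge0.
- by move=> s; apply: cvgM; exact: continuous_poisson.
- by move=> s /=; rewrite poissonN.
- by rewrite /F /= add0r mul0r mul0r atan0 mulr0 addr0 mulr0.
- rewrite -pe; apply: cvgM; first exact: cvg_cst; apply: cvgD; last first.
    by apply: cvgM; [exact: cvg_cst|exact: atan_oo].
  apply: (@near_oo _ (2 * b ^+ 2)^-1); near=> s.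
  have s0 : 0 < s by near: s; exact: nbhs_pinfty_gt.
  rewrite ger0_norm; last by rewrite divr_ge0 ?(ltW s0)// !mulr_ge0 ?sqr_ge0// ltW ?den_gt0.
  rewrite ler_pdivrMr ?mulr_gt0 ?exprn_gt0 ?den_gt0//.
  have -> : (2 * b ^+ 2)^-1 / s * (2 * b ^+ 2 * (b ^+ 2 + s ^+ 2)) = s + b ^+ 2 / s.
    by field; rewrite !gt_eqF.
  by rewrite lerDl divr_ge0 ?sqr_ge0 ?(ltW s0).
Unshelve. all: by end_near. Qed.

Let ln_oo b h : 0 < b ->
  ln (b ^+ 2 + (s + h) ^+ 2) - ln (b ^+ 2 + (s - h) ^+ 2) @[s --> +oo] --> 0.
Proof.
move=> b0.
have r1 : (b ^+ 2 + (s + h) ^+ 2) / (b ^+ 2 + (s - h) ^+ 2) @[s --> +oo] --> (1 : R).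
  rewrite -[1]add0r.
  have -> : (fun s => (b ^+ 2 + (s + h) ^+ 2) / (b ^+ 2 + (s - h) ^+ 2)) =
      (fun s => 4 * s * h / (b ^+ 2 + (s - h) ^+ 2) + 1).
    by apply/funext => s; field; rewrite gt_eqF ?den_gt0.
  apply: cvgD; last exact: cvg_cst.
  apply: (@near_oo _ (16 * `|h|)); near=> s.
  have s0 : 0 < s by near: s; exact: nbhs_pinfty_gt.
  have sh : 2 * `|h| <= s by near: s; apply: nbhs_pinfty_ge; exact: num_real.
  have q : (s / 2) ^+ 2 <= (s - h) ^+ 2.
    by rewrite ler_pXn2r ?nnegrE//; have := ler_norm h; lra.
  rewrite !normrM (gtr0_norm s0) normfV (gtr0_norm (den_gt0 _ b0)) ger0_norm//.
  rewrite ler_pdivrMr ?den_gt0//.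
  rewrite [leRHS]mulrAC ler_pdivlMr//.
  have h0 := normr_ge0 h; move: `|h| h0 => y y0.
  have -> : 4 * s * y * s = 16 * y * (s / 2) ^+ 2 by field.
  rewrite ler_wpM2l//; first lra.
  have := sqr_ge0 b; lra.
have l1 : ln ((b ^+ 2 + (s + h) ^+ 2) / (b ^+ 2 + (s - h) ^+ 2)) @[s --> +oo] --> ln (1 : R).
  apply: continuous_cvg; last exact: r1.
  exact: continuous_ln.
rewrite ln1 in l1; apply: cvg_trans l1; apply: near_eq_cvg; near=> s.
by rewrite ln_div ?posrE ?den_gt0.
Unshelve. all: by end_near. Qed.

Let conv_off b h : 0 < b -> h != 0 ->
  (\int[leb]_s (poisson b (s - h) * poisson b (s + h))%:E =
   (poisson (2 * b) (2 * h))%:E)%E.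
Proof.
move=> b0 h0; have pp := @pi_gt0 R.
have hb := den_gt0 h b0.
pose c := (b / pi) ^+ 2 * (8 * h * (b ^+ 2 + h ^+ 2))^-1.
pose F s := c * (2 * h / b * (atan ((s - h) / b) + atan ((s + h) / b)) +
  (ln (b ^+ 2 + (s + h) ^+ 2) - ln (b ^+ 2 + (s - h) ^+ 2))).
have pe : c * (2 * h / b * (pi / 2 + pi / 2) + 0) = poisson (2 * b) (2 * h) / 2.
  rewrite /c /poisson; move: (@pi R) pp => P P0; field.
  by rewrite h0 !gt_eqF// -?exprMn ?den_gt0// mulr_gt0.
have dF (s : R) : is_derive s 1 F (poisson b (s - h) * poisson b (s + h)).
  have d1 := is_deriveD (atan_div (- h) s b0) (atan_div h s b0).
  have d2 := @is_deriveZ _ _ _ _ (2 * h / b) _ _ _ d1.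
  have d3 := is_deriveB (ln_sq h s b0) (ln_sq (- h) s b0).
  have d4 := @is_deriveZ _ _ _ _ c _ _ _ (is_deriveD d2 d3).
  apply: (is_derive_eq (f := F) d4); rewrite /GRing.scale /= /poisson /c.
  move: (@pi R) pp => P P0; field.
  by rewrite h0 !gt_eqF ?den_gt0.
rewrite (FTC_even (l := poisson (2 * b) (2 * h) / 2) _ _ _ dF).
- by congr EFin; field.
- by move=> s; rewrite mulr_ge0 ?poisson_ge0.
- move=> s; apply: cvgM; first exact: continuous_poisson_shift.
  by have := @continuous_poisson_shift b (- h) b0 s; rewrite opprK.
- by move=> s /=; rewrite mulrC; congr (_ * _); rewrite -poissonN; congr poisson; ring.
- by rewrite /F !add0r mulNr atanN sqrrN subrr addNr mulr0 addr0 mulr0.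
- rewrite -pe; apply: cvgM; first exact: cvg_cst; apply: cvgD; last exact: ln_oo.
  apply: cvgM; first exact: cvg_cst; apply: cvgD; last exact: atan_oo.
  exact: atan_oo.
Qed.

(** The semigroup law of the Poisson kernels. *)
Lemma poisson_conv b p q : 0 < b ->
  (\int[leb]_s (poisson b (s - p) * poisson b (s - q))%:E =
   (poisson (2 * b) (p - q))%:E)%E.
Proof.
move=> b0; pose h := (p - q) / 2.
rewrite -(@integral_translation _ (fun s => (poisson b (s - p) * poisson b (s - q))%:E)
  ((p + q) / 2)); last 2 first.
- apply/measurable_EFinP; apply: measurable_funM; apply: continuous_measurable_fun;
    exact: continuous_poisson_shift.
- by move=> s; rewrite lee_fin mulr_ge0 ?poisson_ge0.
have -> : (fun s => (poisson b (s + (p + q) / 2 - p) * poisson b (s + (p + q) / 2 - q))%:E) =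
    (fun s => (poisson b (s - h) * poisson b (s + h))%:E).
  apply/funext => s; congr (poisson _ _ * poisson _ _)%:E; rewrite /h; by field.
have -> : p - q = 2 * h by rewrite /h; field.
have [->|h0] := eqVneq h 0; last exact: conv_off.
rewrite mulr0.
under eq_integral do rewrite subr0 addr0.
rewrite conv_diag//; congr EFin; rewrite /poisson.
have pp := @pi_gt0 R; move: (@pi R) pp => P P0; field; rewrite !gt_eqF//.
Qed.
End poisson_convolution.

(** * Duality for the energy of Poisson kernels *)

Section poisson_duality.
Context {R : realType}.
Local Notation leb := (@leb R).
Variables (mu : probability (R * R)%type R) (b : R) (c : R * R -> R).
Hypotheses (b0 : 0 < b) (mc : measurable_fun [set: R * R] c).

Let K (x : R * R) (s : R) : \bar R := (poisson b (s - c x))%:E.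

Let K0 x s : (0 <= K x s)%E.
Proof. by rewrite lee_fin poisson_ge0. Qed.

Let mpoisson : measurable_fun [set: R] (poisson b).
Proof. by apply: continuous_measurable_fun; exact: continuous_poisson. Qed.

Let mK : measurable_fun [set: (R * R) * R] (fun z => K z.1 z.2).
Proof.
apply/measurable_EFinP; apply: measurableT_comp; first exact: mpoisson.
apply: measurable_funB; first exact: measurable_snd.
by apply: measurableT_comp => //; exact: measurable_fst.
Qed.

Let mKx x : measurable_fun [set: R] (K x).
Proof. exact: (measurableT_comp mK (pair1_measurable x)). Qed.

Let mKs s : measurable_fun [set: R * R] (K^~ s).
Proof. exact: (measurableT_comp mK (pair2_measurable s)). Qed.

Let f (s : R) : \bar R := (\int[mu]_x K x s)%E.

Let f0 s : (0 <= f s)%E.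
Proof. by apply: integral_ge0 => x _; exact: K0. Qed.

Let mf : measurable_fun [set: R] f.
Proof.
by apply: (@measurable_fun_fubini_tonelli_G _ _ _ _ R mu
  (fun z : (R * R) * R => K z.1 z.2)) => // z; exact: K0.
Qed.

Let f_fin s : (f s < +oo)%E.
Proof.
apply: (@le_lt_trans _ _ (\int[mu]_x (cst ((pi * b)^-1)%:E x))%E).
  apply: ge0_le_integral => //; last by move=> x _; rewrite lee_fin poisson_le.
rewrite integral_cst//; set m := (X in (_ * X)%E).
by rewrite (_ : m = 1%E) ?mule1 ?ltry//; exact: probability_setT.
Qed.

(** Completing the square: the energy of [mu] for the kernel [poisson (2 * b)],
    the convolution square of [poisson b], dominates its pairing with any
    density. *)
Lemma poisson_energy_ge (g : R -> R) :
  measurable_fun [set: R] g -> (forall s, 0 <= g s) ->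
  (2%:E * \int[mu]_x \int[leb]_s (poisson b (s - c x) * g s)%:E <=
   \int[mu]_x \int[mu]_y (poisson (2 * b) (c x - c y))%:E +
   \int[leb]_s (g s ^+ 2)%:E)%E.
Proof.
move=> mg g0; have mgE : measurable_fun [set: R] (EFin \o g).
  exact/measurable_EFinP.
have lhs : (\int[mu]_x \int[leb]_s (poisson b (s - c x) * g s)%:E =
    \int[leb]_s (f s * (g s)%:E))%E.
  rewrite (@fubini_tonelli _ _ _ _ R mu leb
    (fun z : (R * R) * R => (poisson b (z.2 - c z.1) * g z.2)%:E)).
  - apply: eq_integral => s _; rewrite /f -ge0_integralZr//.
    by rewrite lee_fin.
  - under eq_fun do rewrite EFinM.
    apply: emeasurable_funM; first exact: mK.
    exact: (measurableT_comp mgE measurable_snd).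
  - by move=> z; rewrite lee_fin mulr_ge0// poisson_ge0.
have rhs : (\int[mu]_x \int[mu]_y (poisson (2 * b) (c x - c y))%:E =
    \int[leb]_s (f s * f s))%E.
  transitivity (\int[mu]_x \int[leb]_s (K x s * f s))%E.
    apply: eq_integral => x _.
    transitivity (\int[mu]_y \int[leb]_s (K x s * K y s))%E.
      by apply: eq_integral => y _; rewrite -poisson_conv.
    rewrite (@fubini_tonelli _ _ _ _ R mu leb
      (fun z : (R * R) * R => K x z.2 * K z.1 z.2)%E).
    - apply: eq_integral => s _; rewrite /= ge0_integralZl//.
    - apply: emeasurable_funM; last exact: mK.
      by apply: measurableT_comp; [exact: mKx|exact: measurable_snd].
    - by move=> z; rewrite mule_ge0.
  rewrite (@fubini_tonelli _ _ _ _ R mu leb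
    (fun z : (R * R) * R => K z.1 z.2 * f z.2)%E).
  - apply: eq_integral => s _; rewrite /= ge0_integralZr//.
  - apply: emeasurable_funM; first exact: mK.
    by apply: measurableT_comp; [exact: mf|exact: measurable_snd].
  - by move=> z; rewrite mule_ge0.
rewrite lhs rhs.
have mfg : measurable_fun [set: R] (fun s => f s * (g s)%:E)%E.
  exact: emeasurable_funM.
rewrite -ge0_integralZl//; last by move=> s _; rewrite mule_ge0// lee_fin.
rewrite -ge0_integralD//; last 4 first.
- by move=> s _; rewrite mule_ge0.
- exact: emeasurable_funM.
- by move=> s _; rewrite lee_fin sqr_ge0.
- by apply/measurable_EFinP; exact: measurable_funX.
apply: ge0_le_integral => //.
- by move=> s _; rewrite mule_ge0// mule_ge0// lee_fin.
- exact: measurable_funeM.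
- apply: emeasurable_funD; first exact: emeasurable_funM.
  by apply/measurable_EFinP; exact: measurable_funX.
move=> s _; have ff : f s \is a fin_num by rewrite ge0_fin_numE.
rewrite -(fineK ff) -!EFinM -EFinD lee_fin.
by have := sqr_ge0 (fine (f s) - g s); nra.
Qed.
End poisson_duality.

(** * A lower bound for the Riesz energy by shadows *)

Section energy_lower_bound.
Context {R : realType}.
Local Notation leb := (@leb R).
Implicit Types (e x y z : R * R) (A : set R) (G : set (R * R)).

Definition coord e x : R := e.1 * x.2 - e.2 * x.1.

Lemma line_coord e x : dotp e e = 1 -> line e (coord e x) (dotp x e) = x.
Proof.
move=> e1; rewrite /line /rot /coord /= [RHS]surjective_pairing.
have h v : v * dotp e e = v by rewrite e1 mulr1.
by congr (_, _); rewrite -[RHS]h /dotp; ring.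
Qed.

Lemma coord_line e (s t : R) : dotp e e = 1 -> coord e (line e s t) = s.
Proof.
move=> e1; rewrite /line /rot /coord /=.
by transitivity (s * dotp e e); [rewrite /dotp; ring|rewrite e1 mulr1].
Qed.

Lemma coordB e x y : coord e (x - y) = coord e x - coord e y.
Proof. by rewrite /coord /=; ring. Qed.

Lemma coord_le e x : dotp e e = 1 -> `|coord e x| <= nrm x.
Proof.
move=> e1; have := dotp_abs_le (x.2, - x.1) e.
have -> : nrm e = 1 by rewrite /nrm e1 sqrtr1.
have -> : nrm (x.2, - x.1) = nrm x by rewrite /nrm /dotp /= mulrNN addrC.
by rewrite mulr1; have -> : dotp (x.2, - x.1) e = coord e x by rewrite /dotp /coord /=; ring.
Qed.

Lemma shadow_coord e G x : dotp e e = 1 -> G x -> shadow e G (coord e x).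
Proof. by move=> e1 Gx; exists (dotp x e); rewrite line_coord. Qed.

Lemma measurable_coord e : measurable_fun [set: R * R] (coord e).
Proof.
apply: measurable_funB; apply: measurable_funM => //.
Qed.

Lemma poisson_average_coord n N (b : R) x : 0 < b -> N = (2 ^ n)%N ->
  `|pi / N%:R * \sum_(k < N) poisson b (coord (dir (k%:R * (pi / N%:R))) x) -
    (Num.sqrt (b ^+ 2 + nrm x ^+ 2))^-1| <= (b * N%:R)^-1.
Proof.
move=> b0 NE; have := poisson_average (x.2, - x.1) b0 NE.
have -> : nrm (x.2, - x.1) = nrm x by rewrite /nrm /dotp /= mulrNN addrC.
congr (`|_ * _ - _| <= _); apply: eq_bigr => k _; congr poisson.
by rewrite /dotp /coord /=; ring.
Qed.

Lemma measurable_riesz_kernel :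
  measurable_fun [set: (R * R) * (R * R)] (fun z : (R * R) * (R * R) => riesz_kernel z.1 z.2).
Proof.
have md : measurable_fun [set: (R * R) * (R * R)] (fun z : (R * R) * (R * R) => eucl_dist z.1 z.2).
  have ms : measurable_fun [set: R] (Num.sqrt : R -> R).
    by apply: continuous_measurable_fun; exact: sqrt_continuous.
  apply: (measurableT_comp ms).
  have m1 : measurable_fun [set: (R * R) * (R * R)] (fun z : (R * R) * (R * R) => z.1.1 - z.2.1).
    apply: measurable_funB.
      exact: (measurableT_comp measurable_fst measurable_fst).
    exact: (measurableT_comp measurable_fst measurable_snd).
  have m2 : measurable_fun [set: (R * R) * (R * R)] (fun z : (R * R) * (R * R) => z.1.2 - z.2.2).
    apply: measurable_funB.
      exact: (measurableT_comp measurable_snd measurable_fst).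
    exact: (measurableT_comp measurable_snd measurable_snd).
  by apply: measurable_funD; apply: measurable_funX.
suff mi : measurable_fun [set: R] (fun r : R => (r%:E^-1)%E) by exact: (measurableT_comp mi md).
under eq_fun do rewrite inver.
apply: measurable_fun_if => //.
- by apply: measurable_fun_eqr.
- rewrite setTI.
  have -> : (fun r : R => r == 0) @^-1` [set false] = [set r : R | r != 0].
    by apply/seteqP; split=> r /=; [move=> ->|move/negbTE].
  apply/measurable_EFinP; apply: open_continuous_measurable_fun; first last.
    by move=> r /set_mem /= r0; exact: inv_continuous.
  have -> : [set r : R | r != 0] = ~` [set 0 : R].
    by apply/seteqP; split=> r /= /eqP.
  by rewrite openC; apply: compact_closed => //; exact: compact_set1.
Qed.

Definition trunc_affine A (al a s : R) : R := (al + a * s) * \1_A s.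

Let trunc_in A al a s : A s -> trunc_affine A al a s = al + a * s.
Proof. by move=> As; rewrite /trunc_affine indicE mem_set// mulr1. Qed.

Let trunc_ge0 A al a s : (forall s, A s -> 0 <= al + a * s) -> 0 <= trunc_affine A al a s.
Proof.
move=> h; rewrite /trunc_affine indicE; have [/set_mem As|_] := boolP (s \in A).
  by rewrite mulr1 h.
by rewrite mulr0.
Qed.

Let measurable_trunc A al a : measurable A -> measurable_fun [set: R] (trunc_affine A al a).
Proof.
move=> mA; apply: measurable_funM; last exact: measurable_indic.
by apply: measurable_funD => //; apply: measurable_funM.
Qed.

Let window_ge A (al a p r b L M : R) : 0 < b -> 0 < r -> measurable A ->
  (forall s, `|s - p| <= r -> A s) -> (forall s, A s -> 0 <= al + a * s <= M) ->
  `|a| <= L ->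
  ((al + a * p)%:E <= \int[leb]_s (poisson b (s - p) * trunc_affine A al a s)%:E +
    (L * r + (1 - 2 / pi * atan (r / b)) * M)%:E)%E.
Proof.
move=> b0 r0 mA Ap AM aL; set t := 2 / pi * atan (r / b).
have pp := @pi_gt0 R.
have t1 : t <= 1.
  rewrite /t mulrC -[2 / pi]invf_div ler_pdivrMr ?divr_gt0// mul1r.
  by rewrite ltW ?atan_ltpi2.
have t0 : 0 <= t.
  rewrite /t mulr_ge0 ?divr_ge0 ?(ltW pp)// ltW// -[ltLHS]atan0.
  by apply: lt_atan; rewrite divr_gt0.
have /andP[h0 hM] : 0 <= al + a * p <= M.
  by apply: AM; apply: Ap; rewrite subrr normr0 ltW.
set I := (X in (X + _)%E).
have I0 : (0 <= I)%E.
  apply: integral_ge0 => s _; rewrite lee_fin mulr_ge0 ?poisson_ge0 ?trunc_ge0//.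
  by move=> s' /AM/andP[].
have L0 : 0 <= L by apply: le_trans aL.
have Lr : 0 <= L * r by rewrite mulr_ge0// ltW.
have tM : 0 <= (1 - t) * M by rewrite mulr_ge0 ?subr_ge0//; exact: le_trans hM.
have [small|big] := leP (al + a * p) (L * r).
  rewrite -[leLHS]add0e; apply: leeD => //; rewrite lee_fin.
  by apply: le_trans small _; rewrite lerDl.
have mg : measurable_fun [set: R] (fun s => (poisson b (s - p) * trunc_affine A al a s)%:E).
  apply/measurable_EFinP; apply: measurable_funM; last exact: measurable_trunc.
  by apply: continuous_measurable_fun; exact: continuous_poisson_shift.
have IE : (((al + a * p - L * r) * t)%:E <= I)%E.
  rewrite EFinM -(poisson_itv p b0 r0) -ge0_integralZl//; last 3 first.
  - apply: measurable_funTS; apply/measurable_EFinP; apply: continuous_measurable_fun.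
    exact: continuous_poisson_shift.
  - by move=> s _; rewrite lee_fin poisson_ge0.
  - by rewrite lee_fin subr_ge0 ltW.
  apply: (@le_trans _ _ (\int[leb]_(s in `[(p - r)%R, (p + r)%R])
      (poisson b (s - p) * trunc_affine A al a s)%:E)%E); last first.
    apply: ge0_subset_integral => //.
    by move=> s _; rewrite lee_fin mulr_ge0 ?poisson_ge0 ?trunc_ge0// => s' /AM/andP[].
  apply: ge0_le_integral => //.
  - move=> s _; rewrite mule_ge0// lee_fin ?poisson_ge0//.
    by rewrite subr_ge0 ltW.
  - apply: measurable_funeM; apply: measurable_funTS; apply/measurable_EFinP.
    by apply: continuous_measurable_fun; exact: continuous_poisson_shift.
  - exact: measurable_funTS.
  move=> s; rewrite /= in_itv /= => /andP[s1 s2].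
  have sp : `|s - p| <= r by rewrite ler_norml; apply/andP; split; lra.
  rewrite -EFinM lee_fin mulrC ler_wpM2l ?poisson_ge0// trunc_in; last exact: Ap.
  have := ler_norm (a * (p - s)); rewrite normrM distrC => h1.
  have h2 : `|a| * `|s - p| <= L * r by rewrite ler_pM.
  have h3 : a * (p - s) = a * p - a * s by ring.
  by clear -h1 h2 h3; lra.
apply: (@le_trans _ _ (((al + a * p - L * r) * t)%:E + (L * r + (1 - t) * M)%:E)%E).
  by rewrite -EFinD lee_fin; nra.
exact: leeD2r.
Qed.

(** One scale of the energy estimate: [b] is the width of the Poisson kernel and
    [r] the depth below which points of [G] are discarded. *)
Let energy_ge_err (mu : probability (R * R)%type R) G (n N : nat) (al a : nat -> R)
    (b r L M : R) :
  let e k := dir (k%:R * (pi / N%:R)) : R * R in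
  open G -> mu G = 1%E -> N = (2 ^ n)%N -> 0 < b -> 0 < r ->
  (forall k : 'I_N, `|a k| <= L) ->
  (forall (k : 'I_N) s, shadow (e k) G s -> 0 <= al k + a k * s <= M) ->
  (forall x, \sum_(k < N) a k * coord (e k) x = 0) ->
  ((pi / N%:R * \sum_(k < N) (2 * al k))%:E <=
   \int[mu]_x \int[mu]_y riesz_kernel x y +
   (pi / N%:R)%:E * \sum_(k < N) \int[leb]_(s in shadow (e k) G) ((al k + a k * s) ^+ 2)%:E +
   ((2 * b * N%:R)^-1)%:E +
   (2 * pi)%:E * ((L * r + (1 - 2 / pi * atan (r / b)) * M)%:E + M%:E * mu (G `\` core r G)))%E.
Proof.
move=> e oG muG NE b0 r0 aL AM a0.
have N0 : 0 < N%:R :> R by rewrite NE ltr0n expn_gt0.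
have pN0 : 0 <= pi / N%:R :> R by rewrite divr_ge0 ?pi_ge0// ltW.
have e1 k : dotp (e k) (e k) = 1 by exact: dir1.
pose A k := shadow (e k) G; pose g k := trunc_affine (A k) (al k) (a k).
have mA k : measurable (A k) by apply: open_measurable; exact: open_shadow.
have mG : measurable G by exact: open_measurable_plane.
have mC : measurable (core r G) by apply: open_measurable_plane; exact: open_core.
have AMk (k : 'I_N) s : A k s -> 0 <= al k + a k * s <= M by exact: AM.
have A0 (k : 'I_N) s : A k s -> 0 <= al k + a k * s by move=> /AMk/andP[].
have G0 : G !=set0.
  by apply/set0P/eqP => G0; move: muG; rewrite G0 measure0 => /eqP; rewrite eqe eq_sym oner_eq0.
have M0 : 0 <= M.
  case: G0 => x Gx; have NN : (0 < N)%N by rewrite NE expn_gt0.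
  have /andP[h1 h2] := AMk (Ordinal NN) _ (shadow_coord (e1 _) Gx).
  exact: le_trans h2.
pose err := (L * r + (1 - 2 / pi * atan (r / b)) * M).
pose inner k x := (\int[leb]_s (poisson b (s - coord (e k) x) * g k s)%:E)%E.
have g0 (k : 'I_N) s : 0 <= g k s by apply: trunc_ge0 => s' /AMk/andP[].
have mg k : measurable_fun [set: R] (g k) by exact: measurable_trunc.
have inner0 (k : 'I_N) x : (0 <= inner k x)%E.
  by apply: integral_ge0 => s _; rewrite lee_fin mulr_ge0 ?poisson_ge0.
have minner (k : 'I_N) : measurable_fun [set: R * R] (inner k).
  apply: (@measurable_fun_fubini_tonelli_F _ _ _ _ R leb
    (fun z : (R * R) * R => (poisson b (z.2 - coord (e k) z.1) * g k z.2)%:E)); last first.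
    by move=> z; rewrite lee_fin mulr_ge0 ?poisson_ge0.
  apply/measurable_EFinP; apply: measurable_funM.
    apply: measurableT_comp.
      by apply: continuous_measurable_fun; exact: continuous_poisson.
    apply: measurable_funB; first exact: measurable_snd.
    by apply: measurableT_comp; [exact: measurable_coord|exact: measurable_fst].
  by apply: measurableT_comp; [exact: mg|exact: measurable_snd].
have err0 : 0 <= err.
  have ppi := @pi_gt0 R.
  have NN : (0 < N)%N by rewrite NE expn_gt0.
  have L0 : 0 <= L by apply: le_trans (aL (Ordinal NN)).
  rewrite /err addr_ge0 ?mulr_ge0 ?(ltW r0)// subr_ge0.
  by rewrite mulrC -[2 / pi]invf_div ler_pdivrMr ?divr_gt0// mul1r ltW ?atan_ltpi2.
(* Away from the boundary of [G] the competitors are recovered from their convolutions with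
   the Poisson kernel; near the boundary they are at most [M]. *)
have h1 (k : 'I_N) x : G x -> ((al k + a k * coord (e k) x)%:E <=
    inner k x + err%:E + M%:E * (\1_(G `\` core r G) x)%:E)%E.
  move=> Gx; rewrite indicE; have [/set_mem[_ Cx]|] := boolP (x \in _).
    rewrite mule1; have /andP[_ h] := AMk k _ (shadow_coord (e1 _) Gx).
    apply: (@le_trans _ _ M%:E); first by rewrite lee_fin.
    by rewrite leeDr// adde_ge0// lee_fin.
  rewrite mule0 adde0 => /negP Cx; apply: window_ge => //.
  - move=> s sx; have [y ry yG] : core r G x.
      by apply: contrapT => nC; apply: Cx; rewrite inE.
    exists (dotp x (e k)); apply: yG; rewrite -{1}(line_coord x (e1 k)).
    by rewrite eucl_dist_line// distrC (le_lt_trans sx).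
  - exact: AMk.

have intG (v : R) : (\int[mu]_(x in G) cst v%:E x)%E = v%:E.
  rewrite integral_cst//; set m := (X in (_ * X)%E).
  by rewrite (_ : m = 1%E) ?mule1//; exact: muG.
have h2 (k : 'I_N) : (\int[mu]_(x in G) (al k + a k * coord (e k) x)%:E <=
    \int[mu]_x inner k x + err%:E + M%:E * mu (G `\` core r G))%E.
  apply: (@le_trans _ _ (\int[mu]_(x in G)
     (inner k x + err%:E + M%:E * (\1_(G `\` core r G) x)%:E))%E).
    apply: ge0_le_integral => //.
    - by move=> x Gx; rewrite lee_fin A0//; exact: shadow_coord.
    - apply/measurable_EFinP; apply: measurable_funD => //; apply: measurable_funM => //.
      by apply: measurable_funTS; exact: measurable_coord.
    - apply: emeasurable_funD; first by apply: emeasurable_funD => //; exact: measurable_funTS.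
      apply: measurable_funeM; apply/measurable_EFinP; apply: measurable_indic.
      exact: measurableD.
    - by move=> x; exact: h1.
  have mI : measurable_fun G (fun x => (\1_(G `\` core r G) x)%:E : \bar R).
    by apply/measurable_EFinP; apply: measurable_indic; exact: measurableD.
  rewrite ge0_integralD//; last 4 first.
  - by move=> x _; rewrite adde_ge0// lee_fin.
  - by apply: emeasurable_funD => //; exact: measurable_funTS.
  - by move=> x _; rewrite mule_ge0// lee_fin.
  - exact: measurable_funeM.
  rewrite ge0_integralD//; last exact: measurable_funTS.
  rewrite ge0_integralZl_EFin//.
  rewrite integral_indic//; last exact: measurableD.
  rewrite intG; apply: leeD; first apply: leeD => //.
    exact: ge0_subset_integral.
  rewrite lee_wpmul2l ?lee_fin//; apply: le_measure; rewrite ?inE.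
  - by apply: measurableI => //; exact: measurableD.
  - exact: measurableD.
  - by move=> x [].
(* The slopes cancel: only the constants [al k] survive the summation. *)
have sumal : (\sum_(k < N) \int[mu]_(x in G) (al k + a k * coord (e k) x)%:E =
    (\sum_(k < N) al k)%:E)%E.
  rewrite -ge0_integral_sum//; last 2 first.
  - move=> k; apply/measurable_EFinP; apply: measurable_funD => //; apply: measurable_funM => //.
    by apply: measurable_funTS; exact: measurable_coord.
  - by move=> k x Gx; rewrite lee_fin A0//; exact: shadow_coord.
  transitivity (\int[mu]_(x in G) (cst (\sum_(k < N) al k)%:E x))%E.
    by apply: eq_integral => x _; rewrite sumEFin big_split/= a0 addr0.
  by rewrite intG.
pose PP k := (\int[mu]_x \int[mu]_y (poisson (2 * b) (coord (e k) x - coord (e k) y))%:E)%E.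
have gE (k : 'I_N) : (\int[leb]_s (g k s ^+ 2)%:E =
    \int[leb]_(s in A k) ((al k + a k * s) ^+ 2)%:E)%E.
  rewrite [RHS]integral_mkcond; apply: eq_integral => s _; rewrite patchE.
  rewrite /g /trunc_affine indicE; case: ifPn => sA.
    by rewrite mulr1.
  by rewrite mulr0 expr0n.
(* In each direction, duality for the kernel [poisson (2 * b)]. *)
have h3 (k : 'I_N) : ((2%:E * \int[mu]_(x in G) (al k + a k * coord (e k) x)%:E) <=
    PP k + \int[leb]_(s in A k) ((al k + a k * s) ^+ 2)%:E +
    2%:E * (err%:E + M%:E * mu (G `\` core r G)))%E.
  apply: (@le_trans _ _ (2%:E * \int[mu]_x inner k x +
      2%:E * (err%:E + M%:E * mu (G `\` core r G)))%E); last first.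
    apply: leeD2r; rewrite -gE.
    by apply: (poisson_energy_ge mu b0 (measurable_coord (e k)) (mg k)) => s; exact: g0.
  rewrite -muleDr//; first by rewrite addeA lee_wpmul2l// h2.
  rewrite ge0_adde_def// inE; first by apply: integral_ge0 => x _; exact: inner0.
  by rewrite adde_ge0// ?lee_fin// mule_ge0// lee_fin.
(* The average of the kernels is at most the Riesz kernel, up to a small constant. *)
have kernel_ge x y : ((pi / N%:R * \sum_(k < N) poisson (2 * b) (coord (e k) x - coord (e k) y))%:E
    <= riesz_kernel x y + ((2 * b * N%:R)^-1)%:E)%E.
  rewrite /riesz_kernel inver; case: eqP => [_|/eqP d0]; first by rewrite addye ?leey.
  rewrite -EFinD lee_fin.
  have b20 : 0 < 2 * b by rewrite mulr_gt0.
  have h : pi / N%:R * \sum_(k < N) poisson (2 * b) (coord (e k) (x - y)) -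
      (Num.sqrt ((2 * b) ^+ 2 + nrm (x - y) ^+ 2))^-1 <= (2 * b * N%:R)^-1.
    by have := poisson_average_coord (x - y) b20 NE; rewrite ler_norml => /andP[].
  under eq_bigr do rewrite -coordB.
  have d1 : 0 < eucl_dist x y by rewrite lt_neqAle eq_sym d0 eucl_dist_ge0.
  have : (Num.sqrt ((2 * b) ^+ 2 + nrm (x - y) ^+ 2))^-1 <= (eucl_dist x y)^-1.
    rewrite lef_pV2 ?posrE//; last first.
      by rewrite sqrtr_gt0 ltr_wpDr ?sqr_ge0// exprn_gt0.
    rewrite eucl_distE -[leLHS]ger0_norm ?nrm_ge0// -sqrtr_sqr ler_wsqrtr//.
    by rewrite lerDr sqr_ge0.
  by move: h; clear; lra.
have mP k : measurable_fun [set: (R * R) * (R * R)]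
    (fun z : (R * R) * (R * R) => (poisson (2 * b) (coord (e k) z.1 - coord (e k) z.2))%:E).
  apply/measurable_EFinP; apply: measurableT_comp.
    by apply: continuous_measurable_fun; apply: continuous_poisson; rewrite mulr_gt0.
  apply: measurable_funB.
    exact: (measurableT_comp (measurable_coord (e k)) measurable_fst).
  exact: (measurableT_comp (measurable_coord (e k)) measurable_snd).
have P0 k x y : (0 <= (poisson (2 * b) (coord (e k) x - coord (e k) y))%:E)%E.
  by rewrite lee_fin poisson_ge0// mulr_gt0.
have mPx k x : measurable_fun [set: R * R]
    (fun y => (poisson (2 * b) (coord (e k) x - coord (e k) y))%:E).
  exact: (measurableT_comp (mP k) (pair1_measurable x)).
have mPP k : measurable_fun [set: R * R]
    (fun x => \int[mu]_y (poisson (2 * b) (coord (e k) x - coord (e k) y))%:E)%E.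
  by apply: (@measurable_fun_fubini_tonelli_F _ _ _ _ R mu
    (fun z : (R * R) * (R * R) => (poisson (2 * b) (coord (e k) z.1 - coord (e k) z.2))%:E))
    => // z; exact: P0.
have h5 : ((pi / N%:R)%:E * \sum_(k < N) PP k <=
    \int[mu]_x \int[mu]_y riesz_kernel x y + ((2 * b * N%:R)^-1)%:E)%E.
  have -> : ((pi / N%:R)%:E * \sum_(k < N) PP k = \int[mu]_x \int[mu]_y
      (pi / N%:R * \sum_(k < N) poisson (2 * b) (coord (e k) x - coord (e k) y))%:E)%E.
    rewrite /PP -ge0_integral_sum//; last first.
      by move=> k x _; apply: integral_ge0 => y _; exact: P0.
    rewrite -ge0_integralZl_EFin//; last 2 first.
    - by move=> x _; apply: sume_ge0 => k _; apply: integral_ge0 => y _; exact: P0.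
    - exact: emeasurable_sum.
    apply: eq_integral => x _; rewrite -ge0_integral_sum//.
    rewrite -ge0_integralZl_EFin//; last 2 first.
    - by move=> y _; apply: sume_ge0 => k _; exact: P0.
    - exact: emeasurable_sum.
    by apply: eq_integral => y _; rewrite sumEFin -EFinM.
  have mk := measurable_riesz_kernel.
  have mkx x : measurable_fun [set: R * R] (riesz_kernel x).
    exact: (measurableT_comp mk (pair1_measurable x)).
  have k0 x y : (0 <= riesz_kernel x y)%E.
    rewrite /riesz_kernel inver; case: ifP => // _.
    by rewrite lee_fin invr_ge0 eucl_dist_ge0.
  have mkk : measurable_fun [set: R * R] (fun x => \int[mu]_y riesz_kernel x y)%E.
    by apply: (@measurable_fun_fubini_tonelli_F _ _ _ _ R mu
      (fun z : (R * R) * (R * R) => riesz_kernel z.1 z.2)) => // z; exact: k0.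
  have c0 : 0 <= (2 * b * N%:R)^-1 by rewrite invr_ge0 !mulr_ge0 ?(ltW b0)// ltW.
  have int1 (v : R) : (\int[mu]_x cst v%:E x)%E = v%:E.
    rewrite integral_cst//; set m := (X in (_ * X)%E).
    by rewrite (_ : m = 1%E) ?mule1//; exact: probability_setT.
  have S0 x y : (0 <= (pi / N%:R *
      \sum_(k < N) poisson (2 * b) (coord (e k) x - coord (e k) y))%:E)%E.
    by rewrite lee_fin mulr_ge0// sumr_ge0// => k _; rewrite poisson_ge0// mulr_gt0.
  have mS : measurable_fun [set: (R * R) * (R * R)] (fun z : (R * R) * (R * R) => (pi / N%:R *
      \sum_(k < N) poisson (2 * b) (coord (e k) z.1 - coord (e k) z.2))%:E).
    apply/measurable_EFinP; apply: measurable_funM => //.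
    by apply: measurable_sum => k; apply/measurable_EFinP; exact: mP.
  rewrite -[X in (_ + X)%E]int1 -ge0_integralD//; last by move=> x _; apply: integral_ge0.
  apply: ge0_le_integral => //.
  - by move=> x _; apply: integral_ge0.
  - by apply: (@measurable_fun_fubini_tonelli_F _ _ _ _ R mu (fun z : (R * R) * (R * R) => (pi / N%:R *
      \sum_(k < N) poisson (2 * b) (coord (e k) z.1 - coord (e k) z.2))%:E)) => // z; exact: S0.
  - exact: emeasurable_funD.
  move=> x _; rewrite /= -[X in (_ + X)%E]int1 -ge0_integralD//.
  apply: ge0_le_integral => //.
  - exact: (measurableT_comp mS (pair1_measurable x)).
  - exact: emeasurable_funD.
set E := (\int[mu]_x \int[mu]_y riesz_kernel x y)%E in h5 *.
set Q := (\sum_(k < N) \int[leb]_(s in shadow (e k) G) ((al k + a k * s) ^+ 2)%:E)%E.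
set er := (err%:E + M%:E * mu (G `\` core r G))%E in h3 *.
have er0 : (0 <= er)%E by rewrite adde_ge0 ?lee_fin// mule_ge0// lee_fin.
have PP0 k : (0 <= PP k)%E.
  by apply: integral_ge0 => x _; apply: integral_ge0 => y _; exact: P0.
have Q0 (k : 'I_N) : (0 <= \int[leb]_(s in A k) ((al k + a k * s) ^+ 2)%:E)%E.
  by apply: integral_ge0 => s _; rewrite lee_fin sqr_ge0.
have h6 : ((\sum_(k < N) (2 * al k))%:E <= \sum_(k < N) PP k + Q + N%:R%:E * (2%:E * er))%E.
  rewrite -mulr_sumr EFinM -sumal ge0_sume_distrr; last first.
    move=> k _; apply: integral_ge0 => x Gx; rewrite lee_fin A0//; exact: shadow_coord.
  apply: le_trans (lee_sum _ (fun k _ => h3 k)) _.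
  rewrite big_split/= big_split/= leeD2l// big_const_ord.
  have itE (v : \bar R) (m : nat) : (0 <= v)%E -> iter m (+%E v) 0%E = (m%:R%:E * v)%E.
    move=> v0; elim: m => [|m IH]; first by rewrite mul0e.
    by rewrite iterS IH -natr1 EFinD ge0_muleDl ?lee_fin// mul1e addeC.
  by rewrite le_eqVlt; apply/orP; left; apply/eqP; apply: itE; rewrite mule_ge0.
have Qge0 : (0 <= Q)%E by apply: sume_ge0 => k _; exact: Q0.
have SP0 : (0 <= \sum_(k < N) PP k)%E by apply: sume_ge0 => k _; exact: PP0.
have er2 : (0 <= N%:R%:E * (2%:E * er))%E by rewrite !mule_ge0// lee_fin// ltW.
rewrite EFinM; apply: le_trans (lee_wpmul2l _ h6) _; first by rewrite lee_fin.
rewrite ge0_muleDr ?adde_ge0// ge0_muleDr//.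
have -> : ((pi / N%:R)%:E * (N%:R%:E * (2%:E * er)) = (2 * pi)%:E * er)%E.
  by rewrite !muleA -!EFinM; congr (_%:E * _)%E; rewrite divfK ?gt_eqF// mulrC.
apply: leeD2r; rewrite [leRHS]addeAC; exact: leeD2r.
Qed.

Let atan_near (d : R) : 0 < d -> exists2 u : R, 0 < u & 1 - 2 / pi * atan u <= d.
Proof.
move=> d0; have pp := @pi_gt0 R.
have : \forall u \near +oo, `|pi / 2 - atan u| <= d * (pi / 2).
  move/cvgrPdist_le: (@cvgy_atan R); apply.
  by rewrite mulr_gt0// divr_gt0.
move=> h; have h' : \forall u \near +oo, 0 < u /\ `|pi / 2 - atan u| <= d * (pi / 2).
  near=> u; split; first by near: u; exact: nbhs_pinfty_gt.
  by near: u.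
have [u [u0]] := filter_ex h'.
move=> /ler_normlW h1; exists u => //.
have -> : 1 - 2 / pi * atan u = (pi / 2 - atan u) / (pi / 2).
  by move: (@pi R) pp => P P0; field; rewrite gt_eqF.
by rewrite ler_pdivrMr// divr_gt0.
Unshelve. all: by end_near. Qed.

Let core_null (mu : probability (R * R)%type R) G (L d : R) : open G -> 0 <= L -> 0 < d ->
  exists r : R, [/\ 0 < r, L * r <= d & (mu (G `\` core r G) <= d%:E)%E].
Proof.
move=> oG L0 d0; pose F (m : nat) := G `\` core m.+1%:R^-1 G.
have mF m : measurable (F m).
  apply: measurableD; apply: open_measurable_plane => //; exact: open_core.
have F0 : \bigcap_m F m = set0.
  apply/seteqP; split => // x Fx.
  have [Gx _] := Fx 0%N I.
  have [b b0 bG] := (open_euclP _).1 oG x Gx.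
  have [_] := Fx (Num.truncn b^-1) I; apply; exists b => //.
  by rewrite invf_plt ?posrE ?ltr0Sn//; exact: truncnS_gt.
have cv : mu (F n) @[n --> \oo] --> 0%E.
  rewrite -(measure0 mu) -F0; apply: nonincreasing_cvg_mu => //.
  - apply: (@le_lt_trans _ _ 1%E); last exact: ltry.
    exact: probability_le1.
  - by rewrite F0.
  - move=> n m nm; apply/subsetPset => x [Gx nC]; split => // -[b nb bG]; apply: nC.
    exists b => //; apply: le_lt_trans nb.
    by rewrite lef_pV2 ?posrE ?ltr0Sn// ler_nat ltnS.
have mufin m : mu (F m) \is a fin_num by apply: fin_num_measure.
move/fine_cvgP: cv => [_ /cvgr0Pnorm_le/(_ d d0) near1].
have near2 : \forall n \near \oo, L * n.+1%:R^-1 <= d.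
  near=> n; rewrite ler_pdivrMr ?ltr0Sn// mulrC -ler_pdivrMr//.
  apply: ltW; apply: (@lt_trans _ _ n%:R); last by rewrite ltr_nat.
  by near: n; exact: nbhs_infty_gtr.
have [n [h1 h2]] := filter_ex (filterI near1 near2).
exists n.+1%:R^-1; split => //.
by rewrite -[mu _](fineK (mufin n)) lee_fin; apply: le_trans (ler_norm _) h1.
Unshelve. all: by end_near. Qed.

(** The energy of a measure carried by the open set [G] is bounded below through
    the projections of [G]. Any affine functions that are nonnegative on the
    shadows and whose slopes cancel can be used as competitors. *)
Lemma energy_ge (mu : probability (R * R)%type R) G (L M eta : R) :
  open G -> mu G = 1%E -> 0 <= L -> 0 < eta ->
  exists n0 : nat, forall (n N : nat) (al a : nat -> R), (n0 <= n)%N -> N = (2 ^ n)%N ->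
  let e k := dir (k%:R * (pi / N%:R)) : R * R in
  (forall k : 'I_N, `|a k| <= L) ->
  (forall (k : 'I_N) s, shadow (e k) G s -> 0 <= al k + a k * s <= M) ->
  (forall x, \sum_(k < N) a k * coord (e k) x = 0) ->
  ((pi / N%:R * \sum_(k < N) (2 * al k))%:E <=
   \int[mu]_x \int[mu]_y riesz_kernel x y +
   (pi / N%:R)%:E * \sum_(k < N) \int[leb]_(s in shadow (e k) G) ((al k + a k * s) ^+ 2)%:E
   + eta%:E)%E.
Proof.
move=> oG muG L0 eta0; have pp := @pi_gt0 R.
have M'0 : 0 <= `|M| by [].
(* First [r] is chosen, so that [G] has little mass near its boundary; then [b], small
   compared to [r]; then [N], large compared to the inverse of [b]. *)
pose d := eta / (4 * pi * (1 + 2 * `|M|)).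
have d0 : 0 < d by rewrite divr_gt0// !mulr_gt0// ltr_pwDl// mulr_ge0.
have [r [r0 Lr muC]] := core_null mu oG L0 d0.
have [u u0 ud] := atan_near d0.
pose b := r / u; have b0 : 0 < b by rewrite divr_gt0.
have ub : r / b = u by rewrite /b invf_div mulrCA divff ?mulr1// gt_eqF.
exists (Num.truncn (b * eta)^-1).+1 => n N al a n0 NE e aL AM a0.
have N0 : 0 < N%:R :> R by rewrite NE ltr0n expn_gt0.
have h := energy_ge_err oG muG NE b0 r0 aL AM a0.
apply: le_trans h _; rewrite -[leLHS]addeA; apply: leeD2l.
have Nb : (2 * b * N%:R)^-1 <= eta / 2.
  have h1 : (b * eta)^-1 <= N%:R.
    apply: (@le_trans _ _ n%:R).
      apply: ltW; apply: lt_le_trans (truncnS_gt _) _.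
      by rewrite ler_nat.
    by rewrite ler_nat NE ltnW// ltn_expl.
  have -> : (2 * b * N%:R)^-1 = (b * eta)^-1 / N%:R * (eta / 2).
    by field; rewrite !gt_eqF.
  by rewrite -[leRHS]mul1r ler_wpM2r ?divr_ge0 ?(ltW eta0)// ler_pdivrMr// mul1r.
have M0 : 0 <= M.
  have G0 : G !=set0.
    by apply/set0P/eqP => G0; move: muG; rewrite G0 measure0 => /eqP; rewrite eqe eq_sym oner_eq0.
  case: G0 => x Gx; have NN : (0 < N)%N by rewrite NE expn_gt0.
  have /andP[h1 h2] := AM (Ordinal NN) _ (shadow_coord (dir1 _) Gx).
  exact: le_trans h2.
have er : ((L * r + (1 - 2 / pi * atan (r / b)) * M)%:E + M%:E * mu (G `\` core r G) <=
    (d * (1 + 2 * M))%:E)%E.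
  apply: (@le_trans _ _ ((d + d * M)%:E + M%:E * d%:E)%E).
    apply: leeD; first by rewrite lee_fin lerD// ub ler_wpM2r.
    by rewrite lee_wpmul2l.
  by rewrite -EFinM -EFinD lee_fin; lra.
apply: (@le_trans _ _ ((eta / 2)%:E + (2 * pi)%:E * (d * (1 + 2 * M))%:E)%E).
  apply: leeD; first by rewrite lee_fin.
  by rewrite lee_wpmul2l// lee_fin mulr_ge0// ltW.
rewrite -EFinM -EFinD lee_fin /d ger0_norm//.
rewrite (_ : 2 * pi * _ = eta / 2); first lra.
have M1 : 1 + 2 * M != 0 by rewrite gt_eqF// ltr_pwDl// mulr_ge0.
by move: (@pi R) pp => P P0; field; rewrite M1 gt_eqF.
Qed.
End energy_lower_bound.

(** * Measures of finite energy and sets of finite length *)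

Section boundary_null.
Context {R : realType}.
Variable mu : probability (R * R)%type R.
Local Notation P := (mu \x mu)%E.

Lemma riesz_kernel_ge0 (x y : R * R) : (0 <= riesz_kernel x y)%E.
Proof.
rewrite /riesz_kernel inver; case: ifP => // _.
by rewrite lee_fin invr_ge0 eucl_dist_ge0.
Qed.

Lemma measurable_eucl_dist :
  measurable_fun [set: (R * R) * (R * R)] (fun z : (R * R) * (R * R) => eucl_dist z.1 z.2).
Proof.
have ms : measurable_fun [set: R] (Num.sqrt : R -> R).
  by apply: continuous_measurable_fun; exact: sqrt_continuous.
apply: (measurableT_comp ms); apply: measurable_funD; apply: measurable_funX;
  apply: measurable_funB.
- exact: (measurableT_comp measurable_fst measurable_fst).
- exact: (measurableT_comp measurable_fst measurable_snd).
- exact: (measurableT_comp measurable_snd measurable_fst).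
- exact: (measurableT_comp measurable_snd measurable_snd).
Qed.

Let k (z : (R * R) * (R * R)) := riesz_kernel z.1 z.2.
Let S (delta : R) : set ((R * R) * (R * R)) := [set z | eucl_dist z.1 z.2 <= delta].
Let f (delta : R) z : \bar R := (k z * (\1_(S delta) z)%:E)%E.

Let k0 z : (0 <= k z)%E. Proof. exact: riesz_kernel_ge0. Qed.

Let mk : measurable_fun setT k. Proof. exact: measurable_riesz_kernel. Qed.

Let mS delta : measurable (S delta).
Proof.
rewrite -[S delta]setTI.
have -> : S delta = (fun z : (R * R) * (R * R) => eucl_dist z.1 z.2) @^-1` `]-oo, delta].
  by apply/seteqP; split=> z /=; rewrite in_itv.
exact: measurable_eucl_dist.
Qed.

Let mf delta : measurable_fun setT (f delta).
Proof.
apply: emeasurable_funM; first exact: mk.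
by apply/measurable_EFinP; exact: measurable_indic.
Qed.

Let f0 delta z : (0 <= f delta z)%E.
Proof. by rewrite mule_ge0// lee_fin. Qed.

Let f_le delta z : (f delta z <= k z)%E.
Proof.
rewrite /f indicE; case: (_ \in _); rewrite ?mule1//.
by rewrite mule0.
Qed.

Hypothesis energy_fin : (\int[mu]_x \int[mu]_y riesz_kernel x y < +oo)%E.

Let kP : (\int[P]_z k z < +oo)%E.
Proof. by rewrite fubini_tonelli1. Qed.

Let D : set ((R * R) * (R * R)) := ~` S 0.

Let mD : measurable D. Proof. by apply: measurableC. Qed.

Let diag_null : P (S 0) = 0%E.
Proof.
apply/eqP/negPn/negP => h.
have : (+oo * P (S 0) <= \int[P]_z k z)%E.
  rewrite -integral_cst//; apply: (@le_trans _ _ (\int[P]_(z in S 0) k z)%E).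
    apply: ge0_le_integral => //.
    - by move=> z _; rewrite leey.
    - exact: measurable_funTS.
    - move=> z /= z0; rewrite /k /riesz_kernel inver.
      by rewrite eq_le z0 eucl_dist_ge0.
  exact: ge0_subset_integral.
rewrite gt0_mulye; last by rewrite lt_neqAle eq_sym h measure_ge0.
by rewrite leye_eq => /eqP e; move: kP; rewrite e.
Qed.

(** The kernel is infinite on the diagonal, which is thus a null set of the product
    measure; the rest is dominated convergence. *)
Let near_diagonal (eps : R) : 0 < eps ->
  exists2 d0 : R, 0 < d0 & (\int[P]_z f d0 z <= eps%:E)%E.
Proof.
move=> eps0.
have cv : (\int[P]_(z in D) f n.+1%:R^-1 z)%E @[n --> \oo] --> 0%E.
  rewrite -(integral0 P D).
  apply: (@dominated_cvg _ _ _ P D mD (fun n => f n.+1%:R^-1) (cst 0%E) k).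
  - by move=> n; apply: measurable_funTS; exact: mf.
  - move=> z /negP; rewrite -ltNge => z0; apply: cvg_near_cst.
    near=> n; rewrite /f indicE memNset ?mule0// => /=; apply/negP; rewrite -ltNge.
    rewrite invf_plt ?posrE ?ltr0Sn//.
    apply: (@lt_trans _ _ n%:R); last by rewrite ltr_nat.
    by near: n; exact: nbhs_infty_gtr.
  - move=> z /negP; rewrite -ltNge => z0.
    by rewrite /k /riesz_kernel inver gt_eqF.
  - apply/integrableP; split; first exact: measurable_funTS.
    apply: le_lt_trans kP; under eq_integral do rewrite gee0_abs//.
    exact: ge0_subset_integral.
  - by move=> n z _; rewrite gee0_abs.
have bound n : (\int[P]_(z in D) f n.+1%:R^-1 z <= \int[P]_z k z)%E.
  apply: (@le_trans _ _ (\int[P]_z f n.+1%:R^-1 z)%E); first exact: ge0_subset_integral.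
  exact: ge0_le_integral.
have fin n : (\int[P]_(z in D) f n.+1%:R^-1 z)%E \is a fin_num.
  rewrite ge0_fin_numE; first exact: le_lt_trans kP.
  by apply: integral_ge0 => z _; exact: f0.
move/fine_cvgP: cv => [_ /cvgr0Pnorm_le/(_ eps eps0) near1].
have [n h1] := filter_ex near1.
exists n.+1%:R^-1 => //.
have e : setT = D `|` S 0 by rewrite /D setUC setUv.
rewrite e ge0_integral_setU//; last 2 first.
- by rewrite -e; exact: mf.
- by apply/disj_setPS; rewrite /D setICl.
rewrite (null_set_integral _ _ diag_null)//; last by apply: measurable_funTS; exact: mf.
rewrite adde0 -(fineK (fin n)) lee_fin.
exact: le_trans (ler_norm _) h1.
Unshelve. all: by end_near. Qed.

Variable E : set (R * R).
Hypotheses (mE : measurable E) (Efin : (hausdorff1 E < +oo)%E).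

(** A set of finite length is covered by pieces the sum of whose diameters is
    bounded; a piece of diameter [d] and mass [m] has a self-energy of at least
    [m ^+ 2 / d >= 2 * t * m - t ^+ 2 * d], so a positive mass on [E] would keep
    the energy near the diagonal away from 0. *)
Let mass_le (eps t : R) : 0 < eps -> 0 <= t ->
  ((2 * t)%:E * mu E <= eps%:E + (t ^+ 2)%:E * (2%:E * (hausdorff1 E + 2%:E)))%E.
Proof.
move=> eps0 t0; have [d0 d00 Jle] := near_diagonal eps0.
pose delta := Num.min 1 (d0 / 2).
have delta0 : 0 < delta by rewrite /delta lt_min ltr01 divr_gt0.
have delta1 : delta <= 1 by rewrite /delta ge_min lexx.
have delta2 : 2 * delta <= d0.
  have : delta <= d0 / 2 by rewrite /delta ge_min lexx orbT.
  by lra.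
have [C [p [d [EC [Cd Cp] dge0 dle sumd]]]] := hausdorff1_cover Efin delta0.
pose B n := E `&` eucl_closed_ball (p n) (d n).
have mB n : measurable (B n).
  apply: measurableI => //; apply: closed_measurable_plane.
  exact: closed_eucl_closed_ball.
have EB : E = \bigcup_n seqDU B n.
  rewrite -seqDU_bigcup_eq; apply/seteqP; split; last by move=> x [n _ []].
  move=> x Ex; have [n _ Cx] := EC x Ex; exists n => //; split => //.
  by rewrite /eucl_closed_ball /=; apply: Cd => //; exact: Cp Cx.
have mDU n : measurable (seqDU B n) by apply: measurableD => //; exact: bigsetU_measurable.
pose phi x := (\int[mu]_y f d0 (x, y))%E.
have phi0 x : (0 <= phi x)%E by apply: integral_ge0.
have mphi : measurable_fun setT phi.
  by apply: (@measurable_fun_fubini_tonelli_F _ _ _ _ R mu (f d0)).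
(* Diameters may vanish; the summable term makes the denominators positive. *)
pose d' n := 2 * d n + 1 / (2 ^ n.+1)%:R.
have d'0 n : 0 < d' n.
  rewrite /d' ltr_wpDl ?mulr_ge0// divr_gt0// ltr0n expn_gt0//.
have piece n : ((2 * t)%:E * mu (seqDU B n) <=
    \int[mu]_(x in seqDU B n) phi x + (t ^+ 2)%:E * (d' n)%:E)%E.
  set A := seqDU B n; have mAs : measurable A by exact: mDU.
  have AB x : A x -> eucl_dist (p n) x <= d n by move=> /(@subset_seqDU _ B n)[].
  pose m := fine (mu A).
  have mA : mu A = m%:E by rewrite fineK// fin_num_measure//; exact: mDU.
  have m0 : 0 <= m by rewrite -lee_fin -mA measure_ge0.
  have phige x : A x -> ((m / d' n)%:E <= phi x)%E.
    move=> Ax; apply: (@le_trans _ _ (\int[mu]_(y in A) cst (d' n)^-1%:E y)%E).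
      rewrite integral_cst//; set mm := (X in (_ * X)%E).
      by rewrite (_ : mm = m%:E) ?mA// -EFinM mulrC.
    apply: (@le_trans _ _ (\int[mu]_(y in A) f d0 (x, y))%E); last first.
      apply: ge0_subset_integral => //.
      exact: (measurableT_comp (mf d0) (pair1_measurable x)).
    apply: ge0_le_integral => //.
    - by move=> y _; rewrite lee_fin invr_ge0 ltW.
    - apply: measurable_funTS.
      exact: (measurableT_comp (mf d0) (pair1_measurable x)).
    move=> y Ay; have xy : eucl_dist x y <= 2 * d n.
      apply: le_trans (eucl_dist_triangle (p n) x y) _.
      have := AB _ Ax; have := AB _ Ay; rewrite (eucl_distC x); lra.
    rewrite /f indicE mem_set ?mule1; last first.
      by apply: le_trans xy _; apply: le_trans delta2; rewrite ler_wpM2l.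
    rewrite /k /riesz_kernel /= inver; case: eqP => [_|/eqP xy0]; first exact: leey.
    rewrite lee_fin lef_pV2 ?posrE//.
      by apply: le_trans xy _; rewrite /d' lerDl divr_ge0.
    by rewrite lt_neqAle eq_sym xy0 eucl_dist_ge0.
  apply: (@le_trans _ _ ((m / d' n)%:E * mu A + (t ^+ 2)%:E * (d' n)%:E)%E).
    rewrite mA -!EFinM -EFinD lee_fin -subr_ge0.
    have -> : m / d' n * m + t ^+ 2 * d' n - 2 * t * m = (m - t * d' n) ^+ 2 / d' n.
      by field; rewrite gt_eqF.
    by rewrite divr_ge0 ?sqr_ge0// ltW.
  apply: leeD2r; rewrite -integral_cst//; apply: ge0_le_integral => //.
  - by move=> x _; rewrite lee_fin divr_ge0// ltW.
  - exact: measurable_funTS.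
have sumd' : (\sum_(n <oo) (d' n)%:E <= 2%:E * (hausdorff1 E + 2%:E))%E.
  have -> : (\sum_(n <oo) (d' n)%:E = \sum_(n <oo) ((2 * d n)%:E + (1 / (2 ^ n.+1)%:R)%:E))%E.
    by apply: eq_eseriesr => n _; rewrite -EFinD.
  apply: le_trans (@epsilon_trick R (fun n => (2 * d n)%:E) 1 xpredT _ ler01) _.
    by move=> n; rewrite lee_fin mulr_ge0.
  have -> : (\sum_(n <oo) (2 * d n)%:E = 2%:E * \sum_(n <oo) (d n)%:E)%E.
    by rewrite -nneseriesZl//; last by move=> n _; rewrite lee_fin.
  apply: (@le_trans _ _ (2%:E * (hausdorff1 E + delta%:E) + 1)%E).
    by apply: leeD2r; rewrite lee_wpmul2l.
  rewrite !ge0_muleDr ?hausdorff1_ge0// ?lee_fin ?(ltW delta0)// -addeA leeD2l//.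
  by rewrite -!EFinM -EFinD lee_fin; lra.
have sumE : ((2 * t)%:E * mu E <= \sum_(n <oo) (\int[mu]_(x in seqDU B n) phi x) +
    (t ^+ 2)%:E * \sum_(n <oo) (d' n)%:E)%E.
  have t20 : 0 <= 2 * t by rewrite mulr_ge0.
  rewrite {1}EB measure_semi_bigcup//; last exact: bigcup_measurable.
  rewrite -nneseriesZl; last by move=> n _; exact: measure_ge0.
  rewrite -nneseriesZl; last by move=> n _; rewrite lee_fin ltW.
  rewrite -nneseriesD; last 2 first.
  - by move=> n _ _; apply: integral_ge0.
  - by move=> n _ _; rewrite mule_ge0// lee_fin ?sqr_ge0// ltW.
  by apply: lee_nneseries => n _; [rewrite mule_ge0// lee_fin|exact: piece].
apply: le_trans sumE _; apply: leeD; last by rewrite lee_wpmul2l// lee_fin sqr_ge0.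
rewrite -ge0_integral_bigcup//; last exact: measurable_funTS.
apply: le_trans Jle; rewrite fubini_tonelli1//.
by apply: ge0_subset_integral => //; exact: bigcup_measurable.
Qed.

(** Let [t] tend to 0 in [mass_le] with [eps := t ^+ 2]. *)
Lemma energy_null : mu E = 0%E.
Proof.
have Hfin : hausdorff1 E \is a fin_num by rewrite ge0_fin_numE ?hausdorff1_ge0.
have mfin : mu E \is a fin_num by apply: fin_num_measure.
set h := fine (hausdorff1 E); set m := fine (mu E).
have h0 : 0 <= h by rewrite fine_ge0// hausdorff1_ge0.
have m0 : 0 <= m by rewrite fine_ge0.
have key (t : R) : 0 < t -> 2 * t * m <= t ^+ 2 * (2 * (h + 2)) + t ^+ 2.
  move=> t0; have := mass_le (exprn_gt0 2 t0) (ltW t0).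
  rewrite -(fineK Hfin) -(fineK mfin).
  by move=> h1; rewrite -lee_fin addrC; exact: h1.
have m_le (t : R) : 0 < t -> 2 * m <= (2 * h + 5) * t.
  move=> t0; rewrite -(ler_pM2l t0); have := key t t0; lra.
rewrite -(fineK mfin) -/m; congr EFin; apply/eqP; rewrite eq_le m0 andbT.
rewrite leNgt; apply/negP => mp.
have c0 : 0 < 2 * h + 5 by lra.
have := m_le (m / (2 * h + 5)) (divr_gt0 mp c0); rewrite [leRHS]mulrC divfK ?gt_eqF//; lra.
Qed.
End boundary_null.

(** * The functional and the shadows of the interior *)

Section master_inequality.
Context {R : realType}.
Local Notation leb := (@leb R).

Let sin_ratio (d : R) : 0 < d -> exists2 x0 : R, 0 < x0 &
  forall x : R, 0 < x -> x <= x0 -> 0 < sin x -> x / sin x <= 1 + d.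
Proof.
move=> d0; have [g [gE cg g0]] := (is_derive1_caratheodory (@sin R) 0 (cos 0)).1 (is_derive_sin 0).
rewrite cos0 in g0.
have gd : (1 + d)^-1 < 1 by rewrite invf_lt1 ?ltrDl// addr_gt0.
have : \forall x \near 0, (1 + d)^-1 < g x.
  by move/cvgr_gt: cg; apply; rewrite g0.
move=> /nbhs_ballP[r /= r0 rg]; exists (r / 2); first by rewrite divr_gt0.
move=> x x0 xr sx.
have gx : (1 + d)^-1 < g x.
  by apply: rg; rewrite /ball /= sub0r normrN gtr0_norm//; lra.
have := gE x; rewrite sin0 !subr0 => sE.
rewrite ler_pdivrMr// sE mulrA -[leLHS]mul1r ler_wpM2r ?(ltW x0)//.
by rewrite -ler_pdivrMl ?addr_gt0// mulr1 ltW.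
Qed.

Definition dirs (N k : nat) : R * R := dir (k%:R * (pi / N%:R)).

(** For the [N] equidistributed lines the constant [kap] of [sum_shadows_le] is
    [(sin (pi / (2 * N)))^-1], and [pi / (2 * N)] divided by its sine tends to 1: this is
    a discrete form of the Cauchy-Crofton formula. *)
Lemma perimeter_ge (A F : set (R * R)) (D eta : R) :
  let G := interior A in
  (forall x, G x -> nrm x <= D) -> (hausdorff1 (boundary A) < +oo)%E ->
  open F -> G `&` F = set0 -> 0 <= D -> 0 < eta ->
  exists n0 : nat, forall n N : nat, (n0 <= n)%N -> N = (2 ^ n)%N ->
  ((pi / N%:R)%:E * \sum_(k < N) (leb (shadow (dirs N k) G) + leb (notch (dirs N k) G F))
   <= hausdorff1 (boundary A) + eta%:E)%E.
Proof.
move=> G GD Hoo oF GF D0 eta0; have pp := @pi_gt0 R.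
have Hfin : hausdorff1 (boundary A) \is a fin_num by rewrite ge0_fin_numE ?hausdorff1_ge0.
set H := fine (hausdorff1 (boundary A)).
have H0 : 0 <= H by rewrite fine_ge0// hausdorff1_ge0.
(* The error factor multiplies the perimeter [H], whence the denominator [H + 1]. *)
have [x0 x00 hx] := sin_ratio (divr_gt0 eta0 (ltr_wpDl H0 ltr01)).
exists (Num.truncn (pi / x0)).+1 => n N n0 NE.
have N0 : (0 < N)%N by rewrite NE expn_gt0.
have NR0 : 0 < N%:R :> R by rewrite ltr0n.
have N1 : 1 <= N%:R :> R by rewrite ler1n.
pose x : R := pi / (2 * N%:R).
have xp : 0 < x by rewrite divr_gt0// mulr_gt0.
have xx0 : x <= x0.
  have h : pi / x0 <= N%:R.
    apply: ltW; apply: lt_le_trans (truncnS_gt _) _.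
    by rewrite ler_nat (leq_trans n0)// NE ltnW// ltn_expl.
  rewrite /x ler_pdivrMr ?mulr_gt0//; move: h; rewrite ler_pdivrMr//.
  have : 0 <= x0 * N%:R by rewrite mulr_ge0// ltW.
  by rewrite mulrCA mulrC; lra.
have sx : 0 < sin x.
  apply: sin_gt0_pi; rewrite xp /=.
  rewrite /x ltr_pdivrMr ?mulr_gt0// -[ltLHS]mulr1 ltr_pM2l//.
  by rewrite (@lt_le_trans _ _ 2)// ?ltr1n// -[leLHS]mulr1 ler_pM2l.
have k0 : 0 <= (sin x)^-1 by rewrite invr_ge0 ltW.
have h := @sum_shadows_le _ A F N (dirs N) (sin x)^-1 D GD Hoo oF GF (fun k _ => dir1 _)
  (fun m => sum_dotp_dir_le m N0) k0 D0.
set X := (\sum_(k < N) _)%E in h *.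
have -> : ((pi / N%:R)%:E * X = x%:E * (2%:E * X))%E.
  by rewrite muleA -EFinM; congr (_%:E * _)%E; rewrite /x; move: (@pi R) => P; field; rewrite gt_eqF.
apply: le_trans (lee_wpmul2l _ h) _; first by rewrite lee_fin ltW.
rewrite muleA -EFinM -(fineK Hfin) -/H -EFinM -EFinD lee_fin.
have := hx x xp xx0 sx; set q := x / sin x => qle.
have H10 : 0 < H + 1 by lra.
apply: (@le_trans _ _ ((1 + eta / (H + 1)) * H)); first by rewrite ler_wpM2r.
rewrite mulrDl mul1r lerD2l mulrAC ler_pdivrMr// ler_wpM2l ?(ltW eta0)//; lra.
Qed.

Lemma closed_boundary (A : set (R * R)) : closed (boundary A).
Proof.
rewrite /boundary setDE; apply: closedI; first exact: closed_closure.
by apply: open_closedC; exact: open_interior.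
Qed.

Let full_mass (mu : probability (R * R)%type R) (Omega : set (R * R)) :
  compact Omega -> mu Omega = 1%E -> (hausdorff1 (boundary Omega) < +oo)%E ->
  (\int[mu]_x \int[mu]_y riesz_kernel x y < +oo)%E -> mu (interior Omega) = 1%E.
Proof.
move=> cO muO Hoo Joo.
have mB : measurable (boundary Omega) by apply: closed_measurable_plane; exact: closed_boundary.
have mG : measurable (interior Omega) by apply: open_measurable_plane; exact: open_interior.
have mO : measurable Omega by exact: compact_measurable_plane.
have B0 := energy_null Joo mB Hoo.
apply/eqP; rewrite eq_le probability_le1//= -muO.
apply: (@le_trans _ _ (mu (interior Omega `|` boundary Omega))).
  apply: le_measure; rewrite ?inE//; first exact: measurableU.
  move=> x Ox; have [|nG] := pselect (interior Omega x); first by left.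
  by right; split => //; exact: subset_closure.
apply: le_trans (measureU2 _ mG mB) _; rewrite -[leRHS]adde0; apply: leeD2l.
by rewrite le_eqVlt; apply/orP; left; apply/eqP; exact: B0.
Qed.

Lemma energy_restrict (mu : probability (R * R)%type R) (Omega : set (R * R)) :
  measurable Omega -> mu Omega = 1%E ->
  (\int[mu]_(x in Omega) \int[mu]_(y in Omega) riesz_kernel x y =
   \int[mu]_x \int[mu]_y riesz_kernel x y)%E.
Proof.
move=> mO muO.
have mC : mu (~` Omega) = 0%E by rewrite probability_setC// muO subee.
have rest (f : R * R -> \bar R) : measurable_fun [set: R * R] f -> (forall x, 0 <= f x)%E ->
    (\int[mu]_x f x = \int[mu]_(x in Omega) f x)%E.
  move=> mf f0; rewrite -[X in integral _ X](setUv Omega) ge0_integral_setU//; last 3 first.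
  - exact: measurableC.
  - by rewrite setUv.
  - by apply/disj_setPS; rewrite setICr.
  rewrite [X in (_ + X)%E](null_set_integral _ _ mC) ?adde0//; first exact: measurableC.
  exact: measurable_funTS.
have mk := @measurable_riesz_kernel R.
have mkx x : measurable_fun [set: R * R] (riesz_kernel x).
  exact: (measurableT_comp mk (pair1_measurable x)).
rewrite [RHS]rest.
- by apply: eq_integral => x _; rewrite -rest// => y; exact: riesz_kernel_ge0.
- by apply: (@measurable_fun_fubini_tonelli_F _ _ _ _ R mu
      (fun z : (R * R) * (R * R) => riesz_kernel z.1 z.2)) => // z; exact: riesz_kernel_ge0.
- by move=> x; apply: integral_ge0 => y _; exact: riesz_kernel_ge0.
Qed.

(** Otherwise the set equals its boundary, which measures of finite energy do not
    charge. *)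
Lemma interior_nonempty (Omega : set (R * R)) :
  admissible Omega -> (riesz_energy Omega < +oo)%E -> interior Omega !=set0.
Proof.
move=> [cO _ Hoo] /ereal_inf_lt[_ [mu /= muO <-]] Joo.
rewrite energy_restrict// in Joo; last exact: compact_measurable_plane.
have muG := full_mass cO muO Hoo Joo.
apply/set0P/eqP => G0; move: muG; rewrite G0 measure0 => /eqP.
by rewrite eqe eq_sym oner_eq0.
Qed.

(** Both terms of the functional are bounded below by averages over the same directions
    of quantities that depend on the shadows, so that they can be compared direction by
    direction. The energy bound applies to the interior, as measures of finite energy do
    not charge the boundary. *)
Lemma energyQ_ge (lambda : R) (Omega : set (R * R)) (L M eta : R) :
  let G := interior Omega in
  0 < lambda -> admissible Omega -> 0 <= L -> 0 < eta ->
  exists n0 : nat, forall (n N : nat) (al a : nat -> R), (n0 <= n)%N -> N = (2 ^ n)%N ->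
  (forall k : 'I_N, `|a k| <= L) ->
  (forall (k : 'I_N) s, shadow (dirs N k) G s -> 0 <= al k + a k * s <= M) ->
  (forall x, \sum_(k < N) a k * coord (dirs N k) x = 0) ->
  ((pi / N%:R)%:E * (\sum_(k < N) (leb (shadow (dirs N k) G) + leb (notch (dirs N k) G (~` Omega)))) +
   lambda%:E * (pi / N%:R * \sum_(k < N) (2 * al k))%:E <=
   energyQ lambda Omega + lambda%:E * ((pi / N%:R)%:E *
     \sum_(k < N) \int[leb]_(s in shadow (dirs N k) G) ((al k + a k * s) ^+ 2)%:E)
   + eta%:E)%E.
Proof.
move=> G l0 [cO _ Hoo] L0 eta0.
have cl : closed Omega by exact: compact_closed.
have GO : G `<=` Omega by exact: interior_subset.
have [D D0 OD] : exists2 D : R, 0 <= D & forall x, Omega x -> nrm x <= D.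
  by have [D D0 h] := compact_bounded_plane cO; exists D => //; exact: ltW.
have eta30 : 0 < eta / 3 by rewrite divr_gt0.
have disj : G `&` ~` Omega = set0 by apply/seteqP; split => // x [/GO].
have [n1 hP] := @perimeter_ge Omega (~` Omega) D (eta / 3) (fun x Gx => OD x (GO x Gx))
  Hoo (closed_openC cl) disj D0 eta30.
have H0 := hausdorff1_ge0 (boundary Omega).
have [Ioo|Ifin] := eqVneq (riesz_energy Omega) +oo%E.
  exists 0%N => n N al a _ _ _ _ _.
  rewrite /energyQ Ioo gt0_muley ?lte_fin// addey ?addye ?leey//.
  - rewrite -ltNye (@lt_le_trans _ _ 0%E)// mule_ge0 ?lee_fin ?(ltW l0)// mule_ge0//.
      by rewrite lee_fin divr_ge0 ?pi_ge0.
    by apply: sume_ge0 => k _; apply: integral_ge0 => s _; rewrite lee_fin sqr_ge0.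
  - by rewrite -ltNye (lt_le_trans _ H0).
have I0 : (0 <= riesz_energy Omega)%E.
  apply: le_ereal_inf_tmp => _ [mu _ <-]; apply: integral_ge0 => x _.
  by apply: integral_ge0 => y _; exact: riesz_kernel_ge0.
have If : riesz_energy Omega \is a fin_num by rewrite ge0_fin_numE// ltey.
pose eta' := eta / (3 * lambda).
have eta'0 : 0 < eta' by rewrite divr_gt0// mulr_gt0.
have [_ [mu /= muO <-] Jle] := @lb_ereal_inf_adherent R _ eta' eta'0 If.
have mO : measurable Omega by exact: compact_measurable_plane.
rewrite -/(riesz_energy Omega) energy_restrict// in Jle.
set J := (\int[mu]_x \int[mu]_y riesz_kernel x y)%E in Jle.
have Joo : (J < +oo)%E.
  by apply: lt_trans Jle _; rewrite lte_add_pinfty ?ltry// ltey.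
have muG : mu G = 1%E by exact: full_mass.
have [n2 hI] := energy_ge M (open_interior _) muG L0 eta'0.
exists (maxn n1 n2) => n N al a; rewrite geq_max => /andP[n1n n2n] NE aL AM a0.
have {hP}P := hP n N n1n NE.
have {hI}K := hI n N al a n2n NE aL AM a0.
set X := (\sum_(k < N) (leb _ + leb _))%E in P *.
set Q := (\sum_(k < N) \int[leb]_(s in _) _)%E in K *.
have Q0 : (0 <= Q)%E.
  by apply: sume_ge0 => k _; apply: integral_ge0 => s _; rewrite lee_fin sqr_ge0.
have c0 : 0 <= pi / N%:R :> R by rewrite divr_ge0 ?pi_ge0.
have K2 : (lambda%:E * (pi / N%:R * \sum_(k < N) (2 * al k))%:E <=
    lambda%:E * riesz_energy Omega + lambda%:E * ((pi / N%:R)%:E * Q) + (2 * (eta / 3))%:E)%E.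
  apply: (@le_trans _ _ (lambda%:E * (riesz_energy Omega + eta'%:E +
      (pi / N%:R)%:E * Q + eta'%:E))%E).
    rewrite lee_wpmul2l ?lee_fin ?(ltW l0)//; apply: le_trans K _.
    by apply: leeD2r; apply: leeD2r; exact: ltW.
  have e0 : (0 <= eta'%:E)%E by rewrite lee_fin ltW.
  have cQ : (0 <= (pi / N%:R)%:E * Q)%E by rewrite mule_ge0// lee_fin.
  rewrite !ge0_muleDr ?adde_ge0//.
  have -> : (lambda%:E * eta'%:E = (eta / 3)%:E)%E.
    by rewrite -EFinM /eta'; congr EFin; field; rewrite gt_eqF.
  rewrite (addeAC (lambda%:E * _)%E) -[leLHS]addeA.
  by apply: leeD2l; rewrite -EFinD lee_fin; lra.
apply: le_trans (leeD P K2) _.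
rewrite /energyQ.
set H := hausdorff1 _; set I := (lambda%:E * riesz_energy _)%E.
set S := (lambda%:E * (_ * Q))%E.
rewrite addeACA -!addeA; apply: leeD2l; apply: leeD2l; apply: leeD2l.
by rewrite -EFinD lee_fin; lra.
Qed.
End master_inequality.

(** * The lower bound for the functional *)

Section averages.
Context {R : realType}.

Let average_arc (p j n N : nat) (f : R -> R) (c : R) :
  (j < 2 ^ p)%N -> (p <= n)%N -> N = (2 ^ n)%N -> 0 <= c ->
  (forall k, 0 <= f (k%:R * (pi / N%:R))) ->
  (forall t, j%:R * (pi / (2 ^ p)%:R) <= t -> t < j.+1%:R * (pi / (2 ^ p)%:R) -> c <= f t) ->
  pi / (2 ^ p)%:R * c <= pi / N%:R * \sum_(k < N) f (k%:R * (pi / N%:R)).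
Proof.
move=> jp pn NE c0 f0 fc; have pp := @pi_gt0 R.
pose M := (2 ^ (n - p))%N.
have NM : N = (2 ^ p * M)%N by rewrite NE /M -expnD subnKC.
have P0 : 0 < (2 ^ p)%:R :> R by rewrite ltr0n expn_gt0.
have M0 : 0 < M%:R :> R by rewrite ltr0n expn_gt0.
have NR : N%:R = (2 ^ p)%:R * M%:R :> R by rewrite NM natrM.
have le1 : (j * M <= j.+1 * M)%N by rewrite leq_mul2r leqnSn orbT.
have le2 : (j.+1 * M <= N)%N by rewrite NM leq_mul2r jp orbT.
have low : M%:R * c <= \sum_(k < N) f (k%:R * (pi / N%:R)).
  rewrite -(big_mkord xpredT (fun k => f (k%:R * (pi / N%:R)))).
  rewrite (big_cat_nat _ (n := j * M))//=; last exact: leq_trans le2.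
  rewrite [X in _ + X](big_cat_nat _ (n := j.+1 * M))//= addrCA.
  apply: (@le_trans _ _ (\sum_(j * M <= k < j.+1 * M) f (k%:R * (pi / N%:R)))); last first.
    by rewrite lerDl addr_ge0// sumr_ge0.
  have -> : M%:R * c = \sum_(j * M <= k < j.+1 * M) c.
    by rewrite sumr_const_nat mulSn addnK mulr_natl.
  apply: ler_sum_nat => k /andP[k1 k2]; apply: fc.
    have -> : j%:R * (pi / (2 ^ p)%:R) = (j * M)%:R * (pi / N%:R) :> R.
      by rewrite NR natrM; move: (@pi R) => P; field; rewrite !gt_eqF.
    by rewrite ler_wpM2r ?ler_nat// divr_ge0 ?(ltW pp).
  have -> : j.+1%:R * (pi / (2 ^ p)%:R) = (j.+1 * M)%:R * (pi / N%:R) :> R.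
    by rewrite NR natrM; move: (@pi R) => P; field; rewrite !gt_eqF.
  by rewrite ltr_pM2r ?ltr_nat// divr_gt0// NR mulr_gt0.
have -> : pi / (2 ^ p)%:R * c = pi / N%:R * (M%:R * c).
  by rewrite NR; move: (@pi R) => P; field; rewrite !gt_eqF.
by rewrite ler_wpM2l// divr_ge0 ?(ltW pp)// NR mulr_ge0// ltW.
Qed.

(** The grid points near [t0] are at least a fixed fraction of all the points of any fine
    grid. *)
Lemma average_near (t0 w : R) : 0 <= t0 < pi -> 0 < w ->
  exists2 kap : R, 0 < kap & exists n0 : nat, forall (n N : nat) (f : R -> R) (c : R),
    (n0 <= n)%N -> N = (2 ^ n)%N -> 0 <= c ->
    (forall k, 0 <= f (k%:R * (pi / N%:R))) -> (forall t, `|t - t0| <= w -> c <= f t) ->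
    kap * c <= pi / N%:R * \sum_(k < N) f (k%:R * (pi / N%:R)).
Proof.
move=> /andP[t00 t0pi] w0; have pp := @pi_gt0 R.
pose p := (Num.truncn (pi / w)).+1.
have P0 : 0 < (2 ^ p)%:R :> R by rewrite ltr0n expn_gt0.
have pw : pi / (2 ^ p)%:R <= w.
  have h : pi / w <= (2 ^ p)%:R.
    apply: ltW; apply: lt_le_trans (truncnS_gt _) _.
    by rewrite ler_nat ltnW// ltn_expl.
  by rewrite ler_pdivrMr// mulrC -ler_pdivrMr.
have h0 : 0 < pi / (2 ^ p)%:R :> R by rewrite divr_gt0.
pose j := Num.truncn (t0 / (pi / (2 ^ p)%:R)).
have u0 : 0 <= t0 / (pi / (2 ^ p)%:R) by rewrite divr_ge0 // ltW.
have j1 : j%:R * (pi / (2 ^ p)%:R) <= t0.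
  by rewrite -ler_pdivlMr// truncn_le.
have j2 : t0 < j.+1%:R * (pi / (2 ^ p)%:R).
  by rewrite -ltr_pdivrMr//; exact: truncnS_gt.
have jp : (j < 2 ^ p)%N.
  rewrite -(ltr_nat R); apply: (@le_lt_trans _ _ (t0 / (pi / (2 ^ p)%:R))).
    by rewrite truncn_le.
  rewrite ltr_pdivrMr// mulrC divfK ?gt_eqF//.
exists (pi / (2 ^ p)%:R) => //; exists p => n N f c pn NE c0 f0 fc.
apply: (average_arc jp pn NE c0 f0) => t t1 t2; apply: fc.
have e : j.+1%:R * (pi / (2 ^ p)%:R) = j%:R * (pi / (2 ^ p)%:R) + pi / (2 ^ p)%:R :> R.
  by rewrite -natr1 mulrDl mul1r.
by rewrite ler_norml; apply/andP; split; lra.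
Qed.
End averages.

Section lower_bound.
Context {R : realType}.
Local Notation leb := (@leb R).

Definition width (G : set (R * R)) (t : R) : R := fine (leb (shadow (dir t) G)).

Section widths.
Variables (G F : set (R * R)) (D : R).
Hypotheses (oG : open G) (oF : open F) (D0 : 0 <= D) (GD : forall x, G x -> nrm x <= D).

Lemma widthE t : leb (shadow (dir t) G) = (width G t)%:E.
Proof.
rewrite /width fineK// ge0_fin_numE//.
exact: (shadow_lty (dir1 t) oG D0 GD).
Qed.

Lemma width_ge0 t : 0 <= width G t.
Proof. by rewrite /width fine_ge0. Qed.

Lemma width_le t : width G t <= 2 * D.
Proof.
rewrite -lee_fin -widthE; apply: (@le_trans _ _ (leb `[- D, D]%classic)).
  apply: le_measure; rewrite ?inE//.
    by apply: open_measurable; apply: open_shadow => //; exact: dir1.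
  move=> s [u Gu]; rewrite /= in_itv /= -ler_norml.
  rewrite -(coord_line s u (dir1 t)).
  exact: le_trans (coord_le _ (dir1 t)) (GD Gu).
by rewrite leb_itv ?lee_fin; move: D0; lra.
Qed.

Lemma width_ge x0 r t : 0 < r -> (forall y, eucl_dist x0 y < r -> G y) -> r <= width G t.
Proof.
move=> r0 rG; rewrite -lee_fin -widthE.
apply: (@le_trans _ _ (leb `[coord (dir t) x0 - r / 2, coord (dir t) x0 + r / 2]%classic)).
  by rewrite leb_itv ?lee_fin; lra.
apply: le_measure; rewrite ?inE//.
  by apply: open_measurable; apply: open_shadow => //; exact: dir1.
move=> s /=; rewrite in_itv /= => /andP[s1 s2]; exists (dotp x0 (dir t)); apply: rG.
rewrite -{1}(line_coord x0 (dir1 t)) eucl_dist_line ?dir1// ltr_norml.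
by apply/andP; split; lra.
Qed.

Lemma notchE t : leb (notch (dir t) G F) = (fine (leb (notch (dir t) G F)))%:E.
Proof.
rewrite fineK// ge0_fin_numE//; apply: le_lt_trans (shadow_lty (dir1 t) oG D0 GD).
apply: le_measure; rewrite ?inE; last exact: notch_shadow.
  by apply: open_measurable; apply: open_notch => //; exact: dir1.
by apply: open_measurable; apply: open_shadow => //; exact: dir1.
Qed.
End widths.

(** Real-valued form of [energyQ_ge], with upper bounds [q k] instead of the quadratic
    terms themselves. *)
Lemma energyQ_ge_real (lambda E : R) (Omega : set (R * R)) (L M eta : R) :
  let G := interior Omega in
  0 < lambda -> admissible Omega -> (energyQ lambda Omega <= E%:E)%E -> 0 <= L -> 0 < eta ->
  exists n0 : nat, forall (n N : nat) (al a q : nat -> R), (n0 <= n)%N -> N = (2 ^ n)%N ->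
  (forall k : 'I_N, `|a k| <= L) ->
  (forall (k : 'I_N) s, shadow (dirs N k) G s -> 0 <= al k + a k * s <= M) ->
  (forall x, \sum_(k < N) a k * coord (dirs N k) x = 0) ->
  (forall k : 'I_N, \int[leb]_(s in shadow (dirs N k) G) ((al k + a k * s) ^+ 2)%:E <=
    (q k)%:E)%E ->
  pi / N%:R * \sum_(k < N) (width G (k%:R * (pi / N%:R)) +
    fine (leb (notch (dirs N k) G (~` Omega))) + lambda * (2 * al k - q k)) <= E + eta.
Proof.
move=> G l0 adm EE L0 eta0; have [cO _ _] := adm.
have [D D0 OD] := compact_bounded_plane cO.
have GD x : G x -> nrm x <= D by move=> /interior_subset/OD.
have cl : closed Omega by exact: compact_closed.
have oF := closed_openC cl.
have [n0 h] := energyQ_ge M l0 adm L0 eta0.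
exists n0 => n N al a q n0n NE aL AM a0 qk.
have c0 : 0 <= pi / N%:R :> R by rewrite divr_ge0 ?pi_ge0.
have h1 := h n N al a n0n NE aL AM a0.
set Q := (\sum_(k < N) \int[leb]_(s in _) _)%E in h1.
have QE : (Q <= (\sum_(k < N) q k)%:E)%E by rewrite -sumEFin; apply: lee_sum => k _; exact: qk.
set X := (\sum_(k < N) (leb _ + leb _))%E in h1.
have XE : X = (\sum_(k < N) (width G (k%:R * (pi / N%:R)) +
    fine (leb (notch (dirs N k) G (~` Omega)))))%:E.
  rewrite -sumEFin; apply: eq_bigr => k _; rewrite EFinD.
  by rewrite -(widthE (open_interior _) (ltW D0) GD) -(notchE (open_interior _) oF (ltW D0) GD).
have h2 : ((pi / N%:R)%:E * X + lambda%:E * (pi / N%:R * \sum_(k < N) (2 * al k))%:E <=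
    E%:E + lambda%:E * ((pi / N%:R)%:E * (\sum_(k < N) q k)%:E) + eta%:E)%E.
  apply: le_trans h1 _; apply: leeD2r; apply: leeD => //.
  by rewrite lee_wpmul2l ?lee_fin ?(ltW l0)// lee_wpmul2l ?lee_fin.
rewrite XE -!EFinM -!EFinD lee_fin in h2.
rewrite [X in _ * X](_ : _ = \sum_(k < N) (width G (k%:R * (pi / N%:R)) +
    fine (leb (notch (dirs N k) G (~` Omega)))) + lambda * (\sum_(k < N) (2 * al k) -
    \sum_(k < N) q k)); last first.
  by rewrite big_split/= -mulr_sumr sumrB.
by move: h2; move: (pi / N%:R) => P; lra.
Qed.

Lemma energyQ_fin_num (lambda E : R) (Omega : set (R * R)) :
  0 < lambda -> (energyQ lambda Omega <= E%:E)%E ->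
  [/\ hausdorff1 (boundary Omega) \is a fin_num, riesz_energy Omega \is a fin_num,
    0 <= fine (riesz_energy Omega) &
    fine (hausdorff1 (boundary Omega)) + lambda * fine (riesz_energy Omega) <= E].
Proof.
move=> l0; rewrite /energyQ => EE.
have I0 : (0 <= riesz_energy Omega)%E.
  apply: le_ereal_inf_tmp => _ [mu _ <-]; apply: integral_ge0 => x _.
  by apply: integral_ge0 => y _; exact: riesz_kernel_ge0.
have H0 := hausdorff1_ge0 (boundary Omega).
have lI0 : (0 <= lambda%:E * riesz_energy Omega)%E by rewrite mule_ge0// lee_fin ltW.
have Hf : hausdorff1 (boundary Omega) \is a fin_num.
  rewrite ge0_fin_numE//; apply: le_lt_trans (ltry E).
  by apply: le_trans EE; rewrite leeDl.
have If : riesz_energy Omega \is a fin_num.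
  rewrite ge0_fin_numE// ltey; apply/negP => /eqP Ioo; move: EE.
  by rewrite Ioo gt0_muley ?lte_fin// addey// -ltNye (lt_le_trans _ H0).
split=> //; first exact: fine_ge0.
by rewrite -lee_fin EFinD EFinM !fineK.
Qed.

(** With the competitor [w^-1] the linear and the quadratic terms combine to
    [2 / w - 1 / w]. *)
Lemma energyQ_widths (lambda E : R) (Omega : set (R * R)) (eta : R) :
  let G := interior Omega in
  0 < lambda -> admissible Omega -> (energyQ lambda Omega <= E%:E)%E -> 0 < eta ->
  exists n0 : nat, forall n N : nat, (n0 <= n)%N -> N = (2 ^ n)%N ->
  pi / N%:R * \sum_(k < N) (width G (k%:R * (pi / N%:R)) +
    fine (leb (notch (dirs N k) G (~` Omega))) +
    lambda * (width G (k%:R * (pi / N%:R)))^-1) <= E + eta.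
Proof.
move=> G l0 adm EE eta0; have [cO _ _] := adm.
have [_ If _ _] := energyQ_fin_num l0 EE.
have oG : open G by exact: open_interior.
have [x0 Gx0] : G !=set0.
  apply: interior_nonempty => //; by rewrite ltey_eq If.
have [r r0 rG] := (open_euclP _).1 oG x0 Gx0.
have [D D0 OD] := compact_bounded_plane cO.
have GD x : G x -> nrm x <= D by move=> /interior_subset/OD.
have [n0 h] := energyQ_ge_real r^-1 l0 adm EE (lexx 0) eta0.
exists n0 => n N n0n NE; pose w k := width G (k%:R * (pi / N%:R)).
have wr k : r <= w k by apply: (width_ge oG (ltW D0) GD) rG.
have w0 k : 0 < w k by exact: lt_le_trans (wr k).
have : pi / N%:R * \sum_(k < N) (w k + fine (leb (notch (dirs N k) G (~` Omega))) +
    lambda * (2 * (w k)^-1 - (w k)^-1)) <= E + eta.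
  apply: (h n N (fun k => (w k)^-1) (cst 0) (fun k => (w k)^-1) n0n NE).
  - by move=> k; rewrite /= normr0.
  - by move=> k s _; rewrite /= mul0r addr0 invr_ge0 (ltW (w0 k)) /= lef_pV2 ?posrE.
  - by move=> x; rewrite big1// => k _; rewrite mul0r.
  - move=> k; under eq_integral do rewrite /= mul0r addr0.
    rewrite integral_cst; last by apply: open_measurable; apply: open_shadow => //; exact: dir1.
    set m := (X in (_ * X)%E).
    have -> : m = (w k)%:E by exact: (widthE oG (ltW D0) GD).
    rewrite -EFinM lee_fin.
    by rewrite expr2 -mulrA mulVf ?mulr1 ?gt_eqF.
apply: le_trans; rewrite le_eqVlt; apply/orP; left; apply/eqP; congr (_ * _).
by apply: eq_bigr => k _; congr (_ + _ * _); lra.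
Qed.

Lemma width_excess (lambda w : R) : 0 < lambda -> 0 < w ->
  w + lambda * w^-1 = 2 * Num.sqrt lambda + (w - Num.sqrt lambda) ^+ 2 / w.
Proof.
move=> l0 w0; have l2 : lambda = Num.sqrt lambda ^+ 2 by rewrite sqr_sqrtr// ltW.
by move: l2; move: (Num.sqrt lambda) => u ->; field; rewrite gt_eqF.
Qed.

Lemma sum_cst_pi (N : nat) (c : R) : (0 < N)%N -> pi / N%:R * \sum_(k < N) c = pi * c.
Proof.
move=> N0; rewrite sumr_const card_ord -[in LHS]mulr_natl.
by move: (@pi R) => P; field; rewrite gt_eqF// ltr0n.
Qed.

(** Each direction contributes [w + lambda / w >= 2 * sqrt lambda]; the equality case
    is quantified by the squares and the notches on the left. *)
Lemma energyQ_excess (lambda E : R) (Omega : set (R * R)) (eta : R) :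
  let G := interior Omega in
  0 < lambda -> admissible Omega -> (energyQ lambda Omega <= E%:E)%E -> 0 < eta ->
  exists n0 : nat, forall n N : nat, (n0 <= n)%N -> N = (2 ^ n)%N ->
  2 * pi * Num.sqrt lambda + pi / N%:R * \sum_(k < N)
    ((width G (k%:R * (pi / N%:R)) - Num.sqrt lambda) ^+ 2 / width G (k%:R * (pi / N%:R)) +
    fine (leb (notch (dirs N k) G (~` Omega)))) <= E + eta.
Proof.
move=> G l0 adm EE eta0; have [cO _ _] := adm.
have [_ If _ _] := energyQ_fin_num l0 EE.
have oG : open G by exact: open_interior.
have [x0 Gx0] : G !=set0 by apply: interior_nonempty => //; rewrite ltey_eq If.
have [r r0 rG] := (open_euclP _).1 oG x0 Gx0.
have [D D0 OD] := compact_bounded_plane cO.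
have GD x : G x -> nrm x <= D by move=> /interior_subset/OD.
have [n0 h] := energyQ_widths l0 adm EE eta0.
exists n0 => n N n0n NE; pose w k := width G (k%:R * (pi / N%:R)).
apply: le_trans (h n N n0n NE).
have w0 k : 0 < w k by apply: (lt_le_trans r0); apply: (width_ge oG (ltW D0) GD) rG.
have -> : 2 * pi * Num.sqrt lambda = pi / N%:R * \sum_(k < N) (2 * Num.sqrt lambda).
  by rewrite sum_cst_pi ?NE ?expn_gt0//; ring.
rewrite -mulrDr -big_split /= ler_wpM2l ?divr_ge0 ?pi_ge0//; apply: ler_sum => k _.
have := width_excess l0 (w0 k); rewrite /w; move: (fine _) => nu; lra.
Qed.

(** Drop the nonnegative excess in [energyQ_excess]. *)
Lemma energyQ_lower (lambda : R) (Omega : set (R * R)) :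
  0 < lambda -> admissible Omega -> ((2 * pi * Num.sqrt lambda)%:E <= energyQ lambda Omega)%E.
Proof.
move=> l0 adm; rewrite leNgt; apply/negP => lt.
have [Hf If I0 _] := energyQ_fin_num l0 (ltW lt).
set E := fine (hausdorff1 (boundary Omega)) + lambda * fine (riesz_energy Omega).
have EE : energyQ lambda Omega = E%:E by rewrite EFinD EFinM !fineK.
rewrite EE lte_fin in lt; set v := 2 * pi * _ in lt.
have eta0 : 0 < (v - E) / 2 by rewrite divr_gt0// subr_gt0.
have EE' : (energyQ lambda Omega <= E%:E)%E by rewrite EE.
have [n0 h] := energyQ_excess l0 adm EE' eta0.
have aux (a b c : R) : 0 <= c -> a < b -> b + c <= a + (b - a) / 2 -> False by lra.
apply: (aux _ _ _ _ lt (h n0 _ (leqnn _) erefl)).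
rewrite mulr_ge0 ?divr_ge0 ?pi_ge0//; apply: sumr_ge0 => k _.
by rewrite addr_ge0 ?fine_ge0// divr_ge0 ?sqr_ge0// /width fine_ge0.
Qed.
End lower_bound.

(** * The equilibrium measure of the disc *)

Section equilibrium_measure.
Context {R : realType}.
Local Notation leb := (@leb R).
Local Notation leb2 := (leb \x leb)%E.

Lemma measurable_inv : measurable_fun [set: R] (fun r : R => r^-1).
Proof.
have -> : (fun r : R => r^-1) = (fun r : R => if r == 0 then 0 else r^-1).
  by apply/funext => r; case: eqP => [->|//]; rewrite invr0.
apply: measurable_fun_if => //; first by apply: measurable_fun_eqr.
rewrite setTI.
have -> : (fun r : R => r == 0) @^-1` [set false] = [set r : R | r != 0].
  by apply/seteqP; split=> r /=; [move=> ->|move/negbTE].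
apply: open_continuous_measurable_fun.
  have -> : [set r : R | r != 0] = ~` [set 0 : R].
    by apply/seteqP; split=> r /= /eqP.
  by rewrite openC; apply: compact_closed => //; exact: compact_set1.
by move=> r /set_mem /= r0; exact: inv_continuous.
Qed.

Lemma measurable_sqrt : measurable_fun [set: R] (Num.sqrt : R -> R).
Proof. by apply: continuous_measurable_fun; exact: sqrt_continuous. Qed.

Section arcsine.
Variable a : R.

Let f (v : R) : R := (Num.sqrt (a ^+ 2 - v ^+ 2))^-1.

Let f0 (v : R) : 0 <= f v. Proof. by rewrite invr_ge0 sqrtr_ge0. Qed.

Let mf : measurable_fun [set: R] f.
Proof.
apply: (measurableT_comp measurable_inv); apply: (measurableT_comp measurable_sqrt).
by apply: measurable_funB => //; apply: measurable_funX.
Qed.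

Let inside (v : R) : 0 < a -> `|v| < a -> 0 < a ^+ 2 - v ^+ 2.
Proof.
move=> a0 va; rewrite subr_gt0 -(real_normK (num_real v)).
by rewrite ltr_pXn2r ?nnegrE// ltW.
Qed.

Let cf (v : R) : 0 < a -> `|v| < a -> {for v, continuous f}.
Proof.
move=> a0 va; rewrite /continuous_at /f; apply: cvgV.
  by rewrite gt_eqF// sqrtr_gt0 inside.
apply: (@continuous_comp _ _ _ (fun x : R => a ^+ 2 - x ^+ 2) (Num.sqrt : R -> R) v).
  by apply: cvgB; [exact: cvg_cst|apply: cvgM; exact: cvg_id].
exact: sqrt_continuous.
Qed.

Let dF (v : R) : 0 < a -> `|v| < a -> is_derive v 1 (fun x => asin (x / a)) (f v).
Proof.
move=> a0 va.
have h : is_derive v 1 (fun x => x / a) a^-1.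
  apply/is_derive1_caratheodory; exists (fun=> a^-1); split => //.
    by move=> z; rewrite -mulrBl mulrC.
  exact: cst_continuous.
have va1 : -1 < v / a < 1.
  by rewrite ltr_pdivlMr// ltr_pdivrMr// mulN1r mul1r -ltr_norml.
have := @is_derive1_comp _ asin (fun x => x / a) v _ _ (is_derive1_asin va1) h.
move=> h1; apply: is_derive_eq h1 _.
rewrite /f -invfM; congr (_^-1).
rewrite -{2}(gtr0_norm a0) -sqrtr_sqr -sqrtrM; last first.
  by rewrite subr_ge0 expr_div_n ler_pdivrMr ?exprn_gt0// mul1r -subr_ge0 ltW ?inside.
by congr Num.sqrt; field; rewrite gt_eqF.
Qed.

(** The chords of a disc all have the same mass for the density of the
    equilibrium measure. *)
Lemma integral_arcsine : 0 < a ->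
  (\int[leb]_v ((Num.sqrt (a ^+ 2 - v ^+ 2))^-1)%:E = pi%:E)%E.
Proof.
move=> a0; have pp := @pi_gt0 R.
pose y n : R := pi / 2 * (1 - n.+2%:R^-1).
have y0 n : 0 < y n.
  by rewrite /y mulr_gt0 ?divr_gt0// subr_gt0 invf_lt1 ?ltr0Sn// ltr1n.
have y1 n : y n < pi / 2.
  by rewrite /y -[ltRHS]mulr1 ltr_pM2l ?divr_gt0// ltrBlDr ltrDl invr_gt0 ltr0Sn.
have yle n m : (n <= m)%N -> y n <= y m.
  move=> nm; rewrite /y ler_wpM2l ?divr_ge0 ?(ltW pp)// lerB//.
  by rewrite lef_pV2 ?posrE ?ltr0Sn// ler_nat !ltnS.
have yin n : y n \in `[- (pi / 2), pi / 2].
  by rewrite in_itv /=; apply/andP; split; have := y0 n; have := y1 n; lra.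
pose s n := a * sin (y n).
have s0 n : 0 < s n.
  by rewrite /s mulr_gt0// sin_gt0_pi// y0 /=; have := y1 n; lra.
have sa n : s n < a.
  rewrite /s -[ltRHS]mulr1 ltr_pM2l// -(@sin_pihalf R) ltr_sin//.
  by rewrite in_itv /=; apply/andP; split; lra.
pose F n : set R := `[- s n, s n]%classic.
have Fin n v : F n v -> `|v| < a.
  by rewrite /F /= in_itv /= -ler_norml => /le_lt_trans; apply.
have step n : (\int[leb]_(v in F n) (f v)%:E = (2 * y n)%:E)%E.
  pose Fa (x : R) := asin (x / a).
  rewrite integral_leb//; last 3 first.
  - exact: measurable_itv.
  - by apply/measurable_EFinP; exact: measurable_funTS.
  - by move=> v _; rewrite lee_fin.
  have cF (v : R) : `|v| < a -> {for v, continuous Fa}.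
    move=> va; apply: differentiable_continuous; apply/derivable1_diffP.
    by have := dF a0 va => dv; exact: ex_derive.
  have ns : `|- s n| < a by rewrite normrN gtr0_norm.
  have ps : `|s n| < a by rewrite gtr0_norm.
  rewrite (@continuous_FTC2 _ f Fa).
  - rewrite /Fa; have -> : s n / a = sin (y n) by rewrite /s mulrC mulKf// gt_eqF.
    have -> : - s n / a = sin (- y n) by rewrite sinN /s mulNr mulrC mulKf// gt_eqF.
    rewrite !sinK//; first by congr EFin; lra.
    by rewrite in_itv /= lerN2 lerNl; apply/andP; split; have := y0 n; have := y1 n; lra.
  - by have := s0 n; lra.
  - apply: continuous_in_subspaceT => v /set_mem Fv; apply: cf => //; exact: Fin Fv.
  - split.
    + move=> v; rewrite in_itv /= -ltr_norml => vs.
      by have := dF a0 (lt_trans vs (sa n)) => dv; exact: ex_derive.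
    + by apply: cvg_at_right_filter; exact: cF.
    + by apply: cvg_at_left_filter; exact: cF.
  - move=> v; rewrite in_itv /= -ltr_norml => vs; rewrite derive1E.
    by have := dF a0 (lt_trans vs (sa n)) => dv; exact: derive_val.
have cv : (\int[leb]_(v in F n) (f v)%:E)%E @[n --> \oo] -->
    (\int[leb]_(v in \bigcup_n F n) (f v)%:E)%E.
  apply: ge0_nondecreasing_set_cvg_integral.
  - move=> n m nm; apply/subsetPset => v; rewrite /F /= !in_itv /= -!ler_norml => /le_trans; apply.
    rewrite /s ler_wpM2l ?(ltW a0)//; move: (yle _ _ nm); rewrite le_eqVlt => /orP[/eqP ->//|lt].
    by apply: ltW; rewrite ltr_sin.
  - by move=> n; exact: measurable_itv.
  - by move=> n; apply/measurable_EFinP; exact: measurable_funTS.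
  - by move=> n v _; rewrite lee_fin.
have cvpi : (\int[leb]_(v in F n) (f v)%:E)%E @[n --> \oo] --> pi%:E.
  under eq_fun do rewrite step.
  apply: cvg_EFin; first by apply: nearW.
  have -> : pi = 2 * (pi / 2 * (1 - 0)) :> R by field.
  apply: cvgM; first exact: cvg_cst; apply: cvgM; first exact: cvg_cst.
  apply: cvgB; first exact: cvg_cst.
  have := @cvg_harmonic R; rewrite -(cvg_shiftn 1) /harmonic.
  by under eq_fun do rewrite addn1.
have -> : (\int[leb]_v (f v)%:E = \int[leb]_(v in \bigcup_n F n) (f v)%:E)%E.
  rewrite [RHS]integral_mkcond; apply: eq_integral => v _; rewrite patchE.
  case: ifPn => // /negP vF; congr EFin; rewrite /f ler0_sqrtr ?invr0//.
  rewrite subr_le0 leNgt; apply/negP => va2; apply: vF; rewrite inE.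
  have va : `|v| < a by rewrite -(ltr_pXn2r (n := 2)) ?nnegrE ?(ltW a0)// real_normK ?num_real.
  have t1 : -1 <= `|v| / a <= 1.
    rewrite ler_pdivrMr// mul1r (ltW va) andbT; apply: (@le_trans _ _ 0) => //.
    by rewrite divr_ge0// ltW.
  have hlt : asin (`|v| / a) < pi / 2.
    rewrite lt_neqAle asin_lepi2// andbT; apply/eqP => e.
    have := asinK (_ : `|v| / a \in `[-1, 1]); rewrite in_itv /= t1 e sin_pihalf => /(_ isT) e1.
    by move: va; rewrite -[ltRHS]mul1r e1 divfK ?gt_eqF// ltxx.
  have [n nP] : exists n : nat, asin (`|v| / a) <= y n.
    pose d := (pi / 2 - asin (`|v| / a)) / (pi / 2).
    have d0 : 0 < d by rewrite divr_gt0 ?subr_gt0 ?divr_gt0.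
    exists (Num.truncn d^-1).
    have hn : (Num.truncn d^-1).+2%:R^-1 <= d.
      rewrite invf_ple ?posrE ?ltr0Sn//; apply: ltW; apply: lt_trans (truncnS_gt _) _.
      by rewrite ltr_nat.
    have : pi / 2 * d = pi / 2 - asin (`|v| / a) by rewrite /d mulrC divfK// gt_eqF// divr_gt0.
    have : pi / 2 * (Num.truncn d^-1).+2%:R^-1 <= pi / 2 * d.
      by rewrite ler_wpM2l// divr_ge0// ltW.
    have -> : y (Num.truncn d^-1) = pi / 2 - pi / 2 / (Num.truncn d^-1).+2%:R.
      by rewrite /y [LHS]mulrBr mulr1.
    by move: (_ / _) => q1; lra.
  exists n => //; rewrite /F /= in_itv /= -ler_norml /s.
  have -> : `|v| = a * sin (asin (`|v| / a)).
    by rewrite asinK ?in_itv//= mulrC divfK// gt_eqF.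
  rewrite ler_wpM2l ?(ltW a0)//; move: nP; rewrite le_eqVlt => /orP[/eqP ->//|lt].
  apply: ltW; rewrite ltr_sin// in_itv /= asin_geNpi2// asin_lepi2//.
exact: (cvg_unique _ cv cvpi).
Qed.
End arcsine.
End equilibrium_measure.

Section density.
Context {R : realType}.
Local Notation leb := (@leb R).
Local Notation leb2 := (leb \x leb)%E.
Variable f : R * R -> R.
Hypotheses (f0 : forall x, 0 <= f x) (mf : measurable_fun [set: R * R] f).

Definition density_measure (_ : forall x, 0 <= f x) (_ : measurable_fun [set: R * R] f)
  (A : set (R * R)) : \bar R := (\int[leb2]_(x in A) (f x)%:E)%E.

Local Notation nu := (density_measure f0 mf).

Let nu_set0 : nu set0 = 0%E.
Proof. by rewrite /density_measure integral_set0. Qed.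

Let nu_ge0 A : (0 <= nu A)%E.
Proof. by apply: integral_ge0 => x _; rewrite lee_fin. Qed.

Let mfE : measurable_fun [set: R * R] (EFin \o f).
Proof. exact/measurable_EFinP. Qed.

Let nu_additive : semi_sigma_additive nu.
Proof.
move=> /= F mF tF mUF; rewrite /density_measure; apply: cvg_toP.
  apply: ereal_nondecreasing_is_cvgn => m n mn.
  by apply: lee_sum_nneg_natr => // k _ _; exact: nu_ge0.
rewrite ge0_integral_bigcup//=.
- exact: measurable_funTS.
- by move=> x _; rewrite lee_fin.
Qed.

HB.instance Definition _ := isMeasure.Build _ _ _ nu nu_set0 nu_ge0 nu_additive.

Import HBNNSimple.

Let integral_density_indic E : measurable E ->
  (\int[nu]_x (\1_E x)%:E = \int[leb2]_x ((\1_E x)%:E * (f x)%:E))%E.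
Proof.
move=> mE; rewrite integral_indic//= setIT [LHS]/density_measure integral_mkcond.
apply: eq_integral => x _; rewrite patchE indicE.
by case: ifP => _; rewrite ?mul1e ?mul0e.
Qed.

Let integral_density_nnsfun (h : {nnsfun _ >-> R}) :
  (\int[nu]_x (h x)%:E = \int[leb2]_x ((h x)%:E * (f x)%:E))%E.
Proof.
under [LHS]eq_integral do rewrite fimfunE -fsumEFin//.
rewrite [LHS]ge0_integral_fsum//; last 2 first.
  - by move=> r; exact/measurable_EFinP/measurableT_comp.
  - by move=> n x _; rewrite EFinM nnfun_muleindic_ge0.
under [RHS]eq_integral.
  move=> x xD; rewrite fimfunE -fsumEFin// ge0_mule_fsuml; last first.
    by move=> r; rewrite EFinM nnfun_muleindic_ge0.
  over.
rewrite [RHS]ge0_integral_fsum//; last 2 first.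
  - move=> r; apply: emeasurable_funM => //.
    by apply/measurable_EFinP; do 2 apply/measurableT_comp => //.
  - by move=> n x _; rewrite EFinM mule_ge0//; [rewrite nnfun_muleindic_ge0|rewrite lee_fin].
apply: eq_fsbigr => r _; have [r0|r0] := leP 0 r; last first.
  have -> : h @^-1` [set r] = set0 by rewrite preimage_nnfun0.
  by rewrite !integral0_eq// => x _; rewrite indic0 mulr0// mul0e.
have mh : measurable (h @^-1` [set r]) by [].
under [LHS]eq_integral do rewrite EFinM.
rewrite ge0_integralZl_EFin//; last first.
  by apply/measurable_EFinP; exact: measurable_indic.
rewrite integral_density_indic// -ge0_integralZl_EFin//; last 2 first.
- by move=> x _; rewrite mule_ge0// lee_fin.
- by apply: emeasurable_funM => //; apply/measurable_EFinP; exact: measurable_indic.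
by apply: eq_integral => x _; rewrite EFinM muleA.
Qed.

Lemma integral_density (g : R * R -> \bar R) :
  measurable_fun [set: R * R] g -> (forall x, 0 <= g x)%E ->
  (\int[nu]_x g x = \int[leb2]_x (g x * (f x)%:E))%E.
Proof.
move=> mg g0; pose g_ := nnsfun_approx measurableT mg.
have mg_ n : measurable_fun [set: R * R] (EFin \o g_ n) by exact/measurable_EFinP.
have cvg_ x : (EFin \o (g_ ^~ x)) n @[n --> \oo] --> g x by exact: cvg_nnsfun_approx.
transitivity (lim (\int[nu]_x (g_ n x)%:E @[n --> \oo])%E).
  rewrite -monotone_convergence//=.
  - by apply: eq_integral => x _; apply/esym/cvg_lim => //; exact: cvg_.
  - by move=> n x _; rewrite lee_fin.
  - by move=> x _ n m nm; rewrite lee_fin; exact/lefP/nd_nnsfun_approx.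
under eq_fun do rewrite integral_density_nnsfun.
rewrite -monotone_convergence//=.
- apply: eq_integral => x _; apply/cvg_lim => //.
  by apply: cvgeZr => //; exact: cvg_.
- by move=> n; exact: (emeasurable_funM (mg_ n) mfE).
- by move=> n x _; rewrite mule_ge0// lee_fin.
- move=> x _ n m nm; rewrite lee_wpmul2r ?lee_fin//.
  exact/lefP/nd_nnsfun_approx.
Qed.
End density.

Section ball_energy.
Context {R : realType}.
Local Notation leb := (@leb R).
Local Notation leb2 := (leb \x leb)%E.
Variables (c : R * R) (rad : R).
Hypothesis rad0 : 0 < rad.

(** The equilibrium measure of the disc for the kernel [1 / |x - y|]: the projection to the
    plane of the uniform measure on the sphere. *)
Definition equilibrium_density (x : R * R) : R :=
  (2 * pi * rad)^-1 * (Num.sqrt (rad ^+ 2 - nrm (x - c) ^+ 2))^-1.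

Let f := equilibrium_density.

Let f0 x : 0 <= f x.
Proof.
by rewrite mulr_ge0// invr_ge0 ?sqrtr_ge0// !mulr_ge0 ?pi_ge0// ltW.
Qed.

Let g (x : R * R) : R := (2 * pi * rad)^-1 * (Num.sqrt (rad ^+ 2 - nrm x ^+ 2))^-1.

Let mg : measurable_fun [set: R * R] g.
Proof.
apply: measurable_funM => //; apply: (measurableT_comp measurable_inv).
apply: (measurableT_comp measurable_sqrt); apply: measurable_funB => //.
have -> : (fun x : R * R => nrm x ^+ 2) = (fun x => x.1 * x.1 + x.2 * x.2).
  by apply/funext => x; rewrite sqr_nrm.
by apply: measurable_funD; apply: measurable_funM.
Qed.

Let mshift : measurable_fun [set: R * R] (fun x : R * R => x - c).
Proof. by apply: measurable_fun_pair; apply: measurable_funB. Qed.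

Let mf : measurable_fun [set: R * R] f.
Proof. exact: (measurableT_comp mg mshift). Qed.

Local Notation nu := (density_measure f0 mf).

(** By [integral_arcsine] a chord has the same mass whatever its length, so the
    projections of the measure are uniform. *)
Let projection_uniform e (phi : R -> R) : dotp e e = 1 ->
  measurable_fun [set: R] phi -> (forall s, 0 <= phi s) ->
  (\int[nu]_x (phi (coord e (x - c)))%:E =
   \int[leb]_(s in `](- rad)%R, rad[) ((2 * rad)^-1 * phi s)%:E)%E.
Proof.
move=> e1 mphi phi0; have pp := @pi_gt0 R.
have mc : measurable_fun [set: R * R] (fun x => phi (coord e x)).
  exact: (measurableT_comp mphi (measurable_coord e)).
rewrite integral_density//; last 2 first.
- by apply/measurable_EFinP; exact: (measurableT_comp mc mshift).
- by move=> x; rewrite lee_fin.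
pose h x : \bar R := ((phi (coord e x))%:E * (g x)%:E)%E.
have mh : measurable_fun [set: R * R] h.
  by apply: emeasurable_funM; exact/measurable_EFinP.
have g0 x : 0 <= g x.
  by rewrite mulr_ge0// invr_ge0 ?sqrtr_ge0// !mulr_ge0 ?pi_ge0// ltW.
have h0 x : (0 <= h x)%E by rewrite mule_ge0// lee_fin.
rewrite (@integral2_translation R h (- c)) => //.
have e2 : e.1 ^+ 2 + e.2 ^+ 2 = 1 by rewrite -e1 /dotp !expr2.
rewrite -(integral2_rot e2)//.
have hE (x : R * R) : h (rot e.1 e.2 x) = ((phi x.2)%:E * (g x)%:E)%E.
  have -> : rot e.1 e.2 x = line e x.2 x.1 by rewrite /line -surjective_pairing.
  rewrite /h coord_line// /g; congr (_ * (_ * (Num.sqrt (_ - _))^-1)%:E)%E.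
  rewrite !sqr_nrm; transitivity (dotp x x * dotp e e); last by rewrite e1 mulr1.
  by rewrite /line /rot /dotp /=; ring.
under eq_integral do rewrite hE.
have mk : measurable_fun [set: R * R] (fun x : R * R => ((phi x.2)%:E * (g x)%:E)%E).
  apply: emeasurable_funM; apply/measurable_EFinP => //.
  exact: (measurableT_comp mphi measurable_snd).
rewrite fubini_tonelli2//; last by move=> x; rewrite mule_ge0// lee_fin.
rewrite [RHS]integral_mkcond; apply: eq_integral => s _.
rewrite /fubini_G /= ge0_integralZl//; last 3 first.
- by apply/measurable_EFinP; exact: (measurableT_comp mg (pair2_measurable s)).
- by move=> t _; rewrite lee_fin.
- by rewrite lee_fin.
rewrite patchE; case: ifPn.
  rewrite inE /= in_itv /= -ltr_norml => sr.
  have d0 : 0 < rad ^+ 2 - s ^+ 2.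
    by rewrite subr_gt0 -(real_normK (num_real s)) ltr_pXn2r ?nnegrE// ltW.
  have aE : Num.sqrt (rad ^+ 2 - s ^+ 2) ^+ 2 = rad ^+ 2 - s ^+ 2 by rewrite sqr_sqrtr// ltW.
  have -> : (\int[leb]_t (g (t, s))%:E = (2 * pi * rad)^-1%:E * pi%:E)%E.
    rewrite -(@integral_arcsine R (Num.sqrt (rad ^+ 2 - s ^+ 2))); last by rewrite sqrtr_gt0.
    rewrite -ge0_integralZl_EFin//; last 2 first.
    - apply/measurable_EFinP; apply: (measurableT_comp measurable_inv).
      apply: (measurableT_comp measurable_sqrt); apply: measurable_funB => //.
    - by rewrite invr_ge0 !mulr_ge0 ?(ltW pp)// ltW.
    apply: eq_integral => t _; rewrite -EFinM /g sqr_nrm aE /dotp /=.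
    by congr (_ * (Num.sqrt _)^-1)%:E; ring.
  rewrite -!EFinM; congr EFin; move: (@pi R) pp => P P0; field.
  by rewrite !gt_eqF.
rewrite notin_setE /= in_itv /= -ltr_norml => /negP; rewrite -leNgt => sr.
have -> : (\int[leb]_t (g (t, s))%:E = 0)%E.
  apply: integral0_eq => t _; rewrite /g ler0_sqrtr ?invr0 ?mulr0//.
  rewrite sqr_nrm /dotp /= subr_le0; apply: (@le_trans _ _ (s * s)).
    by rewrite -expr2 -(real_normK (num_real s)) ler_pXn2r ?nnegrE// ltW.
  by rewrite lerDr -expr2 sqr_ge0.
by rewrite mule0.
Qed.

Let nu_setT : nu [set: R * R] = 1%E.
Proof.
have -> : nu [set: R * R] = (\int[nu]_x (cst 1%:E x))%E by rewrite integral_cst// mul1e.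
rewrite (@projection_uniform (dir 0) (cst 1) (dir1 0) (measurable_cst _) (fun=> ler01)).
transitivity (\int[leb]_(s in `](- rad)%R, rad[) cst ((2 * rad)^-1)%:E s)%E.
  by apply: eq_integral => s _; rewrite /= mulr1.
rewrite integral_cst//; set m := (X in (_ * X)%E).
have -> : m = (rad - - rad)%:E by apply: leb_itv; move: rad0; lra.
by rewrite -EFinM; congr EFin; field; rewrite gt_eqF.
Qed.

HB.instance Definition _ := @Measure_isProbability.Build _ _ R nu nu_setT.

Let mass_ball : nu (eucl_closed_ball c rad) = 1%E.
Proof.
have mB : measurable (eucl_closed_ball c rad).
  by apply: closed_measurable_plane; exact: closed_eucl_closed_ball.
have nC : nu (~` eucl_closed_ball c rad) = 0%E.
  rewrite /density_measure; apply: integral0_eq => x /negP; rewrite /= -ltNge => h.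
  rewrite /f /equilibrium_density ler0_sqrtr ?invr0 ?mulr0// subr_le0.
  by rewrite -eucl_distE eucl_distC ler_pXn2r ?nnegrE ?eucl_dist_ge0 ?(ltW h) ?(ltW rad0).
have := @probability_setC _ _ R nu _ (measurableC mB); rewrite setCK => h.
apply: etrans h _; set m := (X in (_ - X)%E).
by rewrite (_ : m = 0%E) ?sube0//; exact: nC.
Qed.

Let projection_poisson_le e b y : dotp e e = 1 -> 0 < b ->
  (\int[nu]_x (poisson b (coord e y - coord e x))%:E <= ((2 * rad)^-1)%:E)%E.
Proof.
move=> e1 b0; have pp := @pi_gt0 R; pose t := coord e (y - c).
have -> : (\int[nu]_x (poisson b (coord e y - coord e x))%:E =
    \int[nu]_x (poisson b (coord e (x - c) - t))%:E)%E.
  apply: eq_integral => x _; congr EFin; rewrite -poissonN /t !coordB; congr poisson.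
  by ring.
have mphi : measurable_fun [set: R] (fun s => poisson b (s - t)).
  by apply: continuous_measurable_fun; exact: continuous_poisson_shift.
rewrite (projection_uniform e1 mphi); last by move=> s; exact: poisson_ge0.
have rt : 0 < rad + `|t| by rewrite ltr_pwDl.
apply: (@le_trans _ _ (\int[leb]_(s in `[(t - (rad + `|t|))%R, (t + (rad + `|t|))%R])
    ((2 * rad)^-1 * poisson b (s - t))%:E)%E).
  apply: ge0_subset_integral => //.
  - by apply/measurable_EFinP; apply: measurable_funTS; apply: measurable_funM.
  - by move=> s _; rewrite lee_fin mulr_ge0 ?poisson_ge0// invr_ge0 mulr_ge0// ltW.
  - move=> s; rewrite /= !in_itv /= => /andP[s1 s2].
    have := ler_norm t; have := ler_norm (- t); rewrite normrN => ? ?.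
    by apply/andP; split; lra.
under eq_integral do rewrite EFinM.
rewrite ge0_integralZl_EFin//; last 3 first.
- by move=> s _; rewrite lee_fin poisson_ge0.
- by apply/measurable_EFinP; exact: measurable_funTS.
- by rewrite invr_ge0 mulr_ge0// ltW.
rewrite poisson_itv// -EFinM lee_fin -[leRHS]mulr1 ler_wpM2l//.
  by rewrite invr_ge0 mulr_ge0// ltW.
by rewrite mulrC -[2 / pi]invf_div ler_pdivrMr ?divr_gt0// mul1r ltW ?atan_ltpi2.
Qed.

Let soft (b : R) (x y : R * R) : R := (Num.sqrt (b ^+ 2 + nrm (x - y) ^+ 2))^-1.

Let msoft b x : measurable_fun [set: R * R] (soft b x).
Proof.
apply: (measurableT_comp measurable_inv); apply: (measurableT_comp measurable_sqrt).
apply: measurable_funD => //.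
have -> : (fun y : R * R => nrm (x - y) ^+ 2) =
    (fun y => (x.1 - y.1) * (x.1 - y.1) + (x.2 - y.2) * (x.2 - y.2)).
  by apply/funext => y; rewrite sqr_nrm.
by apply: measurable_funD; apply: measurable_funM; apply: measurable_funB.
Qed.

Let soft_ge0 b x y : 0 <= soft b x y.
Proof. by rewrite invr_ge0 sqrtr_ge0. Qed.

(** The potential is [pi] times an average of potentials of uniform measures on segments for
    kernels of total mass 1, each of which is at most the density [(2 * rad)^-1]. *)
Let potential_soft_le b x : 0 < b ->
  (\int[nu]_y (soft b x y)%:E <= (pi / (2 * rad))%:E)%E.
Proof.
move=> b0; have pp := @pi_gt0 R.
apply/lee_addgt0Pr => eps eps0.
pose n := (Num.truncn (b * eps)^-1).+1; pose N := (2 ^ n)%N.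
have N0 : 0 < N%:R :> R by rewrite ltr0n expn_gt0.
have Neps : (b * N%:R)^-1 <= eps.
  have h1 : (b * eps)^-1 <= N%:R.
    apply: ltW; apply: lt_le_trans (truncnS_gt _) _.
    by rewrite ler_nat ltnW// ltn_expl.
  have -> : (b * N%:R)^-1 = (b * eps)^-1 / N%:R * eps by field; rewrite !gt_eqF.
  by rewrite -[leRHS]mul1r ler_wpM2r ?(ltW eps0)// ler_pdivrMr// mul1r.
pose e k : R * R := dir (k%:R * (pi / N%:R)).
have c0 : 0 <= pi / N%:R :> R by rewrite divr_ge0 ?(ltW pp)// ltW.
have mP k : measurable_fun [set: R * R] (fun y => poisson b (coord (e k) x - coord (e k) y)).
  apply: measurableT_comp.
    by apply: continuous_measurable_fun; exact: continuous_poisson.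
  by apply: measurable_funB => //; exact: measurable_coord.
apply: (@le_trans _ _ (\int[nu]_y ((pi / N%:R)%:E *
    \sum_(k < N) (poisson b (coord (e k) x - coord (e k) y))%:E + eps%:E))%E).
  apply: ge0_le_integral => //.
  - by move=> y _; rewrite lee_fin.
  - by apply/measurable_EFinP; exact: msoft.
  - apply: emeasurable_funD => //; apply: measurable_funeM.
    by apply: emeasurable_sum => k; apply/measurable_EFinP; exact: mP.
  move=> y _; rewrite sumEFin -EFinM -EFinD lee_fin.
  have h : - (b * N%:R)^-1 <= pi / N%:R * \sum_(k < N) poisson b (coord (e k) (x - y)) -
      soft b x y.
    by have := poisson_average_coord (x - y) b0 (erefl N); rewrite ler_norml => /andP[].
  under eq_bigr do rewrite -coordB.
  apply: (@le_trans _ _ (pi / N%:R * \sum_(k < N) poisson b (coord (e k) (x - y)) +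
    (b * N%:R)^-1)); last by rewrite lerD2l.
  by rewrite -lerBlDr; move: h; rewrite lerBrDr addrC.
rewrite ge0_integralD//; last 3 first.
- move=> y _; rewrite mule_ge0 ?lee_fin//; apply: sume_ge0 => k _.
  by rewrite lee_fin poisson_ge0.
- apply: measurable_funeM.
  by apply: emeasurable_sum => k; apply/measurable_EFinP; exact: mP.
- by move=> y _; rewrite lee_fin ltW.
apply: leeD; last first.
  rewrite integral_cst//; set m := (X in (_ * X)%E).
  by rewrite (_ : m = 1%E) ?mule1//; exact: nu_setT.
rewrite ge0_integralZl_EFin//; last 2 first.
- by move=> y _; apply: sume_ge0 => k _; rewrite lee_fin poisson_ge0.
- by apply: emeasurable_sum => k; apply/measurable_EFinP; exact: mP.
rewrite ge0_integral_sum//; last 2 first.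
- by move=> k; apply/measurable_EFinP; exact: mP.
- by move=> k y _; rewrite lee_fin poisson_ge0.
apply: (@le_trans _ _ ((pi / N%:R)%:E * \sum_(k < N) ((2 * rad)^-1)%:E)%E).
  rewrite lee_wpmul2l ?lee_fin//; apply: lee_sum => k _.
  by apply: projection_poisson_le => //; exact: dir1.
rewrite sumEFin sumr_const card_ord -EFinM lee_fin -mulr_natl.
rewrite le_eqVlt; apply/orP; left; apply/eqP.
by move: (@pi R) => P; field; rewrite !gt_eqF.
Qed.

Let potential_le x : (\int[nu]_y riesz_kernel x y <= (pi / (2 * rad))%:E)%E.
Proof.
have cv y : (soft n.+1%:R^-1 x y)%:E @[n --> \oo] --> riesz_kernel x y.
  rewrite /riesz_kernel inver; case: eqP => [d0|/eqP d0].
    have e n : soft n.+1%:R^-1 x y = n.+1%:R.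
      rewrite /soft -eucl_distE d0 expr0n /= addr0 sqrtr_sqr ger0_norm ?invr_ge0//.
      by rewrite invrK.
    apply/cvgeryP/cvgryPge => A; near=> n; rewrite e.
    by apply: (@le_trans _ _ n%:R); [near: n; exact: nbhs_infty_ger|rewrite ler_nat].
  apply: cvg_EFin; first by apply: nearW.
  have d1 : 0 < eucl_dist x y by rewrite lt_neqAle eq_sym d0 eucl_dist_ge0.
  have ch : {for (0 : R), continuous (fun t : R => (Num.sqrt (t ^+ 2 + nrm (x - y) ^+ 2))^-1)}.
    rewrite /continuous_at; apply: cvgV.
      by rewrite gt_eqF// sqrtr_gt0 expr0n /= add0r exprn_gt0// -eucl_distE.
    apply: (@continuous_comp _ _ _ (fun t : R => t ^+ 2 + nrm (x - y) ^+ 2)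
      (Num.sqrt : R -> R) 0); last exact: sqrt_continuous.
    by apply: cvgD; [apply: cvgM; exact: cvg_id|exact: cvg_cst].
  have H := continuous_cvg _ ch (@cvg_harmonic R); have {}H := H _.
  rewrite expr0n /= add0r sqrtr_sqr ger0_norm ?nrm_ge0// -eucl_distE in H.
  exact: H.
have mono y n m : (n <= m)%N -> soft n.+1%:R^-1 x y <= soft m.+1%:R^-1 x y.
  move=> nm; have pos (k : nat) : 0 < Num.sqrt (k.+1%:R^-1 ^+ 2 + nrm (x - y) ^+ 2).
    by rewrite sqrtr_gt0 ltr_wpDr ?sqr_ge0// exprn_gt0.
  rewrite /soft lef_pV2 ?posrE// ler_wsqrtr// lerD2r ler_pXn2r ?nnegrE//.
  by rewrite lef_pV2 ?posrE ?ltr0Sn// ler_nat ltnS.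
have cvI := @cvg_monotone_convergence _ _ _ nu _ measurableT
  (fun n y => (soft n.+1%:R^-1 x y)%:E) _ _ _.
have -> : (\int[nu]_y riesz_kernel x y =
    \int[nu]_y limn (fun n => (soft n.+1%:R^-1 x y)%:E))%E.
  by apply: eq_integral => y _; apply/esym/cvg_lim => //; exact: cv.
apply: (cvge_to_le (cvI _ _ _)).
- by move=> n; apply/measurable_EFinP; exact: msoft.
- by move=> n y _; rewrite lee_fin.
- by move=> y _ n m nm; rewrite lee_fin mono.
by apply: nearW => n; exact: potential_soft_le.
Unshelve. all: by end_near. Qed.

(** The potential of the equilibrium measure is at most [pi / (2 * rad)] everywhere. *)
Lemma riesz_energy_ball :
  (riesz_energy (eucl_closed_ball c rad) <= (pi / (2 * rad))%:E)%E.
Proof.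
have mB : measurable (eucl_closed_ball c rad).
  by apply: closed_measurable_plane; exact: closed_eucl_closed_ball.
have mk := @measurable_riesz_kernel R.
have mkx x : measurable_fun [set: R * R] (riesz_kernel x).
  exact: (measurableT_comp mk (pair1_measurable x)).
apply: (@le_trans _ _ (\int[nu]_x \int[nu]_y riesz_kernel x y)%E).
  rewrite -(energy_restrict mB mass_ball).
  by apply: ereal_inf_lbound; exists nu => //; exact: mass_ball.
apply: (@le_trans _ _ (\int[nu]_x (cst (pi / (2 * rad))%:E x))%E); last first.
  rewrite integral_cst//; set m := (X in (_ * X)%E).
  by rewrite (_ : m = 1%E) ?mule1//; exact: nu_setT.
apply: ge0_le_integral => //.
- by move=> x _; apply: integral_ge0 => y _; exact: riesz_kernel_ge0.
- by apply: (@measurable_fun_fubini_tonelli_F _ _ _ _ R nu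
      (fun z : (R * R) * (R * R) => riesz_kernel z.1 z.2)) => // z; exact: riesz_kernel_ge0.
Qed.
End ball_energy.

(** * The energy of the ball *)

Section ball.
Context {R : realType}.
Local Notation leb := (@leb R).
Implicit Types (c x y : R * R) (t s rad : R).

Lemma norm_sin_le t : `|sin t| <= `|t|.
Proof.
suff h (u : R) : 0 <= u -> `|sin u| <= u.
  have [t0|t0] := leP 0 t; first by rewrite [leRHS]ger0_norm// h.
  by rewrite -normrN -sinN [leRHS]ltr0_norm// h// oppr_ge0 ltW.
rewrite le_eqVlt => /predU1P[<-|u0]; first by rewrite sin0 normr0.
have [v _ e] : exists2 v, v \in `]0, u[ & sin u - sin 0 = cos v * (u - 0).
  apply: (@MVT R sin cos 0 u u0); by apply: continuous_subspaceT => ?; exact: continuous_sin.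
rewrite sin0 !subr0 in e; rewrite e normrM (gtr0_norm u0) ler_piMl ?(ltW u0)//.
exact: cos_max.
Qed.

Lemma eucl_dist_dir t s : eucl_dist (dir t) (dir s) <= `|t - s|.
Proof.
have -> : eucl_dist (dir t) (dir s) = `|2 * sin ((t - s) / 2)|.
  rewrite -sqrtr_sqr /eucl_dist /dir /=; congr Num.sqrt.
  have e1 : cos t = cos ((t + s) / 2 + (t - s) / 2) by congr cos; field.
  have e2 : cos s = cos ((t + s) / 2 - (t - s) / 2) by congr cos; field.
  have e3 : sin t = sin ((t + s) / 2 + (t - s) / 2) by congr sin; field.
  have e4 : sin s = sin ((t + s) / 2 - (t - s) / 2) by congr sin; field.
  rewrite e1 e2 e3 e4 cosD cosB sinD sinB.
  have := cos2Dsin2 ((t + s) / 2).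
  move: (cos ((t + s) / 2)) (sin ((t + s) / 2)) => p q pq.
  move: (cos ((t - s) / 2)) (sin ((t - s) / 2)) => a b.
  by transitivity (4 * b ^+ 2 * (p ^+ 2 + q ^+ 2)); [ring|rewrite pq; ring].
rewrite normrM ger0_norm//; have := norm_sin_le ((t - s) / 2).
by rewrite normrM (@ger0_norm _ 2^-1) ?invr_ge0//; lra.
Qed.

Lemma polar_circle c rad x : 0 <= rad -> eucl_dist c x = rad ->
  exists2 t, `|t| <= pi & x = c + sc rad (dir t).
Proof.
move=> r0 cx; have [t tp e] := polar (x - c); exists t => //.
move: e; rewrite -eucl_distE eucl_distC cx => <-.
by rewrite addrC subrK.
Qed.

Lemma boundary_ball_sub c rad x : boundary (eucl_closed_ball c rad) x -> eucl_dist c x = rad.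
Proof.
move=> [cl ni]; apply/eqP; rewrite eq_le; apply/andP; split.
  by move: cl; rewrite -(closure_id _).1//; exact: closed_eucl_closed_ball.
rewrite leNgt; apply/negP => lt; apply: ni.
rewrite /interior; apply/nbhs_eucl; exists (rad - eucl_dist c x); first by rewrite subr_gt0.
by move=> y xy; rewrite /eucl_closed_ball /=; have := eucl_dist_triangle x c y; lra.
Qed.

Let arc c rad (N k : nat) : set (R * R) :=
  [set c + sc rad (dir t) | t in
    `[- pi + k%:R * (2 * pi / N%:R), - pi + k.+1%:R * (2 * pi / N%:R)]%classic].

(** Cover the circle with [N] arcs of equal length, whose diameters are at most their
    lengths. *)
Lemma hausdorff1_circle c rad : 0 < rad ->
  (hausdorff1 (boundary (eucl_closed_ball c rad)) <= (2 * pi * rad)%:E)%E.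
Proof.
move=> r0; have pp := @pi_gt0 R; apply: ge_ereal_sup => _ [delta /= d0 <-].
pose N := (Num.truncn (2 * pi * rad / delta)).+1.
have N0 : 0 < N%:R :> R by rewrite ltr0n.
pose h : R := 2 * pi / N%:R; have h0 : 0 < h by rewrite divr_gt0// mulr_gt0.
have hd : rad * h <= delta.
  have : 2 * pi * rad / delta < N%:R by exact: truncnS_gt.
  rewrite ltr_pdivrMr// => /ltW lt; rewrite /h mulrA ler_pdivrMr// [rad * _]mulrC.
  by rewrite [delta * _]mulrC.
pose C k := if (k < N)%N then arc c rad N k else set0.
have Cd k : (eucl_diam (C k) <= (if (k < N)%N then rad * h else 0)%:E)%E.
  rewrite /C; case: ifP => _; last by apply: eucl_diam_le => // x y [].
  apply: eucl_diam_le; first by rewrite mulr_ge0// ltW.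
  move=> _ _ [t /= + <-] [s /= + <-]; rewrite !in_itv /= => /andP[t1 t2] /andP[s1 s2].
  have -> : eucl_dist (c + sc rad (dir t)) (c + sc rad (dir s)) =
      rad * eucl_dist (dir t) (dir s).
    rewrite !eucl_distE -[rad in RHS]gtr0_norm// -nrm_scale; congr nrm.
    by rewrite /sc; congr (_, _) => /=; ring.
  rewrite ler_wpM2l ?(ltW r0)//; apply: le_trans (eucl_dist_dir t s) _.
  have e : k.+1%:R * (2 * pi / N%:R) = k%:R * h + h by rewrite -natr1 /h; ring.
  rewrite e in t2 s2; rewrite -/h in t1 s1.
  by rewrite ler_norml; apply/andP; split; lra.
apply: (@le_trans _ _ (\sum_(k <oo) eucl_diam (C k))%E).
  apply: ereal_inf_lbound; exists C => //; split; last first.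
    move=> k; apply: le_trans (Cd k) _; rewrite lee_fin; case: ifP => // _; exact: ltW.
  move=> x /boundary_ball_sub/(polar_circle (ltW r0))[t tp ->].
  have [k kN kt] : exists2 k, (k < N)%N & (- pi + k%:R * h <= t <= - pi + k.+1%:R * h).
    move: tp; rewrite ler_norml => /andP[t1 t2].
    have Nh : N%:R * h = 2 * pi by rewrite /h mulrC divfK// gt_eqF.
    have u0 : 0 <= (t + pi) / h by rewrite divr_ge0 ?(ltW h0)//; lra.
    have [lt|ge] := ltP (Num.truncn ((t + pi) / h)) N.
      exists (Num.truncn ((t + pi) / h)) => //; apply/andP; split.
        have : (Num.truncn ((t + pi) / h))%:R <= (t + pi) / h by rewrite truncn_le.
        by rewrite ler_pdivlMr//; lra.
      have := truncnS_gt ((t + pi) / h); rewrite ltr_pdivrMr//; lra.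
    exists N.-1 => //; rewrite prednK//.
    have : N%:R <= (t + pi) / h.
      by apply: (@le_trans _ _ (Num.truncn ((t + pi) / h))%:R); rewrite ?ler_nat ?truncn_le.
    rewrite ler_pdivlMr// Nh => t3; apply/andP; split; last lra.
    have : N.-1%:R * h <= N%:R * h by rewrite ler_wpM2r ?(ltW h0)// ler_nat leq_pred.
    by rewrite Nh; lra.
  by exists k => //; rewrite /C kN; exists t => //=; rewrite in_itv.
apply: (@le_trans _ _ (\sum_(k <oo) (if (k < N)%N then rad * h else 0)%:E)%E).
  by apply: lee_nneseries => k *; [exact: eucl_diam_ge0|exact: Cd].
rewrite (nneseries_split 0 N); last by move=> k _; rewrite lee_fin; case: ifP => // _; rewrite mulr_ge0// ltW.
rewrite add0n big_mkord [X in (_ + X)%E]eseries0 ?adde0; last first.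
  by move=> k Nk _; rewrite ltnNge Nk.
under eq_bigr do rewrite ltn_ord.
rewrite sumEFin sumr_const card_ord lee_fin -mulr_natl /h.
by rewrite le_eqVlt; apply/orP; left; apply/eqP; move: (@pi R) => P; field; rewrite gt_eqF.
Qed.

Lemma area_ball_gt0 c rad : 0 < rad -> (0 < area (eucl_closed_ball c rad))%E.
Proof.
move=> r0; pose h := rad / 2; have h0 : 0 < h by rewrite divr_gt0.
pose I1 := `[c.1 - h, c.1 + h]%classic; pose I2 := `[c.2 - h, c.2 + h]%classic.
apply: (@lt_le_trans _ _ (area (I1 `*` I2))).
  rewrite /area product_measure1E//; try exact: measurable_itv.
  have e1 : lebesgue_measure I1 = (rad%:E : \bar R).
    by rewrite -/(leb I1) leb_itv; [congr EFin; rewrite /h; field|lra].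
  have e2 : lebesgue_measure I2 = (rad%:E : \bar R).
    by rewrite -/(leb I2) leb_itv; [congr EFin; rewrite /h; field|lra].
  set m1 := (X in (X * _)%E); set m2 := (X in (_ * X)%E).
  have -> : m1 = rad%:E by exact: e1.
  have -> : m2 = rad%:E by exact: e2.
  by rewrite -EFinM lte_fin mulr_gt0.
apply: le_measure; rewrite ?inE.
- by apply: measurableX; exact: measurable_itv.
- by apply: closed_measurable_plane; exact: closed_eucl_closed_ball.
move=> x []; rewrite /I1 /I2 /= !in_itv /= => /andP[a1 a2] /andP[b1 b2].
have q1 : (c.1 - x.1) ^+ 2 <= h ^+ 2.
  by rewrite -(real_normK (num_real (c.1 - x.1))) lerXn2r ?nnegrE ?(ltW h0)// ler_norml; apply/andP; split; lra.
have q2 : (c.2 - x.2) ^+ 2 <= h ^+ 2.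
  by rewrite -(real_normK (num_real (c.2 - x.2))) lerXn2r ?nnegrE ?(ltW h0)// ler_norml; apply/andP; split; lra.
rewrite /eucl_closed_ball /= /eucl_dist -[rad in leRHS](gtr0_norm r0) -sqrtr_sqr.
apply: ler_wsqrtr; apply: le_trans (lerD q1 q2) _.
have -> : rad = h + h by rewrite /h; field.
by have := sqr_ge0 h; rewrite [(h + h) ^+ 2]sqrrD; lra.
Qed.

Lemma admissible_ball c rad : 0 < rad -> admissible (eucl_closed_ball c rad).
Proof.
move=> r0; split; [exact: compact_eucl_closed_ball|exact: area_ball_gt0|].
exact: le_lt_trans (hausdorff1_circle c r0) (ltry _).
Qed.

Lemma energyQ_ball (lambda : R) c : 0 < lambda ->
  (energyQ lambda (eucl_closed_ball c (2^-1 * Num.sqrt lambda)) <=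
   (2 * pi * Num.sqrt lambda)%:E)%E.
Proof.
move=> l0; have q0 : 0 < Num.sqrt lambda by rewrite sqrtr_gt0.
have r0 : 0 < 2^-1 * Num.sqrt lambda by rewrite mulr_gt0.
apply: le_trans (leeD (hausdorff1_circle c r0)
  (lee_wpmul2l (ltW l0 : (0 <= lambda%:E)%E) (riesz_energy_ball c r0))) _.
rewrite -EFinM -EFinD lee_fin -{2}(sqr_sqrtr (ltW l0)).
move: (@pi R) (Num.sqrt lambda) q0 => P q q0; rewrite le_eqVlt; apply/orP; left; apply/eqP.
by field; rewrite gt_eqF.
Qed.
End ball.

(** * Hausdorff measure of separated sets and of countable unions *)

Section hausdorff_sums.
Context {R : realType}.
Implicit Types (A B : set (R * R)).

Lemma eucl_diam_mono A B : A `<=` B -> (eucl_diam A <= eucl_diam B)%E.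
Proof.
move=> AB; apply: ge_ereal_sup => _ [->|[[x y] /= [Ax Ay] <-]].
  exact: eucl_diam_ge0.
by apply: dist_le_eucl_diam; exact: AB.
Qed.

Lemma eucl_diam_set0 : eucl_diam (set0 : set (R * R)) = 0%E.
Proof. by apply/eqP; rewrite eq_le eucl_diam_ge0 eucl_diam_le. Qed.

Lemma hausdorff1_pre_mono (delta : R) A B : A `<=` B ->
  (hausdorff1_pre delta A <= hausdorff1_pre delta B)%E.
Proof.
move=> AB; apply: le_ereal_inf => _ [C [BC Cd] <-]; exists C => //.
by split => //; exact: subset_trans BC.
Qed.

Lemma hausdorff1_pre_le (d1 d2 : R) A : d1 <= d2 ->
  (hausdorff1_pre d2 A <= hausdorff1_pre d1 A)%E.
Proof.
move=> d12; apply: le_ereal_inf => _ [C [BC Cd] <-]; exists C => //.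
by split => // k; apply: le_trans (Cd k) _; rewrite lee_fin.
Qed.

Lemma hausdorff1_mono A B : A `<=` B -> (hausdorff1 A <= hausdorff1 B)%E.
Proof.
move=> AB; apply: ge_ereal_sup => _ [d d0 <-].
apply: le_trans (hausdorff1_pre_mono d AB) _.
by apply: ereal_sup_ubound; exists d.
Qed.

Let pre_separated A B (d : R) :
  (forall x y, A x -> B y -> d < eucl_dist x y) ->
  (hausdorff1_pre d A + hausdorff1_pre d B <= hausdorff1_pre d (A `|` B))%E.
Proof.
move=> AB; apply: le_ereal_inf_tmp => _ [C [BC Cd] <-].
have split_le k : (eucl_diam (C k `&` A) + eucl_diam (C k `&` B) <= eucl_diam (C k))%E.
  have [[x [Cx Ax]]|nA] := pselect (exists x, (C k `&` A) x).
    have -> : C k `&` B = set0.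
      apply/seteqP; split => // y [Cy By].
      have := le_trans (dist_le_eucl_diam Cx Cy) (Cd k).
      by rewrite lee_fin leNgt (AB _ _ Ax By).
    by rewrite eucl_diam_set0 adde0; apply: eucl_diam_mono => y [].
  have -> : C k `&` A = set0 by apply/seteqP; split => // y Cy; apply: nA; exists y.
  by rewrite eucl_diam_set0 add0e; apply: eucl_diam_mono => y [].
apply: (@le_trans _ _ (\sum_(k <oo) eucl_diam (C k `&` A) +
    \sum_(k <oo) eucl_diam (C k `&` B))%E).
  apply: leeD; apply: ereal_inf_lbound.
    exists (fun k => C k `&` A) => //; split.
      by move=> x Ax; have [k _ Ck] := BC _ (or_introl Ax); exists k.
    by move=> k; apply: le_trans (Cd k); apply: eucl_diam_mono => y [].
  exists (fun k => C k `&` B) => //; split.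
    by move=> x Ax; have [k _ Ck] := BC _ (or_intror Ax); exists k.
  by move=> k; apply: le_trans (Cd k); apply: eucl_diam_mono => y [].
rewrite -nneseriesD; try by move=> *; exact: eucl_diam_ge0.
by apply: lee_nneseries => k *; [rewrite adde_ge0// eucl_diam_ge0|exact: split_le].
Qed.

(** A set of diameter less than the distance of [A] and [B] meets only one of them,
    so fine covers of the union split into covers of the parts. *)
Lemma hausdorff1_separated A B (d : R) : 0 < d ->
  (forall x y, A x -> B y -> d <= eucl_dist x y) ->
  (hausdorff1 A + hausdorff1 B <= hausdorff1 (A `|` B))%E.
Proof.
move=> d0 AB.
have [->|AoB] := eqVneq (hausdorff1 (A `|` B)) +oo%E; first exact: leey.
have ABoo : (hausdorff1 (A `|` B) < +oo)%E by rewrite ltey.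
have Af : hausdorff1 A \is a fin_num.
  rewrite ge0_fin_numE ?hausdorff1_ge0//; apply: le_lt_trans ABoo.
  by apply: hausdorff1_mono => x; left.
rewrite -leeBrDl//; apply: ge_ereal_sup => _ [d1 /= d10 <-].
rewrite leeBrDl// addeC.
have f1 : hausdorff1_pre d1 B \is a fin_num.
  rewrite ge0_fin_numE ?hausdorff1_pre_ge0//; apply: le_lt_trans ABoo.
  apply: le_trans (@hausdorff1_mono B (A `|` B) _); last by move=> x; right.
  by apply: ereal_sup_ubound; exists d1.
rewrite -leeBrDl//; apply: ge_ereal_sup => _ [d2 /= d20 <-].
rewrite leeBrDl// addeC.
pose m := Num.min (Num.min d1 d2) (d / 2).
have m0 : 0 < m by rewrite !lt_min d10 d20 divr_gt0.
have m1 : m <= d1 by rewrite /m !ge_min lexx.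
have m2 : m <= d2 by rewrite /m !ge_min lexx orbT.
have md : m < d.
  by apply: (@le_lt_trans _ _ (d / 2)); [rewrite /m !ge_min lexx !orbT|move: d0; lra].
apply: le_trans (leeD (hausdorff1_pre_le A m2) (hausdorff1_pre_le B m1)) _.
apply: (@le_trans _ _ (hausdorff1_pre m (A `|` B))).
  by apply: pre_separated => x y Ax By; apply: lt_le_trans md (AB _ _ Ax By).
by apply: ereal_sup_ubound; exists m.
Qed.

(** Cover the [n]-th set with total diameter [e / 2 ^ n.+1] and enumerate all pieces. *)
Lemma hausdorff1_null_bigcup (F : nat -> set (R * R)) :
  (forall n, hausdorff1 (F n) = 0%E) -> hausdorff1 (\bigcup_n F n) = 0%E.
Proof.
move=> F0; apply/eqP; rewrite eq_le hausdorff1_ge0 andbT.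
apply: ge_ereal_sup => _ [delta /= delta0 <-].
apply/lee_addgt0Pr => e e0; rewrite add0e.
have /choice[G PG] : forall n, exists C : nat -> set (R * R),
    [/\ F n `<=` \bigcup_k C k, (forall k, (eucl_diam (C k) <= delta%:E)%E) &
    (\sum_(k <oo) eucl_diam (C k) <= (e / (2 ^ n.+1)%:R)%:E)%E].
  move=> n; have h : (hausdorff1_pre delta (F n) < (e / (2 ^ n.+1)%:R)%:E)%E.
    apply: (@le_lt_trans _ _ (hausdorff1 (F n))).
      by apply: ereal_sup_ubound; exists delta.
    by rewrite F0 lte_fin divr_gt0// ltr0n expn_gt0.
  by move/ereal_inf_lt : h => [_ [C [FC Cd] <-] /ltW Cs]; exists C.
apply: (@le_trans _ _ (\esum_(i in [set: nat * nat]) eucl_diam (G i.1 i.2))%E).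
  apply: ereal_inf_lbound => /=.
  have /card_esym/ppcard_eqP[f] := card_nat2.
  exists (fun k => G (f k).1 (f k).2).
    split.
      move=> t [i _ Ft]; have [FG _ _] := PG i; have [j _ Gt] := FG _ Ft.
      exists (f^-1%FUN (i, j)) => //=.
      by rewrite invK ?inE.
    by move=> k; have [_ + _] := PG (f k).1; exact.
  rewrite -(esum_pred_image (fun i : nat * nat => eucl_diam (G i.1 i.2)) _ xpredT) ?[fun=> _]set_true//.
    by rewrite image_eq.
  by move=> k _; exact: eucl_diam_ge0.
rewrite (_ : esum _ _ = \esum_(i in setT) \esum_(j in setT) eucl_diam (G i j))%E; last first.
  rewrite esum_esum; last by move=> *; exact: eucl_diam_ge0.
  congr (esum _ _); apply/seteqP; split => //.
apply: le_trans (epsilon_trick0 xpredT (ltW e0)).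
rewrite -[X in esum X _](_ : [set i | xpredT i] = setT); last by apply/seteqP; split.
rewrite -nneseries_esum; last by move=> *; apply: esum_ge0 => *; exact: eucl_diam_ge0.
apply: lee_nneseries => n _; first by move=> *; apply: esum_ge0 => *; exact: eucl_diam_ge0.
rewrite -[X in esum X _](_ : [set i | xpredT i] = setT); last by apply/seteqP; split.
rewrite -nneseries_esum; last by move=> *; exact: eucl_diam_ge0.
by have [_ _ ] := PG n.
Qed.
End hausdorff_sums.

(** * Convexity of minimizers, and their support function *)

Section convexity.
Context {R : realType}.
Local Notation leb := (@leb R).
Implicit Types (x y z : R * R) (G F : set (R * R)).

Lemma dir_pi (t : R) : dir (t + pi) = sc (-1) (dir t).
Proof. by rewrite /dir /sc /= cosDpi sinDpi !mulN1r. Qed.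

Lemma polar_half x : exists t a, [/\ 0 <= t < pi, `|a| = nrm x & x = sc a (dir t)].
Proof.
have [t tp e] := polar x; move: tp; rewrite ler_norml => /andP[t1 t2].
have pp := @pi_gt0 R; have n0 := nrm_ge0 x.
have [t0|t0] := ltP t 0.
  exists (t + pi), (- nrm x); split; [by apply/andP; split; lra|by rewrite normrN ger0_norm|].
  by rewrite {1}e dir_pi /sc /=; congr (_, _); ring.
have [tp|tp] := ltP t pi.
  by exists t, (nrm x); split; [apply/andP|rewrite ger0_norm|].
have te : t = 0 + pi by lra.
exists 0, (- nrm x); split; [by rewrite lexx|by rewrite normrN ger0_norm|].
by rewrite {1}e te dir_pi /sc /=; congr (_, _); ring.
Qed.

Lemma eucl_dist_shift x y (u v : R * R) (a : R) :
  eucl_dist (x + sc a u) (y + sc a v) <= eucl_dist x y + `|a| * eucl_dist u v.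
Proof.
rewrite !eucl_distE -nrm_scale.
have -> : x + sc a u - (y + sc a v) = (x - y) + (a * (u - v).1, a * (u - v).2).
  by rewrite /sc; congr (_, _) => /=; ring.
exact: nrmD.
Qed.

(** Meeting [G], then [F], then [G] again is stable under small motions of the line. *)
Lemma notch_ge G F (D r a b t0 w : R) z : open G -> open F -> 0 <= D ->
  (forall x, G x -> nrm x <= D) -> 0 < r -> 0 < a -> 0 < b ->
  (forall y, eucl_dist (z + sc (- a) (dir t0)) y < 2 * r -> G y) ->
  (forall y, eucl_dist (z + sc b (dir t0)) y < 2 * r -> G y) ->
  (forall y, eucl_dist z y < 2 * r -> F y) ->
  a * w <= r / 2 -> b * w <= r / 2 ->
  forall t, `|t - t0| <= w -> r <= fine (leb (notch (dir t) G F)).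
Proof.
move=> oG oF D0 GD r0 a0 b0 Ga Gb Fz aw bw t tw.
rewrite -lee_fin -(notchE oG oF D0 GD).
apply: (@le_trans _ _ (leb `[coord (dir t) z - r / 2, coord (dir t) z + r / 2]%classic)).
  by rewrite leb_itv ?lee_fin; lra.
apply: le_measure; rewrite ?inE//.
  by apply: open_measurable; apply: open_notch => //; exact: dir1.
move=> s /=; rewrite in_itv /= => /andP[s1 s2].
set tau := dotp z (dir t).
have zl : eucl_dist z (line (dir t) s tau) <= r / 2.
  rewrite -{1}(line_coord z (dir1 t)) eucl_dist_line ?dir1// ler_norml.
  by apply/andP; split; lra.
have dt : eucl_dist (dir t0) (dir t) <= w.
  by apply: le_trans tw; rewrite distrC; exact: eucl_dist_dir.
exists (tau + - a), tau, (tau + b); split; [lra|lra| | |].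
- rewrite -line_sc; apply: Ga; apply: le_lt_trans (eucl_dist_shift _ _ _ _ _) _.
  rewrite normrN (gtr0_norm a0).
  by have := ler_wpM2l (ltW a0) dt; lra.
- by apply: Fz; lra.
- rewrite -line_sc; apply: Gb; apply: le_lt_trans (eucl_dist_shift _ _ _ _ _) _.
  rewrite (gtr0_norm b0).
  by have := ler_wpM2l (ltW b0) dt; lra.
Qed.

Section minimal_energy.
Variables (lambda : R) (Omega : set (R * R)).
Let G : set (R * R) := interior Omega.
Hypotheses (l0 : 0 < lambda) (adm : admissible Omega).
Hypothesis EE : (energyQ lambda Omega <= (2 * pi * Num.sqrt lambda)%:E)%E.

Let segment_in_oriented x y (u a t0 : R) : 0 <= t0 < pi -> 0 < a -> 0 < u < 1 ->
  G x -> G y -> y = x + sc a (dir t0) -> Omega (x + sc (u * a) (dir t0)).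
Proof.
move=> t0pi a0 /andP[u0 u1] Gx Gy yE; apply: contrapT => nO.
have [cO _ _] := adm; have cl : closed Omega by exact: compact_closed.
have oF := closed_openC cl; have oG : open G by exact: open_interior.
have [D D0 OD] := compact_bounded_plane cO.
have GD z : G z -> nrm z <= D by move=> /interior_subset/OD.
set z := x + _ in nO.
have [r1 r10 h1] := (open_euclP _).1 oG x Gx.
have [r2 r20 h2] := (open_euclP _).1 oG y Gy.
have [r3 r30 h3] := (open_euclP _).1 oF z nO.
pose r := Num.min (Num.min r1 r2) r3 / 2.
have r0 : 0 < r by rewrite divr_gt0// !lt_min r10 r20.
have rE : 2 * r = Num.min (Num.min r1 r2) r3 by rewrite /r; field.
have l1 : 2 * r <= r1 by rewrite rE !ge_min lexx.
have l2 : 2 * r <= r2 by rewrite rE !ge_min lexx orbT.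
have l3 : 2 * r <= r3 by rewrite rE !ge_min lexx orbT.
(* A line that turns by [w] moves by at most [a * w = r / 2] over the length [a]. *)
pose w := r / (2 * a); have w0 : 0 < w by rewrite divr_gt0// mulr_gt0.
have aw : a * w = r / 2 by rewrite /w; field; rewrite gt_eqF.
have ua0 : 0 < u * a by rewrite mulr_gt0.
have va0 : 0 < (1 - u) * a by rewrite mulr_gt0// subr_gt0.
have zx : z + sc (- (u * a)) (dir t0) = x.
  by rewrite /z /sc; case: (x) => ? ?; congr (_, _) => /=; ring.
have zy : z + sc ((1 - u) * a) (dir t0) = y.
  by rewrite yE /z /sc; case: (x) => ? ?; congr (_, _) => /=; ring.
have N1 := @notch_ge G (~` Omega) D r (u * a) ((1 - u) * a) t0 w z oG oF (ltW D0) GD r0 ua0 va0.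
rewrite zx zy -!mulrA aw in N1.
have {}N1 : forall t, `|t - t0| <= w -> r <= fine (leb (notch (dir t) G (~` Omega))).
  apply: N1.
  - by move=> p px; apply: h1; exact: lt_le_trans px l1.
  - by move=> p px; apply: h2; exact: lt_le_trans px l2.
  - by move=> p px; apply: h3; exact: lt_le_trans px l3.
  - by move: u1 r0; nra.
  - by move: u0 r0; nra.
have [kap kap0 [n1 avg]] := average_near t0pi w0.
have kr0 : 0 < kap * r / 2 by rewrite divr_gt0// mulr_gt0.
have [n2 ex] := energyQ_excess l0 adm EE kr0.
pose n := maxn n1 n2.
have {}avg := avg n _ (fun t => fine (leb (notch (dir t) G (~` Omega)))) r (leq_maxl _ _) erefl
  (ltW r0) (fun k => fine_ge0 (measure_ge0 _ _)) N1.
have {}ex := ex n _ (leq_maxr _ _) erefl.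
move: ex; rewrite lerD2l; apply/negP; rewrite -ltNge.
apply: lt_le_trans (le_trans avg _); first by rewrite ltr_pdivrMr//; move: kr0; lra.
rewrite ler_wpM2l ?divr_ge0 ?pi_ge0//; apply: ler_sum => k _.
by rewrite lerDr divr_ge0 ?sqr_ge0// /width fine_ge0.
Qed.

(** Otherwise a point of the complement would lie between two points of the interior, and
    the notches would make the energy exceed the minimum. *)
Lemma segment_in x y (u : R) : 0 <= u <= 1 -> G x -> G y -> Omega (x + sc u (y - x)).
Proof.
move=> /andP[u0 u1] Gx Gy.
have [ue|un0] := eqVneq u 0.
  have -> : x + sc u (y - x) = x.
    by rewrite ue /sc !mul0r; case: (x) => ? ?; congr (_, _); rewrite /= addr0.
  exact: interior_subset.
have [ue|un1] := eqVneq u 1.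
  have -> : x + sc u (y - x) = y.
    by rewrite ue /sc; case: (x) (y) => ? ? [? ?]; congr (_, _) => /=; ring.
  exact: interior_subset.
have u01 : 0 < u < 1 by rewrite !lt_neqAle u0 u1 un1 eq_sym un0.
have [t0 [a [t0pi _ ya]]] := polar_half (y - x).
have yE : y = x + sc a (dir t0) by rewrite -ya addrC subrK.
have zE : x + sc u (y - x) = x + sc (u * a) (dir t0).
  by rewrite ya /sc /=; congr (_, _); rewrite /= mulrA.
rewrite zE; have [a0|a0|a0] := ltgtP a 0.
- have -> : x + sc (u * a) (dir t0) = y + sc ((1 - u) * - a) (dir t0).
    by rewrite yE /sc; case: (x) => ? ?; congr (_, _) => /=; ring.
  apply: (@segment_in_oriented y x) => //; first by rewrite oppr_gt0.
    by move: u01 => /andP[? ?]; apply/andP; split; lra.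
  by rewrite yE /sc; case: (x) => ? ?; congr (_, _) => /=; ring.
- exact: (@segment_in_oriented x y).
- rewrite a0 mulr0 /sc !mul0r (_ : x + _ = x); first exact: interior_subset.
  by case: (x) => ? ?; congr (_, _); rewrite /= addr0.
Qed.

(** Translating the segment covers a neighbourhood of each of its points. *)
Lemma interior_convex x y (u : R) : 0 <= u <= 1 -> G x -> G y -> G (x + sc u (y - x)).
Proof.
move=> u01 Gx Gy; have oG : open G by exact: open_interior.
have [r1 r10 h1] := (open_euclP _).1 oG x Gx.
have [r2 r20 h2] := (open_euclP _).1 oG y Gy.
rewrite /G /interior; apply/nbhs_eucl; exists (Num.min r1 r2); first by rewrite lt_min r10.
move=> p; rewrite lt_min => /andP[p1 p2].
set z := x + _ in p1 p2 *; pose v := p - z.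
have nv : nrm v = eucl_dist z p by rewrite eucl_distC eucl_distE.
have -> : p = (x + v) + sc u ((y + v) - (x + v)).
  rewrite /v /z /sc; case: (x) (y) (p) => ? ? [? ?] [? ?]; congr (_, _) => /=; ring.
apply: segment_in => //.
  by apply: h1; rewrite eucl_distC eucl_distE addrC addKr nv.
by apply: h2; rewrite eucl_distC eucl_distE addrC addKr nv.
Qed.
End minimal_energy.
End convexity.

Section support_function.
Context {R : realType}.
Local Notation leb := (@leb R).
Implicit Types (x y z : R * R) (t s : R).

Lemma coord_pi t x : coord (dir (t + pi)) x = - coord (dir t) x.
Proof. by rewrite dir_pi /coord /sc /=; ring. Qed.

Lemma coord_dir_lip t s x : `|coord (dir t) x - coord (dir s) x| <= `|t - s| * nrm x.
Proof.
have -> : coord (dir t) x - coord (dir s) x = dotp (dir t - dir s) (x.2, - x.1).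
  by rewrite /coord /dotp /=; ring.
apply: le_trans (dotp_abs_le _ _) _.
have -> : nrm (x.2, - x.1) = nrm x by rewrite /nrm /dotp /=; congr Num.sqrt; ring.
by rewrite ler_wpM2r ?nrm_ge0// -eucl_distE eucl_dist_dir.
Qed.

(** The support function of [G] at the normal of the direction [dir t]. *)
Definition hgt (G : set (R * R)) t : R := sup [set coord (dir t) x | x in G].

Variables (G : set (R * R)) (D : R).
Hypotheses (D0 : 0 <= D) (GD : forall x, G x -> nrm x <= D) (G0 : G !=set0).

Let hs t : has_sup [set coord (dir t) x | x in G].
Proof.
split; first by have [x Gx] := G0; exists (coord (dir t) x), x.
exists D => _ [x Gx <-]; apply: le_trans (ler_norm _) _.
exact: le_trans (coord_le _ (dir1 t)) (GD Gx).
Qed.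

Lemma hgt_ge t x : G x -> coord (dir t) x <= hgt G t.
Proof. by move=> Gx; apply: ub_le_sup; [exact: (hs t).2|exists x]. Qed.

Lemma hgt_le t b : (forall x, G x -> coord (dir t) x <= b) -> hgt G t <= b.
Proof. by move=> Gb; apply: ge_sup; [exact: (hs t).1|move=> _ [x Gx <-]; exact: Gb]. Qed.

Lemma hgt_adherent t e : 0 < e -> exists2 x, G x & hgt G t - e < coord (dir t) x.
Proof. by move=> e0; have [_ [x Gx <-] ?] := sup_adherent e0 (hs t); exists x. Qed.

Lemma hgt_lip t s : `|hgt G t - hgt G s| <= D * `|t - s|.
Proof.
suff h u v : hgt G u <= hgt G v + D * `|u - v|.
  by have := h t s; have := h s t; rewrite (distrC s t) ler_norml => ? ?; apply/andP; split; lra.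
apply: hgt_le => x Gx; have := hgt_ge v Gx; have := coord_dir_lip u v x.
have : `|u - v| * nrm x <= D * `|u - v| by rewrite mulrC ler_wpM2r// GD.
by have := ler_norm (coord (dir u) x - coord (dir v) x); lra.
Qed.

Lemma hgt_norm_le t : `|hgt G t| <= D.
Proof.
rewrite ler_norml; apply/andP; split.
  have [x Gx] := G0; have := hgt_ge t Gx; have := coord_le x (dir1 t).
  by have := GD Gx; rewrite ler_norml => ? /andP[]; lra.
apply: hgt_le => x Gx; apply: le_trans (ler_norm _) _.
exact: le_trans (coord_le _ (dir1 t)) (GD Gx).
Qed.

Lemma shadow_hgt t s : shadow (dir t) G s -> - hgt G (t + pi) <= s <= hgt G t.
Proof.
move=> [u Gu]; have e := coord_line s u (dir1 t).
have := hgt_ge t Gu; have := hgt_ge (t + pi) Gu; rewrite coord_pi e => ? ?.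
by apply/andP; split; lra.
Qed.

(** The shadow of a convex set is an interval. *)
Lemma width_hgt t : open G ->
  (forall x y (u : R), 0 <= u <= 1 -> G x -> G y -> G (x + sc u (y - x))) ->
  width G t = hgt G t + hgt G (t + pi).
Proof.
move=> oG cG; apply/eqP; rewrite eq_le; apply/andP; split.
  have [x Gx] := G0; have le0 : - hgt G (t + pi) <= hgt G t.
    by have /andP[] := shadow_hgt (shadow_coord (dir1 t) Gx); exact: le_trans.
  rewrite -lee_fin -(widthE oG D0 GD).
  apply: (@le_trans _ _ (leb `[- hgt G (t + pi), hgt G t]%classic)).
    apply: le_measure; rewrite ?inE//.
      by apply: open_measurable; apply: open_shadow => //; exact: dir1.
    by move=> s /shadow_hgt; rewrite /= in_itv.
  by rewrite leb_itv// lee_fin; lra.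
apply/ler_addgt0Pr => e e0; have e20 : 0 < e / 2 by rewrite divr_gt0.
have [x Gx hx] := hgt_adherent t e20.
have [y Gy] := hgt_adherent (t + pi) e20; rewrite coord_pi => hy.
have w0 := width_ge0 G t.
have [lt|le] := ltP (coord (dir t) x) (coord (dir t) y); first by lra.
suff : coord (dir t) x - coord (dir t) y <= width G t by lra.
rewrite -lee_fin -(widthE oG D0 GD) -(leb_itv true false le).
apply: le_measure; rewrite ?inE//.
  by apply: open_measurable; apply: open_shadow => //; exact: dir1.
move=> s /=; rewrite in_itv /= => /andP[s1 s2].
have [e1|ne] := eqVneq (coord (dir t) x) (coord (dir t) y).
  by have -> : s = coord (dir t) x; [lra|exact: shadow_coord (dir1 t) Gx].
have dlt : 0 < coord (dir t) x - coord (dir t) y by rewrite subr_gt0 lt_neqAle eq_sym ne.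
pose u := (s - coord (dir t) y) / (coord (dir t) x - coord (dir t) y).
have -> : s = coord (dir t) (y + sc u (x - y)).
  transitivity (coord (dir t) y + u * (coord (dir t) x - coord (dir t) y)).
    by rewrite /u divfK ?gt_eqF// addrC subrK.
  by rewrite /coord /sc /=; ring.
apply: shadow_coord (dir1 t) _; apply: cG => //.
rewrite /u divr_ge0 ?subr_ge0// ?ler_pdivrMr// ?mul1r ?lerD2r//; lra.
Qed.
End support_function.

(** * Tilted competitors: constant width and a common center *)

Section tilted.
Context {R : realType}.
Local Notation leb := (@leb R).
Implicit Types (x y : R * R) (t s : R).

Let telescope_sum (g f : R -> R) (h : R) (N : nat) : h != 0 ->
  (forall k : nat, h * f k%:R = g k.+1%:R - g k%:R) -> g N%:R = g 0 ->
  \sum_(k < N) f k%:R = 0.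
Proof.
move=> h0 fg gN; apply: (mulfI h0); rewrite mulr0 mulr_sumr.
rewrite -(big_mkord xpredT (fun k => h * f k%:R)) (eq_bigr (fun k => g k.+1%:R - g k%:R)) //.
by rewrite (telescope_sumr (fun k : nat => g k%:R))// gN subrr.
Qed.

Lemma sum_double_angle (N : nat) : (1 < N)%N ->
  \sum_(k < N) cos (2 * (k%:R * (pi / N%:R))) = 0 :> R /\
  \sum_(k < N) sin (2 * (k%:R * (pi / N%:R))) = 0 :> R.
Proof.
move=> N1; have pp := @pi_gt0 R; have N0 : 0 < N%:R :> R by rewrite ltr0n (ltn_trans _ N1).
pose d : R := pi / N%:R.
have d0 : 0 < d by rewrite divr_gt0.
have dpi : d < pi by rewrite /d ltr_pdivrMr// -[ltLHS]mulr1 ltr_pM2l// ltr1n.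
have sd : 2 * sin d != 0 :> R by rewrite mulf_neq0// gt_eqF// sin_gt0_pi// d0.
have eN : (2 * N%:R - 1) * d = 2 * pi - d.
  by rewrite /d; move: (@pi R) => P; field; rewrite gt_eqF.
split.
  apply: (telescope_sum (f := fun u => cos (2 * (u * d))) (g := fun u => sin ((2 * u - 1) * d)) sd).
    move=> k; have -> : (2 * k.+1%:R - 1) * d = 2 * (k%:R * d) + d by rewrite -natr1; ring.
    have -> : (2 * k%:R - 1) * d = 2 * (k%:R * d) - d by ring.
    by rewrite sinD sinB; ring.
  rewrite eN mulr0 sub0r mulN1r addrC mulr_natl sinD2pi//.
apply: (telescope_sum (f := fun u => sin (2 * (u * d))) (g := fun u => - cos ((2 * u - 1) * d)) sd).
  move=> k; have -> : (2 * k.+1%:R - 1) * d = 2 * (k%:R * d) + d by rewrite -natr1; ring.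
  have -> : (2 * k%:R - 1) * d = 2 * (k%:R * d) - d by ring.
  by rewrite cosD cosB; ring.
by rewrite eN mulr0 sub0r mulN1r addrC mulr_natl cosD2pi.
Qed.

(** The normals of the directions form a tight frame. *)
Lemma sum_coordM (N : nat) x y : (1 < N)%N ->
  \sum_(k < N) coord (dirs N k) x * coord (dirs N k) y = N%:R / 2 * dotp x y.
Proof.
move=> N1; have [c0 s0] := sum_double_angle N1.
pose th (k : nat) : R := 2 * (k%:R * (pi / N%:R)).
have e (k : 'I_N) : coord (dirs N k) x * coord (dirs N k) y =
    dotp x y / 2 + (x.2 * y.2 - x.1 * y.1) / 2 * cos (th k) -
    (x.1 * y.2 + x.2 * y.1) / 2 * sin (th k).
  rewrite /th (mulrDl 1 1) mul1r cosD sinD /coord /dirs /dir /=.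
  have := @cos2Dsin2 R (k%:R * (pi / N%:R)); move: (cos _) (sin _) => a b ab.
  have -> : dotp x y / 2 = (a ^+ 2 + b ^+ 2) * (dotp x y / 2) by rewrite ab mul1r.
  by rewrite /dotp; field.
rewrite (eq_bigr _ (fun k _ => e k)) sumrB big_split /= -!mulr_sumr c0 s0 !mulr0 subr0 addr0.
by rewrite sumr_const card_ord -mulr_natl; ring.
Qed.

(** The least-squares approximation of the offsets [m k] by the coordinates of a point. *)
Definition center (N : nat) (m : nat -> R) : R * R :=
  (2 / N%:R * \sum_(k < N) m k * - sin (k%:R * (pi / N%:R)),
   2 / N%:R * \sum_(k < N) m k * cos (k%:R * (pi / N%:R))).

Lemma center_normal (N : nat) (m : nat -> R) x : (1 < N)%N ->
  \sum_(k < N) (m k - coord (dirs N k) (center N m)) * coord (dirs N k) x = 0.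
Proof.
move=> N1; have N0 : 0 < N%:R :> R by rewrite ltr0n (ltn_trans _ N1).
under eq_bigr do rewrite mulrBl.
rewrite sumrB sum_coordM// /dotp /= /coord /dirs /dir /=.
under eq_bigr do rewrite mulrBr.
rewrite sumrB.
set S1 := \sum_(k < N) m k * - _; set S2 := \sum_(k < N) m k * cos _.
have -> : \sum_(k < N) m k * (cos (k%:R * (pi / N%:R)) * x.2) = S2 * x.2.
  by rewrite mulr_suml; apply: eq_bigr => k _; rewrite mulrA.
have -> : \sum_(k < N) m k * (sin (k%:R * (pi / N%:R)) * x.1) = - S1 * x.1.
  by rewrite -sumrN mulr_suml; apply: eq_bigr => k _; rewrite mulrN opprK mulrA.
by field; rewrite gt_eqF.
Qed.

Lemma center_le (N : nat) (m : nat -> R) (D : R) : (0 < N)%N -> (forall k, `|m k| <= D) ->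
  `|(center N m).1| <= 2 * D /\ `|(center N m).2| <= 2 * D.
Proof.
move=> N0 mD; have NR0 : 0 < N%:R :> R by rewrite ltr0n.
have h (f : nat -> R) : (forall k, `|f k| <= 1) ->
    `|2 / N%:R * \sum_(k < N) m k * f k| <= 2 * D.
  move=> f1; rewrite normrM ger0_norm ?divr_ge0//.
  apply: (@le_trans _ _ (2 / N%:R * \sum_(k < N) D)).
    rewrite ler_wpM2l ?divr_ge0//; apply: le_trans (ler_norm_sum _ _ _) _.
    by apply: ler_sum => k _; rewrite normrM -[leRHS]mulr1 ler_pM.
  by rewrite sumr_const card_ord -mulr_natl le_eqVlt; apply/orP; left; apply/eqP; field; rewrite gt_eqF.
split; [apply: (h (fun k => - sin (k%:R * (pi / N%:R))))|
  apply: (h (fun k => cos (k%:R * (pi / N%:R))))] => k; first by rewrite normrN ler_norml sin_geN1 sin_le1.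
by rewrite ler_norml cos_geN1 cos_le1.
Qed.

Let sqr_le_norm (a b : R) : 0 <= a -> a <= `|b| -> a ^+ 2 <= b ^+ 2.
Proof. by move=> a0 ab; rewrite -[leRHS](real_normK (num_real b)) lerXn2r ?nnegrE. Qed.

Lemma coord_dir_le t x (b : R) : `|x.1| <= b -> `|x.2| <= b -> `|coord (dir t) x| <= 2 * b.
Proof.
move=> x1 x2; apply: le_trans (coord_le _ (dir1 t)) _; apply: le_trans (nrm_le_add x) _; lra.
Qed.

Let continuous_affine_sqr (al a : R) : continuous (fun s => (al + a * s) ^+ 2).
Proof.
have h : continuous (fun s => al + a * s).
  move=> s; apply: continuousD; first exact: cst_continuous.
  exact: mulrl_continuous.
by move=> s; exact: (continuousM (h s) (h s)).
Qed.

Lemma integral_affine_sqr (al a lo hi : R) : lo < hi ->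
  (\int[leb]_(s in `[lo, hi]) ((al + a * s) ^+ 2)%:E =
  (al ^+ 2 * (hi - lo) + al * a * (hi ^+ 2 - lo ^+ 2) + a ^+ 2 * (hi ^+ 3 - lo ^+ 3) / 3)%:E)%E.
Proof.
move=> lohi.
pose F s : R := al ^+ 2 * s + al * a * s ^+ 2 + a ^+ 2 / 3 * s ^+ 3.
have dF (s : R) : is_derive s 1 F ((al + a * s) ^+ 2).
  have d1 : is_derive s 1 (@id R) 1 by exact: is_derive_id.
  have h := is_deriveD (is_deriveD (is_deriveZ (al ^+ 2) d1)
    (is_deriveZ (al * a) (is_deriveX 2 d1))) (is_deriveZ (a ^+ 2 / 3) (is_deriveX 3 d1)).
  have e : (al ^+ 2)%:A + (al * a) *: (2 * s ^+ 2.-1)%:A +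
      (a ^+ 2 / 3) *: (3 * s ^+ 3.-1)%:A = (al + a * s) ^+ 2.
    by rewrite /GRing.scale /=; field.
  by rewrite -e; exact: h.
rewrite (FTC_itv lohi _ _ dF); last 2 first.
- exact: continuous_affine_sqr.
- by move=> s; exact: sqr_ge0.
by congr EFin; rewrite /F; field.
Qed.

Section minimal_energy.
Variables (lambda : R) (Omega : set (R * R)).
Let G : set (R * R) := interior Omega.
Hypotheses (l0 : 0 < lambda) (adm : admissible Omega).
Hypothesis EE : (energyQ lambda Omega <= (2 * pi * Num.sqrt lambda)%:E)%E.

(** The middle of the shadow of a convex set. *)
Definition mid (A : set (R * R)) t : R := (hgt A t - hgt A (t + pi)) / 2.

Let interior_facts : exists D r : R, [/\ 0 < D, (forall x, G x -> nrm x <= D), G !=set0,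
  0 < r & forall t, r <= width G t <= 2 * D].
Proof.
have [cO _ _] := adm; have [_ If _ _] := energyQ_fin_num l0 EE.
have oG : open G by exact: open_interior.
have [x0 Gx0] : G !=set0 by apply: interior_nonempty => //; rewrite ltey_eq If.
have [r r0 rG] := (open_euclP _).1 oG x0 Gx0.
have [D D0 OD] := compact_bounded_plane cO.
have GD x : G x -> nrm x <= D by move=> /interior_subset/OD.
exists D, r; split => //; first by exists x0.
move=> t; rewrite (width_le oG (ltW D0) GD) andbT.
exact: (width_ge oG (ltW D0) GD) rG.
Qed.

Let widthG t : width G t = hgt G t + hgt G (t + pi).
Proof.
have [D [r [D0 GD G0 _ _]]] := interior_facts.
apply: (width_hgt (ltW D0) GD G0 t); first exact: open_interior.
by move=> x y u; exact: (interior_convex l0 adm EE).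
Qed.

(** The competitors [1 / width - tau * deviation * s]: the linear gain dominates the
    quadratic loss for small [tau]. *)
Lemma center_deviation (eta : R) : 0 < eta ->
  exists n0 : nat, forall n N : nat, (n0 <= n)%N -> N = (2 ^ n)%N ->
  pi / N%:R * \sum_(k < N) (mid G (k%:R * (pi / N%:R)) -
    coord (dirs N k) (center N (fun j => mid G (j%:R * (pi / N%:R))))) ^+ 2 <= eta.
Proof.
move=> eta0; have [D [r [D0 GD G0 r0 wb]]] := interior_facts.
have midD t : `|mid G t| <= D.
  have := hgt_norm_le GD G0 t; have := hgt_norm_le GD G0 (t + pi).
  by rewrite !ler_norml /mid => /andP[? ?] /andP[? ?]; apply/andP; split; lra.
(* Small enough for the competitors to be nonnegative on the shadows, as
   [tau * (5 * D) * D = (2 * D)^-1 <= (w k)^-1], and for the quadratic loss. *)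
pose tau := (10 * D ^+ 3)^-1.
have D30 : 0 < D ^+ 3 by rewrite exprn_gt0.
have tau0 : 0 < tau by rewrite invr_gt0 mulr_gt0.
have tauD : tau * D ^+ 3 = 10^-1 by rewrite /tau; field; rewrite gt_eqF.
have L0 : 0 <= tau * (5 * D) by rewrite mulr_ge0// ?mulr_ge0// ltW.
have eta10 : 0 < lambda * tau * eta by rewrite !mulr_gt0.
have [n0 h] := energyQ_ge_real (2 / r) l0 adm EE L0 eta10.
exists (maxn n0 1) => n N; rewrite geq_max => /andP[n0n n1] NE.
have N1 : (1 < N)%N by rewrite NE -{1}(expn0 2) ltn_exp2l.
have N0 : (0 < N)%N by exact: ltnW.
pose m k := mid G (k%:R * (pi / N%:R)); pose w k := width G (k%:R * (pi / N%:R)).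
pose c := center N m; pose de k := m k - coord (dirs N k) c.
have deD k : `|de k| <= 5 * D.
  have [c1 c2] := center_le N0 (fun k => midD (k%:R * (pi / N%:R))).
  have := coord_dir_le (k%:R * (pi / N%:R)) c1 c2.
  have := midD (k%:R * (pi / N%:R)); rewrite /de /m -/c -/(dirs N k) !ler_norml.
  by move=> /andP[? ?] /andP[? ?]; apply/andP; split; lra.
have w0 k : 0 < w k by have /andP[+ _] := wb (k%:R * (pi / N%:R)); exact: lt_le_trans.
have wD k : w k <= 2 * D by have /andP[] := wb (k%:R * (pi / N%:R)).
pose C k := w k * m k ^+ 2 + w k ^+ 3 / 12.
have C1 k : tau * C k <= 1.
  have m2 : m k ^+ 2 <= D ^+ 2.
    by rewrite -(real_normK (num_real (m k))) lerXn2r ?nnegrE ?(ltW D0)//; exact: midD.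
  have w3 : w k ^+ 3 <= (2 * D) ^+ 3.
    by rewrite lerXn2r ?nnegrE ?(ltW (w0 k))// mulr_ge0// ltW.
  have wm : w k * m k ^+ 2 <= 2 * D * D ^+ 2 by rewrite ler_pM ?sqr_ge0// ltW.
  have CD : C k <= 3 * D ^+ 3.
    have e1 : (2 * D) ^+ 3 = 8 * D ^+ 3 by ring.
    have e2 : 2 * D * D ^+ 2 = 2 * D ^+ 3 by ring.
    by rewrite /C; move: wm w3; rewrite e1 e2; move: D30; lra.
  apply: le_trans (ler_wpM2l (ltW tau0) CD) _.
  by rewrite mulrCA tauD; lra.
have sum0 x : \sum_(k < N) de k * coord (dirs N k) x = 0 by exact: center_normal.
pose q k := (w k)^-1 + 2 * (- tau * de k) * m k + (- tau * de k) ^+ 2 * C k.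
have low : pi / N%:R * \sum_(k < N) (w k + fine (leb (notch (dirs N k) G (~` Omega))) +
    lambda * (2 * (w k)^-1 - q k)) <= 2 * pi * Num.sqrt lambda + lambda * tau * eta.
  apply: (h n N (fun k => (w k)^-1) (fun k => - tau * de k) q n0n NE).
  - by move=> k; rewrite normrM normrN (gtr0_norm tau0) ler_wpM2l// ltW.
  - move=> k s sk; have sD : `|s| <= D.
      have /andP[] := shadow_hgt GD G0 sk.
      have := hgt_norm_le GD G0 (k%:R * (pi / N%:R)).
      have := hgt_norm_le GD G0 (k%:R * (pi / N%:R) + pi).
      rewrite !ler_norml => /andP[? ?] /andP[? ?] ? ?; apply/andP; split; lra.
    have ts : `|- tau * de k * s| <= (2 * D)^-1.
      rewrite !normrM normrN (gtr0_norm tau0).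
      have -> : (2 * D)^-1 = tau * (5 * D) * D by rewrite /tau; field; rewrite gt_eqF.
      by rewrite -!mulrA ler_wpM2l ?(ltW tau0)//; rewrite mulrA ler_pM.
    have wi : (2 * D)^-1 <= (w k)^-1 by rewrite lef_pV2 ?posrE// mulr_gt0.
    have ri : (w k)^-1 <= r^-1.
      by rewrite lef_pV2 ?posrE//; have /andP[] := wb (k%:R * (pi / N%:R)).
    by move: ts; rewrite ler_norml => /andP[? ?]; apply/andP; split; lra.
  - move=> x; under eq_bigr do rewrite -mulrA.
    by rewrite -mulr_sumr sum0 mulr0.
  - move=> k; pose t : R := k%:R * (pi / N%:R); pose a := - tau * de k.
    rewrite -/a.
    have wE : w k = hgt G t + hgt G (t + pi) by exact: widthG.
    have lohi : - hgt G (t + pi) < hgt G t by have := w0 k; rewrite wE; lra.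
    apply: (@le_trans _ _ (\int[leb]_(s in `[(- hgt G (t + pi))%R, (hgt G t)%R])
        (((w k)^-1 + a * s) ^+ 2)%:E)%E).
      apply: ge0_subset_integral => //.
      - apply: open_measurable; apply: open_shadow; [exact: dir1|exact: open_interior].
      - apply/measurable_EFinP; apply: measurable_funTS; apply: continuous_measurable_fun.
        exact: continuous_affine_sqr.
      - by move=> s _; rewrite lee_fin sqr_ge0.
      - by move=> s /(shadow_hgt GD G0); rewrite /= in_itv.
    rewrite integral_affine_sqr// lee_fin le_eqVlt; apply/orP; left; apply/eqP.
    have := w0 k; rewrite /q -/a /C /m /mid -/t wE => ww.
    by move: (hgt G t) (hgt G (t + pi)) ww => p p' ww; field; rewrite gt_eqF.
(* The deviations are orthogonal to all the coordinate functions. *)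
have sdm : \sum_(k < N) de k ^+ 2 = \sum_(k < N) (de k ^+ 2 + 2 * (de k * coord (dirs N k) c)).
  by rewrite big_split /= -mulr_sumr sum0 mulr0 addr0.
have term k : 2 * Num.sqrt lambda + lambda * tau * (de k ^+ 2 + 2 * (de k * coord (dirs N k) c))
    <= w k + fine (leb (notch (dirs N k) G (~` Omega))) + lambda * (2 * (w k)^-1 - q k).
  have we := width_excess l0 (w0 k).
  have we0 : 0 <= (w k - Num.sqrt lambda) ^+ 2 / w k by rewrite divr_ge0 ?sqr_ge0// ltW.
  have nu0 : 0 <= fine (leb (notch (dirs N k) G (~` Omega))) by rewrite fine_ge0.
  have qe : 2 * (w k)^-1 - q k = (w k)^-1 + tau * (de k ^+ 2 + 2 * (de k * coord (dirs N k) c)) +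
      tau * (de k ^+ 2 * (1 - tau * C k)).
    have -> : coord (dirs N k) c = m k - de k by rewrite /de opprB addrC subrK.
    by rewrite /q; ring.
  have g0 : 0 <= lambda * (tau * (de k ^+ 2 * (1 - tau * C k))).
    apply: mulr_ge0 (ltW l0) (mulr_ge0 (ltW tau0) (mulr_ge0 (sqr_ge0 _) _)).
    by rewrite subr_ge0.
  rewrite qe; set T := _ + 2 * (_ * _) in qe *.
  have distr (a b : R) : lambda * (a + tau * T + b) = lambda * a + lambda * tau * T + lambda * b.
    by ring.
  rewrite distr; apply: (@le_trans _ _ (w k + lambda * (w k)^-1 + lambda * tau * T)).
    by rewrite we lerD2r lerDl.
  by move: nu0 g0; move: (fine _) (lambda * _) => X1 X2; lra.
have P0 : 0 <= pi / N%:R :> R by rewrite divr_ge0 ?pi_ge0.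
have low2 : pi / N%:R * \sum_(k < N) (2 * Num.sqrt lambda +
    lambda * tau * (de k ^+ 2 + 2 * (de k * coord (dirs N k) c))) <=
    2 * pi * Num.sqrt lambda + lambda * tau * eta.
  by apply: le_trans low; rewrite ler_wpM2l//; apply: ler_sum => k _; exact: term.
rewrite big_split /= mulrDr sum_cst_pi// -mulr_sumr -sdm in low2.
have lt0 : 0 < lambda * tau by rewrite mulr_gt0.
rewrite -(ler_pM2l lt0) mulrCA.
by move: low2; rewrite mulrCA; move: (_ * (_ * \sum_(k < N) _)) => X; lra.
Qed.

(** The excess of the energy averages squares of the deviations of the width. The width
    is Lipschitz in the direction, so a single deviation would persist nearby and give a
    positive excess. *)
Lemma width_const t0 : 0 <= t0 < pi -> width G t0 = Num.sqrt lambda.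
Proof.
move=> t0pi; have [D [r [D0 GD G0 r0 wb]]] := interior_facts.
have oG : open G by exact: open_interior.
apply/eqP/negPn/negP => ne; set q := Num.sqrt lambda in ne.
pose e : R := `|width G t0 - q|; have e0 : 0 < e by rewrite normr_gt0 subr_eq0.
pose v := e / (4 * D); have v0 : 0 < v by rewrite divr_gt0// mulr_gt0.
pose f t := (width G t - q) ^+ 2 / width G t.
have f0 t : 0 <= f t by rewrite divr_ge0 ?sqr_ge0// width_ge0.
pose b := (e / 2) ^+ 2 / (2 * D); have b0 : 0 < b.
  by rewrite divr_gt0 ?mulr_gt0// exprn_gt0// divr_gt0.
have fb t : `|t - t0| <= v -> b <= f t.
  move=> tv; have h1 := hgt_lip GD G0 t t0; have h2 := hgt_lip GD G0 (t + pi) (t0 + pi).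
  have ee : t + pi - (t0 + pi) = t - t0 by ring.
  rewrite ee in h2.
  have dv : D * `|t - t0| <= e / 4.
    apply: le_trans (ler_wpM2l (ltW D0) tv) _.
    by rewrite le_eqVlt; apply/orP; left; apply/eqP; rewrite /v; field; rewrite gt_eqF.
  have w2 : `|width G t - width G t0| <= e / 2.
    rewrite !widthG; move: h1 h2; rewrite !ler_norml => /andP[? ?] /andP[? ?].
    by apply/andP; split; lra.
  have wq : e / 2 <= `|width G t - q|.
    have aux (p u s : R) : p <= u + s -> u <= p / 2 -> p / 2 <= s by lra.
    apply: aux w2; rewrite [X in _ <= X + _]distrC; exact: ler_distD.
  have /andP[wr wD] := wb t; have w0 : 0 < width G t by exact: lt_le_trans wr.
  have DD0 : 0 < 2 * D by rewrite mulr_gt0.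
  have wi : (2 * D)^-1 <= (width G t)^-1 by rewrite lef_pV2 ?posrE.
  have sq : (e / 2) ^+ 2 <= (width G t - q) ^+ 2.
    by apply: sqr_le_norm wq; rewrite divr_ge0// ltW.
  apply: (@le_trans _ _ ((width G t - q) ^+ 2 * (2 * D)^-1)).
    by apply: ler_wpM2r sq; rewrite invr_ge0 ltW.
  exact: ler_wpM2l (sqr_ge0 _) _ _ wi.
have [kap kap0 [n1 avg]] := average_near t0pi v0.
have kb0 : 0 < kap * b / 2 by rewrite divr_gt0// mulr_gt0.
have [n2 ex] := energyQ_excess l0 adm EE kb0.
pose n := maxn n1 n2.
have {}avg := avg n _ f b (leq_maxl _ _) erefl (ltW b0) (fun k => f0 _) fb.
have {}ex := ex n _ (leq_maxr _ _) erefl.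
move: ex; rewrite lerD2l; apply/negP; rewrite -ltNge.
apply: lt_le_trans (le_trans avg _); first by rewrite ltr_pdivrMr//; move: kb0; lra.
rewrite ler_wpM2l ?divr_ge0 ?pi_ge0//; apply: ler_sum => k _.
by rewrite lerDl fine_ge0.
Qed.

Let mid_lip D t s : (forall x, G x -> nrm x <= D) -> G !=set0 ->
  `|mid G t - mid G s| <= D * `|t - s|.
Proof.
move=> GD G0; have h1 := hgt_lip GD G0 t s; have h2 := hgt_lip GD G0 (t + pi) (s + pi).
have ee : t + pi - (s + pi) = t - s by ring.
rewrite ee in h2; rewrite /mid; move: h1 h2; rewrite !ler_norml => /andP[? ?] /andP[? ?].
by apply/andP; split; lra.
Qed.

Let mid_near_center t0 e : 0 <= t0 < pi -> 0 < e -> exists n0 : nat, forall n N : nat,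
  (n0 <= n)%N -> N = (2 ^ n)%N ->
  `|mid G t0 - coord (dir t0) (center N (fun j => mid G (j%:R * (pi / N%:R))))| <= e.
Proof.
move=> t0pi e0; have [D [r [D0 GD G0 _ _]]] := interior_facts.
have midD t : `|mid G t| <= D.
  have := hgt_norm_le GD G0 t; have := hgt_norm_le GD G0 (t + pi).
  by rewrite !ler_norml /mid => /andP[? ?] /andP[? ?]; apply/andP; split; lra.
pose v := e / (10 * D); have v0 : 0 < v by rewrite divr_gt0// mulr_gt0.
pose b := (e / 2) ^+ 2; have b0 : 0 < b by rewrite exprn_gt0// divr_gt0.
have [kap kap0 [n1 avg]] := average_near t0pi v0.
have kb0 : 0 < kap * b / 2 by rewrite divr_gt0// mulr_gt0.
have [n2 ex] := center_deviation kb0.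
exists (maxn n1 n2) => n N; rewrite geq_max => /andP[n1n n2n] NE.
have N0 : (0 < N)%N by rewrite NE expn_gt0.
set c := center N _.
have [c1 c2] := center_le N0 (fun k => midD (k%:R * (pi / N%:R))).
have cD : nrm c <= 4 * D by apply: le_trans (nrm_le_add c) _; move: c1 c2; rewrite -/c; lra.
rewrite leNgt; apply/negP => lt.
pose f t := (mid G t - coord (dir t) c) ^+ 2.
have fb t : `|t - t0| <= v -> b <= f t.
  move=> tv; have h1 := mid_lip t t0 GD G0; have h2 := coord_dir_lip t t0 c.
  have h3 : `|t - t0| * nrm c <= `|t - t0| * (4 * D) by rewrite ler_wpM2l.
  have dv : D * `|t - t0| <= e / 10.
    apply: le_trans (ler_wpM2l (ltW D0) tv) _.
    by rewrite le_eqVlt; apply/orP; left; apply/eqP; rewrite /v; field; rewrite gt_eqF.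
  have wq : e / 2 <= `|mid G t - coord (dir t) c|.
    have := ler_distD (mid G t - coord (dir t) c) (mid G t0 - coord (dir t0) c) 0.
    rewrite !subr0.
    have -> : mid G t0 - coord (dir t0) c - (mid G t - coord (dir t) c) =
      (coord (dir t) c - coord (dir t0) c) - (mid G t - mid G t0) by ring.
    have := ler_normB (coord (dir t) c - coord (dir t0) c) (mid G t - mid G t0).
    move: h1 h2 h3 dv lt; rewrite (mulrC _ (4 * D)) -mulrA.
    move: (D * _) (`|_ - _ - _|) (`|mid G t - mid G t0|) (`|coord _ _ - _|) (`|mid G t0 - _|)
      (`|mid G t - _|) (`|t - t0| * nrm c) => x1 x2 x3 x4 x5 x6 x7.
    by lra.
  by apply: sqr_le_norm wq; rewrite divr_ge0// ltW.
have {}avg := avg n N f b n1n NE (ltW b0) (fun k => sqr_ge0 _) fb.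
have {}ex := ex n N n2n NE.
have : kap * b <= kap * b / 2 by exact: le_trans ex.
by move: kb0; lra.
Qed.

(** On each grid the middles are approximated by the coordinates of the point [center];
    evaluation in the directions [0] and [pi / 2] shows that these points converge. *)
Lemma mid_linear t0 : 0 <= t0 < pi ->
  mid G t0 = coord (dir t0) (- mid G (pi / 2), mid G 0).
Proof.
move=> t0pi; have pp := @pi_gt0 R.
apply/eqP; rewrite -subr_eq0 -normr_le0; apply/ler_addgt0Pr => e e0; rewrite add0r.
have e30 : 0 < e / 3 by rewrite divr_gt0.
have h0 : 0 <= (0 : R) < pi by rewrite lexx.
have h1 : 0 <= (pi / 2 : R) < pi by apply/andP; split; lra.
have [n1 a1] := mid_near_center t0pi e30.
have [n2 a2] := mid_near_center h0 e30.
have [n3 a3] := mid_near_center h1 e30.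
pose n := maxn n1 (maxn n2 n3).
have {}a1 := a1 n _ (leq_maxl _ _) erefl.
have {}a2 := a2 n _ (leq_trans (leq_maxl _ _) (leq_maxr _ _)) erefl.
have {}a3 := a3 n _ (leq_trans (leq_maxr _ _) (leq_maxr _ _)) erefl.
move: a1 a2 a3; set c := center _ _.
have -> : coord (dir 0) c = c.2 by rewrite /coord /dir /= cos0 sin0; ring.
have -> : coord (dir (pi / 2)) c = - c.1 by rewrite /coord /dir /= cos_pihalf sin_pihalf; ring.
move=> a1 a2 a3.
have -> : mid G t0 - coord (dir t0) (- mid G (pi / 2), mid G 0) =
    (mid G t0 - coord (dir t0) c) + (- cos t0 * (mid G 0 - c.2) -
     sin t0 * (mid G (pi / 2) - - c.1)) by rewrite /coord /dir /=; ring.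
have b2 : `|- cos t0 * (mid G 0 - c.2)| <= e / 3.
  rewrite normrM normrN -[leRHS]mul1r ler_pM//.
  by rewrite ler_norml cos_geN1 cos_le1.
have b3 : `|sin t0 * (mid G (pi / 2) - - c.1)| <= e / 3.
  rewrite normrM -[leRHS]mul1r ler_pM//.
  by rewrite ler_norml sin_geN1 sin_le1.
apply: le_trans (ler_normD _ _) _; have := ler_normB (- cos t0 * (mid G 0 - c.2))
  (sin t0 * (mid G (pi / 2) - - c.1)).
by move: a1 b2 b3; move: (`|_|) (`|_|) (`|_|) (`|_|) => *; lra.
Qed.

Lemma hgt_interior t : 0 <= t < pi -> let c := (- mid G (pi / 2), mid G 0) in
  hgt G t = coord (dir t) c + 2^-1 * Num.sqrt lambda /\
  hgt G (t + pi) = coord (dir (t + pi)) c + 2^-1 * Num.sqrt lambda.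
Proof.
move=> tpi c; have := width_const tpi; rewrite widthG => w.
have := mid_linear tpi; rewrite -/c {1}/mid coord_pi => m.
by split; lra.
Qed.

End minimal_energy.
End tilted.

(** * The equality case *)

Section equality_case.
Context {R : realType}.
Implicit Types (x y z c : R * R) (t rad : R).

(** The lower bound for the energy of the ball, in which the capacitary part is known, is a
    lower bound for its perimeter. *)
Lemma hausdorff1_circle_ge c rad : 0 < rad ->
  ((2 * pi * rad)%:E <= hausdorff1 (boundary (eucl_closed_ball c rad)))%E.
Proof.
move=> r0; have l0 : 0 < 4 * rad ^+ 2 by rewrite mulr_gt0// exprn_gt0.
have sE : Num.sqrt (4 * rad ^+ 2) = 2 * rad.
  have -> : 4 * rad ^+ 2 = (2 * rad) ^+ 2 by ring.
  by rewrite sqrtr_sqr gtr0_norm// mulr_gt0.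
have h : ((2 * pi * (2 * rad))%:E <= hausdorff1 (boundary (eucl_closed_ball c rad)) +
    (2 * pi * rad)%:E)%E.
  rewrite -sE; apply: le_trans (energyQ_lower l0 (admissible_ball c r0)) _.
  rewrite /energyQ leeD2l//.
  apply: le_trans (lee_wpmul2l (ltW l0 : (0 <= (4 * rad ^+ 2)%:E)%E) (riesz_energy_ball c r0)) _.
  rewrite -EFinM lee_fin le_eqVlt; apply/orP; left; apply/eqP.
  by move: (@pi R) => P; field; rewrite gt_eqF.
have -> : (2 * pi * rad)%:E = ((2 * pi * (2 * rad))%:E - (2 * pi * rad)%:E)%E.
  by rewrite -EFinB; congr EFin; ring.
by rewrite leeBlDr.
Qed.

(** Equality for one parameter in the lower bound for all parameters fixes both terms
    of the energy; comparison with a slightly larger parameter suffices. *)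
Lemma perimeter_le (lambda : R) (Omega : set (R * R)) : 0 < lambda -> admissible Omega ->
  (energyQ lambda Omega <= (2 * pi * Num.sqrt lambda)%:E)%E ->
  (hausdorff1 (boundary Omega) <= (pi * Num.sqrt lambda)%:E)%E.
Proof.
move=> l0 adm EE; have [Hf If I0 HI] := energyQ_fin_num l0 EE.
have q0 : 0 < Num.sqrt lambda by rewrite sqrtr_gt0.
have ql : lambda = Num.sqrt lambda ^+ 2 by rewrite sqr_sqrtr// ltW.
have P0 := @pi_gt0 R.
rewrite -(fineK Hf) lee_fin leNgt; apply/negP.
set H := fine (hausdorff1 _) in HI *; set I := fine (riesz_energy _) in HI I0.
set q := Num.sqrt lambda in q0 ql HI * => lt.
pose d := H - pi * q; have d0 : 0 < d by rewrite subr_gt0.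
(* The lower bound for the parameter [(q * s) ^+ 2] reads
   [0 <= pi * q * (s - 1) ^+ 2 - d * (s ^+ 2 - 1)], which fails for this [s]. *)
pose s := 1 + d / (pi * q).
have pq0 : 0 < pi * q by rewrite mulr_gt0.
have s0 : 0 < s by rewrite addr_gt0// divr_gt0.
have ls0 : 0 < (q * s) ^+ 2 by rewrite exprn_gt0// mulr_gt0.
have := energyQ_lower ls0 adm; rewrite /energyQ -(fineK Hf) -(fineK If) -EFinM -EFinD lee_fin.
rewrite -/H -/I sqrtr_sqr gtr0_norm ?mulr_gt0//.
apply/negP; rewrite -ltNge.
have HIs : H + q ^+ 2 * I <= 2 * pi * q by rewrite -ql.
have i1 : (q * s) ^+ 2 * I <= s ^+ 2 * (2 * pi * q - H).
  have -> : (q * s) ^+ 2 * I = s ^+ 2 * (q ^+ 2 * I) by ring.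
  by rewrite ler_wpM2l ?sqr_ge0//; lra.
apply: le_lt_trans (lerD (lexx H) i1) _.
have -> : 2 * pi * (q * s) = H + s ^+ 2 * (2 * pi * q - H) + (d ^+ 2 / (pi * q) + d ^+ 3 / (pi * q) ^+ 2).
  by rewrite /s /d; move: P0 pq0; move: (@pi R) => P P0 pq0; field; rewrite !gt_eqF.
by rewrite ltrDl addr_gt0// divr_gt0// ?exprn_gt0.
Qed.

Definition normal t : R * R := (- sin t, cos t).

Lemma polar_normal x : exists t a, [/\ 0 <= t < pi, `|a| = nrm x & x = sc a (normal t)].
Proof.
have [t [a [tpi an e]]] := polar_half (x.2, - x.1).
exists t, a; split => //.
  by rewrite an /nrm /dotp /=; congr Num.sqrt; ring.
move: e; case: x {an} => x1 x2 [/= e1 e2].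
by rewrite /sc /=; congr (_, _); rewrite ?e1// -[x1]opprK e2 mulrN.
Qed.

Lemma coord_normal t (a : R) : coord (dir t) (sc a (normal t)) = a.
Proof.
rewrite /coord /sc /dir /=; have := @cos2Dsin2 R t.
move: (cos t) (sin t) => p q pq; transitivity (a * (p ^+ 2 + q ^+ 2)); first ring.
by rewrite pq mulr1.
Qed.

Lemma nrm_normal t (a : R) : dotp (sc a (normal t)) (sc a (normal t)) = a ^+ 2.
Proof.
rewrite /dotp /sc /=; have := @cos2Dsin2 R t.
move: (cos t) (sin t) => p q pq; transitivity (a ^+ 2 * (p ^+ 2 + q ^+ 2)); first ring.
by rewrite pq mulr1.
Qed.

(** Strict convexity of the disc: among the points of norm at most [rad], a nearly
    maximal coordinate nearly determines the point. *)
Lemma nrm_extreme t x (rad s e : R) : 0 < rad -> s ^+ 2 = 1 -> nrm x <= rad ->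
  rad - e <= s * coord (dir t) x ->
  nrm (x - sc (s * rad) (normal t)) ^+ 2 <= 2 * rad * e.
Proof.
move=> r0 s1 xr xe; rewrite sqr_nrm.
have -> : dotp (x - sc (s * rad) (normal t)) (x - sc (s * rad) (normal t)) =
    dotp x x - 2 * rad * (s * coord (dir t) x) +
    dotp (sc (s * rad) (normal t)) (sc (s * rad) (normal t)).
  by rewrite /dotp /coord /sc /dir /normal /=; ring.
rewrite nrm_normal exprMn s1 mul1r -sqr_nrm.
have h1 : nrm x ^+ 2 <= rad ^+ 2 by rewrite lerXn2r ?nnegrE ?nrm_ge0// ltW.
have r20 : 0 <= 2 * rad by rewrite mulr_ge0// ltW.
have h2 := ler_wpM2l r20 xe; rewrite mulrBr in h2.
have h3 : 2 * rad * rad = rad ^+ 2 + rad ^+ 2 by ring.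
by move: h1 h2; rewrite h3; lra.
Qed.

Section minimal_energy.
Variables (lambda : R) (Omega : set (R * R)).
Let G : set (R * R) := interior Omega.
Hypotheses (l0 : 0 < lambda) (adm : admissible Omega).
Hypothesis EE : (energyQ lambda Omega <= (2 * pi * Num.sqrt lambda)%:E)%E.
Let rad : R := 2^-1 * Num.sqrt lambda.
Let c := (- mid G (pi / 2), mid G 0).

Let rad0 : 0 < rad. Proof. by rewrite mulr_gt0// sqrtr_gt0. Qed.

Let bounded : exists D : R, [/\ 0 < D, (forall x, G x -> nrm x <= D) & G !=set0].
Proof.
have [cO _ _] := adm; have [_ If _ _] := energyQ_fin_num l0 EE.
have [D D0 OD] := compact_bounded_plane cO.
exists D; split=> //; first by move=> x /interior_subset/OD.
by apply: interior_nonempty => //; rewrite ltey_eq If.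
Qed.

(** The ball is the intersection of the strips given by its support function. *)
Let interior_in_ball x : G x -> nrm (x - c) <= rad.
Proof.
move=> Gx; have [D [D0 GD G0]] := bounded.
have [t [a [tpi <- xa]]] := polar_normal (x - c).
have [h1 h2] := hgt_interior l0 adm EE tpi.
have := hgt_ge GD G0 t Gx; have := hgt_ge GD G0 (t + pi) Gx; rewrite h1 h2 !coord_pi -/c.
have : coord (dir t) x - coord (dir t) c = a by rewrite -coordB xa coord_normal.
by rewrite ler_norml -/rad => e1 e2 e3; apply/andP; split; lra.
Qed.

Let near_extreme t (s e : R) : 0 <= t < pi -> s = 1 \/ s = -1 -> 0 < e ->
  exists2 x, G x & nrm (x - c - sc (s * rad) (normal t)) < e.
Proof.
move=> tpi s1 e0; have [D [D0 GD G0]] := bounded.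
have [h1 h2] := hgt_interior l0 adm EE tpi; rewrite -/c -/rad in h1 h2.
pose d := e ^+ 2 / (4 * rad); have d0 : 0 < d by rewrite divr_gt0 ?exprn_gt0// mulr_gt0.
have [x Gx xd] : exists2 x, G x & rad - d <= s * coord (dir t) (x - c).
  case: s1 => ->.
    have [x Gx hx] := hgt_adherent GD G0 t d0; exists x => //.
    by rewrite coordB mul1r; move: hx; rewrite h1; lra.
  have [x Gx hx] := hgt_adherent GD G0 (t + pi) d0; exists x => //.
  by rewrite coordB mulN1r; move: hx; rewrite h2 !coord_pi; lra.
exists x => //.
have ss : s ^+ 2 = 1 by case: s1 => ->; rewrite ?expr1n// sqrrN expr1n.
have := nrm_extreme rad0 ss (interior_in_ball Gx) xd.
have -> : 2 * rad * d = e ^+ 2 / 2 by rewrite /d; field; rewrite gt_eqF.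
move=> le; rewrite -(ltr_pXn2r (ltn0Sn 1)) ?nnegrE ?nrm_ge0 ?(ltW e0)//.
apply: le_lt_trans le _; have : 0 < e ^+ 2 by rewrite exprn_gt0.
by lra.
Qed.

(** A point of the ball lies between two points of the circle, which are limits of points
    of the interior; the interior is convex. *)
Let ball_sub : eucl_closed_ball c rad `<=` Omega.
Proof.
move=> p; rewrite /eucl_closed_ball /= eucl_distC eucl_distE => pc; apply: contrapT => nO.
have [cO _ _] := adm; have cl : closed Omega by exact: compact_closed.
have [r r0 rO] := (open_euclP _).1 (closed_openC cl) p nO.
have [t [a [tpi ea pa]]] := polar_normal (p - c).
have [x Gx xr] := near_extreme tpi (or_intror erefl) r0.
have [y Gy yr] := near_extreme tpi (or_introl erefl) r0.
pose u := (a + rad) / (2 * rad).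
have u01 : 0 <= u <= 1.
  have : `|a| <= rad by rewrite ea.
  rewrite ler_norml => /andP[a1 a2]; have r2 : 0 < 2 * rad by rewrite mulr_gt0.
  rewrite /u ler_pdivrMr// mul1r divr_ge0 ?(ltW r2)//=.
    by rewrite mulr_natl mulr2n lerD2r.
  by rewrite -lerBlDr sub0r.
have Gz := interior_convex l0 adm EE u01 Gx Gy.
apply: (rO _ _ (interior_subset Gz)); rewrite eucl_distC eucl_distE.
set x' := x - c - _ in xr; set y' := y - c - _ in yr.
have -> : x + sc u (y - x) - p = sc (1 - u) x' + sc u y'.
  have -> : p = sc a (normal t) + c by rewrite -pa subrK.
  have ua : 2 * u * rad = a + rad by rewrite /u; field; rewrite gt_eqF.
  have -> : a = 2 * u * rad - rad by rewrite ua addrK.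
  by rewrite /x' /y' /sc; congr (_, _) => /=; ring.
move: u01 => /andP[u0 u1].
apply: le_lt_trans (nrmD _ _) _; rewrite !nrm_scale (ger0_norm u0) ger0_norm ?subr_ge0//.
have -> : r = (1 - u) * r + u * r by ring.
have [ue|un] := eqVneq u 0.
  by rewrite ue !subr0 !mul1r !mul0r !addr0.
apply: ler_ltD; first by rewrite ler_wpM2l ?subr_ge0// ltW.
by rewrite ltr_pM2l// lt_neqAle eq_sym un.
Qed.

(** The circle belongs to the boundary and exhausts its length, so nothing is left for the
    part of the boundary at a positive distance from the circle. *)
Let outside_null (n : nat) :
  hausdorff1 (Omega `&` [set x | rad + n.+1%:R^-1 <= eucl_dist c x]) = 0%E.
Proof.
set F := _ `&` _.
have n0 : 0 < n.+1%:R^-1 :> R by rewrite invr_gt0.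
have h1 : (hausdorff1 (boundary (eucl_closed_ball c rad)) + hausdorff1 F <=
    hausdorff1 (boundary (eucl_closed_ball c rad) `|` F))%E.
  apply: hausdorff1_separated n0 _ => x y /boundary_ball_sub cx [_ /= cy].
  by rewrite -(lerD2l rad) (le_trans cy)// -cx; exact: eucl_dist_triangle.
have Gb x : G x -> eucl_dist c x <= rad.
  by move=> Gx; rewrite eucl_distC eucl_distE; exact: interior_in_ball.
have sub : boundary (eucl_closed_ball c rad) `|` F `<=` boundary Omega.
  move=> x [bx|[Ox /= xn]]; split.
  - apply: subset_closure; apply: ball_sub.
    by rewrite /eucl_closed_ball /= (boundary_ball_sub bx).
  - move=> Gx; case: bx => _; apply.
    have sub2 : G `<=` eucl_closed_ball c rad by move=> y; exact: Gb.
    by apply: filterS sub2 _; apply: open_nbhs_nbhs; split => //; exact: open_interior.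
  - exact: subset_closure.
  - by move=> /Gb; apply/negP; rewrite -ltNge; apply: lt_le_trans xn; rewrite ltrDl.
have h2 := le_trans h1 (hausdorff1_mono sub).
have h3 := le_trans h2 (perimeter_le l0 adm EE).
(* The perimeter of a minimizer is at most the length of the circle. *)
have h4 := le_trans (leeD (hausdorff1_circle_ge c rad0) (lexx (hausdorff1 F))) h3.
apply/eqP; rewrite eq_le hausdorff1_ge0 andbT.
have e : 2 * pi * rad = pi * Num.sqrt lambda by rewrite /rad; move: (@pi R) => P; field.
by move: h4; rewrite e; case: (hausdorff1 F) => [f| |]//; rewrite -EFinD !lee_fin; lra.
Qed.

Lemma H1_equiv_ball : H1_equiv Omega (eucl_closed_ball c rad).
Proof.
have null0 : hausdorff1 (set0 : set (R * R)) = 0%E.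
  apply/eqP; rewrite eq_le hausdorff1_ge0 andbT -(outside_null 0).
  exact: hausdorff1_mono.
split; last first.
  by rewrite (_ : _ `\` _ = set0)//; apply/seteqP; split => // x [/ball_sub].
pose F n := Omega `&` [set x | rad + n.+1%:R^-1 <= eucl_dist c x].
have sub : Omega `\` eucl_closed_ball c rad `<=` \bigcup_n F n.
  move=> x [Ox /= /negP]; rewrite -ltNge -subr_gt0 => d0.
  exists (Num.truncn (eucl_dist c x - rad)^-1) => //; split => //=.
  rewrite -lerBrDl -[leRHS]invrK lef_pV2 ?posrE ?invr_gt0//.
  by rewrite ltW// truncnS_gt.
apply/eqP; rewrite eq_le hausdorff1_ge0 andbT.
by rewrite -(@hausdorff1_null_bigcup R F outside_null); exact: hausdorff1_mono.
Qed.
End minimal_energy.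
End equality_case.

Theorem theorem2p1 (R : realType) (lambda : R) (lambda_gt0 : 0 < lambda) :
  let Rlambda : R := 2^-1 * Num.sqrt lambda in
  (forall c : R * R, is_minimizer lambda (eucl_closed_ball c Rlambda)) /\
  (forall Omega : set (R * R), is_minimizer lambda Omega ->
     exists c : R * R, H1_equiv Omega (eucl_closed_ball c Rlambda)).
Proof.
move=> Rl; have Rl0 : 0 < Rl by rewrite mulr_gt0// sqrtr_gt0.
split=> [c|Omega [adm min]].
  split; first exact: admissible_ball.
  move=> Omega adm; exact: le_trans (energyQ_ball c lambda_gt0) (energyQ_lower lambda_gt0 adm).
have EE : (energyQ lambda Omega <= (2 * pi * Num.sqrt lambda)%:E)%E.
  exact: le_trans (min _ (admissible_ball 0 Rl0)) (energyQ_ball 0 lambda_gt0).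
by eexists; exact: (H1_equiv_ball lambda_gt0 adm EE).
Qed.
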